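(* Let $1\le p\le\infty$. Suppose that $g\in H(\mathbb{D})$ satisfies $|g'|>0$ in $\mathbb{D}$ and that $T_g\colon H^p\to H^p$ is continuous. (i) The optimal domain space $[V_g,H^p]=[T_g,H^p]$ is a Banach space isometric to $H^p$. So, $[T_g,H^p]$ is separable and uniformly convex for $p\in(1,\infty)$. In particular, $[V_g,H^p]=[T_g,H^p]$ is reflexive for $p\in(1,\infty)$. (ii) Suppose that $T_g\colon H^p\to H^p$ is not surjective. Then $H^p$ is strictly contained in $[T_g,H^p]$.
   Context: $\mathbb{D}=\{z\in\mathbb{C}:|z|<1\}$; $H(\mathbb{D})$ is the Fréchet space of all analytic functions on $\mathbb{D}$ with the topology of uniform convergence on compact sets; $H^p$ ($1\le p\le\infty$) is the classical Hardy space on $\mathbb{D}$ with norm $\|f\|_p:=\sup_{0\le r<1}\left(\frac1{2\pi}\int_0^{2\pi}|f(re^{i\theta})|^p\,d\theta\right)^{1/p}$ for $p<\infty$ and $\|f\|_\infty:=\sup_{z\in\mathbb{D}}|f(z)|$. For $g,f\in H(\mathbb{D})$, $(V_gf)(z):=\int_0^z f(\xi)g'(\xi)\,d\xi$ for $z\in\mathbb{D}$, and $(T_gf)(z):=\frac1z\int_0^z f(\xi)g'(\xi)\,d\xi$ for $z\in\mathbb{D}\setminus\{0\}$, $(T_gf)(0):=f(0)g'(0)$. For $X$ a Banach space continuously included in $H(\mathbb{D})$ and $T\colon H(\mathbb{D})\to H(\mathbb{D})$ continuous linear with $T(X)\subseteq X$, the optimal domain is $[T,X]:=\{f\in H(\mathbb{D}):Tf\in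 X\}$ with (semi-)norm $\|f\|_{[T,X]}:=\|Tf\|_X$. Saying that $T\colon X\to X$ is continuous includes that $T(X)\subseteq X$. ''Isometric'' means linearly isometrically isomorphic. *)

(* Defs.v *)
From Stdlib Require Import Reals FunctionalExtensionality.
From Coquelicot Require Import Coquelicot.

Open Scope R_scope.

Section FctModule.

Context {K : Ring} (T : Type) (V : ModuleSpace K).

Definition fct_AbelianMonoid_mixin : AbelianMonoid.mixin_of (T -> V).
Proof.
  apply (AbelianMonoid.Mixin _
    (fun f g : T -> V => fun x => plus (f x) (g x)) (fun _ => zero)).
  - intros f g; apply functional_extensionality; intro x; apply plus_comm.
  - intros f g h; apply functional_extensionality; intro x; apply plus_assoc.
  - intros f; apply functional_extensionality; intro x; apply plus_zero_r.
Defined.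

Canonical fct_AbelianMonoid : AbelianMonoid :=
  AbelianMonoid.Pack (T -> V) fct_AbelianMonoid_mixin (T -> V).

Definition fct_AbelianGroup_mixin : AbelianGroup.mixin_of fct_AbelianMonoid.
Proof.
  apply (AbelianGroup.Mixin fct_AbelianMonoid (fun f : T -> V => fun x => opp (f x))).
  intros f; apply functional_extensionality; intro x; apply (plus_opp_r (f x)).
Defined.

Canonical fct_AbelianGroup : AbelianGroup :=
  AbelianGroup.Pack (T -> V)
    (AbelianGroup.Class _ fct_AbelianMonoid_mixin fct_AbelianGroup_mixin) (T -> V).

Definition fct_ModuleSpace_mixin : ModuleSpace.mixin_of K fct_AbelianGroup.
Proof.
  apply (ModuleSpace.Mixin K fct_AbelianGroup
    (fun (a : K) (f : T -> V) => fun x => scal a (f x))).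
  - intros a b f; apply functional_extensionality; intro x; apply (scal_assoc a b (f x)).
  - intros f; apply functional_extensionality; intro x; apply (scal_one (f x)).
  - intros a f g; apply functional_extensionality; intro x;
      apply (scal_distr_l a (f x) (g x)).
  - intros a b f; apply functional_extensionality; intro x;
      apply (scal_distr_r a b (f x)).
Defined.

Canonical fct_ModuleSpace : ModuleSpace K :=
  ModuleSpace.Pack K (T -> V)
    (ModuleSpace.Class K _ (AbelianGroup.Class _ _ fct_AbelianGroup_mixin)
       fct_ModuleSpace_mixin) (T -> V).

End FctModule.

(** Raw data only: a subset of an ambient complex vector space and a candidate
    norm, whose values outside the subset are irrelevant. *)
Record nspace (E : ModuleSpace C_Ring) := NSpace {
  carrier : E -> Prop;
  nrm : E -> R
}.
Arguments NSpace {E} carrier nrm.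
Arguments carrier {E} n x.
Arguments nrm {E} n x.

Definition same_nspace {E : ModuleSpace C_Ring} (X Y : nspace E) : Prop :=
  (forall x, carrier X x <-> carrier Y x) /\
  (forall x, carrier X x -> nrm X x = nrm Y x).

Definition is_normed_space {E : ModuleSpace C_Ring} (X : nspace E) : Prop :=
  carrier X zero /\
  (forall x y, carrier X x -> carrier X y -> carrier X (plus x y)) /\
  (forall (a : C) x, carrier X x -> carrier X (scal a x)) /\
  (forall x, carrier X x -> 0 <= nrm X x) /\
  (forall x, carrier X x -> nrm X x = 0 -> x = zero) /\
  (forall (a : C) x, carrier X x -> nrm X (scal a x) = Cmod a * nrm X x) /\
  (forall x y, carrier X x -> carrier X y ->
     nrm X (plus x y) <= nrm X x + nrm X y).

Definition is_complete {E : ModuleSpace C_Ring} (X : nspace E) : Prop :=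
  forall u : nat -> E,
    (forall n, carrier X (u n)) ->
    (forall eps, 0 < eps -> exists N : nat, forall m n : nat,
       (N <= m)%nat -> (N <= n)%nat -> nrm X (minus (u m) (u n)) < eps) ->
    exists l, carrier X l /\
      forall eps, 0 < eps -> exists N : nat, forall n : nat,
        (N <= n)%nat -> nrm X (minus (u n) l) < eps.

Definition is_banach {E : ModuleSpace C_Ring} (X : nspace E) : Prop :=
  is_normed_space X /\ is_complete X.

Definition linear_on {E F : ModuleSpace C_Ring} (X : nspace E) (U : E -> F) : Prop :=
  (forall x y, carrier X x -> carrier X y -> U (plus x y) = plus (U x) (U y)) /\
  (forall (a : C) x, carrier X x -> U (scal a x) = scal a (U x)).

Definition maps_into {E F : ModuleSpace C_Ring} (X : nspace E) (Y : nspace F)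
    (U : E -> F) : Prop :=
  forall x, carrier X x -> carrier Y (U x).

Definition maps_onto {E F : ModuleSpace C_Ring} (X : nspace E) (Y : nspace F)
    (U : E -> F) : Prop :=
  forall y, carrier Y y -> exists x, carrier X x /\ U x = y.

Definition isometric {E F : ModuleSpace C_Ring} (X : nspace E) (Y : nspace F) : Prop :=
  exists U : E -> F,
    linear_on X U /\ maps_into X Y U /\ maps_onto X Y U /\
    (forall x y, carrier X x -> carrier X y -> U x = U y -> x = y) /\
    (forall x, carrier X x -> nrm Y (U x) = nrm X x).

Definition continuous_between {E F : ModuleSpace C_Ring} (X : nspace E) (Y : nspace F)
    (U : E -> F) : Prop :=
  maps_into X Y U /\
  forall x, carrier X x -> forall eps, 0 < eps ->
    exists delta, 0 < delta /\
      forall y, carrier X y -> nrm X (minus y x) < delta ->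
        nrm Y (minus (U y) (U x)) < eps.

Definition separable {E : ModuleSpace C_Ring} (X : nspace E) : Prop :=
  exists u : nat -> E,
    (forall n, carrier X (u n)) /\
    (forall x, carrier X x -> forall eps, 0 < eps ->
       exists n, nrm X (minus x (u n)) < eps).

Definition uniformly_convex {E : ModuleSpace C_Ring} (X : nspace E) : Prop :=
  forall eps, 0 < eps <= 2 ->
    exists delta, 0 < delta /\
      forall x y, carrier X x -> carrier X y ->
        nrm X x = 1 -> nrm X y = 1 -> eps <= nrm X (minus x y) ->
        nrm X (scal (RtoC (/ 2)) (plus x y)) <= 1 - delta.

(** Functionals are extended by 0 off the carrier, so that equality in the dual
    is Leibniz equality. *)
Definition dual {E : ModuleSpace C_Ring} (X : nspace E) :
    nspace (fct_ModuleSpace E C_ModuleSpace) :=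
  NSpace (E := fct_ModuleSpace E C_ModuleSpace)
    (fun phi : E -> C =>
       linear_on X (F := C_ModuleSpace) phi /\
       (exists M : R, forall x, carrier X x -> Cmod (phi x) <= M * nrm X x) /\
       (forall x, ~ carrier X x -> phi x = RtoC 0))
    (fun phi : E -> C =>
       real (Lub_Rbar (fun t : R =>
         exists x, carrier X x /\ nrm X x <= 1 /\ t = Cmod (phi x)))).

Definition reflexive_space {E : ModuleSpace C_Ring} (X : nspace E) : Prop :=
  forall L : (E -> C) -> C, carrier (dual (dual X)) L ->
    exists x, carrier X x /\
      forall phi : E -> C, carrier (dual X) phi -> L phi = phi x.

Definition unit_disc (z : C) : Prop := Cmod z < 1.

(** Functions on the disc are represented by functions on [C] that vanish off
    the disc, so that equality in H(D) is Leibniz equality. *)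
Definition holomorphic_disc (f : C -> C) : Prop :=
  (forall z, unit_disc z -> ex_derive (K := C_AbsRing) (V := C_NormedModule) f z) /\
  (forall z, ~ unit_disc z -> f z = RtoC 0).

(** [Rpower 0 p] is 1 in the standard library. *)
Definition rpow (x p : R) : R :=
  if Req_EM_T x 0 then 0 else Rpower x p.

Definition circle_point (r theta : R) : C := (r * cos theta, r * sin theta).

Definition integral_mean (p : R) (f : C -> C) (r : R) : R :=
  rpow (/ (2 * PI) *
        RInt (fun theta => rpow (Cmod (f (circle_point r theta))) p) 0 (2 * PI))
    (/ p).

(** Extended-valued; the value [m_infty] of the exponent is never used. *)
Definition hardy_norm (p : Rbar) (f : C -> C) : Rbar :=
  match p with
  | Finite q =>
      Lub_Rbar (fun t : R => exists r, 0 <= r < 1 /\ t = integral_mean q f r)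
  | _ => Lub_Rbar (fun t : R => exists z, unit_disc z /\ t = Cmod (f z))
  end.

Definition Hardy (p : Rbar) : nspace (fct_ModuleSpace C C_ModuleSpace) :=
  NSpace (E := fct_ModuleSpace C C_ModuleSpace)
    (fun f : C -> C => holomorphic_disc f /\ is_finite (hardy_norm p f))
    (fun f : C -> C => real (hardy_norm p f)).

(** The integral from 0 to [z] along the segment [t |-> t z]. *)
Definition segment_integral (h : C -> C) (z : C) : C :=
  RInt (V := C_R_CompleteNormedModule)
    (fun t : R => (h (RtoC t * z) * z)%C) 0 1.

Definition V_op (g f : C -> C) : C -> C := fun z =>
  if Rlt_dec (Cmod z) 1
  then segment_integral (fun xi => (f xi * C_derive g xi)%C) z
  else RtoC 0.

Definition T_op (g f : C -> C) : C -> C := fun z =>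
  if Req_EM_T (Cmod z) 0 then (f (RtoC 0) * C_derive g (RtoC 0))%C
  else (/ z * V_op g f z)%C.

Definition optimal_domain (T : (C -> C) -> C -> C)
    (X : nspace (fct_ModuleSpace C C_ModuleSpace)) :
    nspace (fct_ModuleSpace C C_ModuleSpace) :=
  NSpace (E := fct_ModuleSpace C C_ModuleSpace)
    (fun f : C -> C => holomorphic_disc f /\ carrier X (T f))
    (fun f : C -> C => nrm X (T f)).

(* Main.v *)
(** Given [h] in H(D), the only [f] in H(D) with [T_g f = h] is [f = (z h)' / g'].  Hence [T_g] is
    a linear isometry of [[T_g, H^p]] onto [H^p], and all assertions are about [H^p].  Since
    [V_g f = z T_g f], the two optimal domains agree because multiplication by [z] preserves the
    [H^p] norm: integral means increase with the radius, by the Poisson formula and Jensen.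

    For [1 < p < oo] everything follows from one pointwise inequality,
    [|a - b|^p <= e (|a|^p + |b|^p) + K ((|a|^p + |b|^p) / 2 - |(a + b) / 2|^p)].
    Integrated over circles it gives uniform convexity, and also the norm convergence of the
    dilations [f (s z)] to [f] as [s -> 1], hence the density of polynomials.

    Reflexivity needs no Hahn-Banach theorem: uniform convexity of [X] makes the norm of its dual
    uniformly smooth, so if [phi_n] nearly norms [L] and [x_n] nearly norms [phi_n], then
    [||L|| x_n], seen in the bidual, converges to [L], and [x_n] converges in [X]. *)

Require Import Defs.
From Stdlib Require Import Reals.
From Coquelicot Require Import Coquelicot.
From Stdlib Require Import Lra Lia Psatz FunctionalExtensionality Classical ClassicalEpsilon.
From Stdlib Require Cantor.

Open Scope R_scope.

(** Boundary values on the unit circle never appear; everything is done on circles of radius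
    [r < 1]. The obstacle is that the norm is a supremum over [r], while the integrated midpoint
    inequality holds on one circle at a time and contains the mean of the midpoint with a minus
    sign. A supremum only gives a lower bound for that mean on some circle [r0]. Since the means
    increase with the radius, the lower bound persists for all [r >= r0], and these circles already
    determine the norm. For the same reason norms are handled through the upper bounds
    [hardy_le p f t], which also put [p = oo] beside finite [p].

    The function theory starts from Goursat's theorem on rectangles. The exponential turns it into a
    statement about means over circles, and the formulas of Cauchy, Poisson and Taylor are all
    equalities between such means. Differentiating under the mean shows that derivatives are
    holomorphic, which is what makes [(z h)' / g'] an element of H(D). *)

Lemma Cmod_minus_sym (a b : C) : Cmod (a - b) = Cmod (b - a).
Proof. rewrite <- Cmod_opp. f_equal. ring. Qed.

Lemma Cmod_triangle_minus (a b c : C) : Cmod (a - c) <= Cmod (a - b) + Cmod (b - c).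
Proof. replace (a - c)%C with ((a - b) + (b - c))%C by ring. apply Cmod_triangle. Qed.

Lemma Cmod_sub_le (a b : C) : Cmod (a - b) <= Cmod a + Cmod b.
Proof. unfold Cminus. eapply Rle_trans; [apply Cmod_triangle|]. rewrite Cmod_opp. lra. Qed.

Lemma Cmod_sub_ge (a b : C) : Cmod a - Cmod b <= Cmod (a - b).
Proof.
  assert (H := Cmod_triangle (a - b) b).
  replace (a - b + b)%C with a in H by ring. lra.
Qed.

Lemma Cmod_fst_le (z : C) : Rabs (fst z) <= Cmod z.
Proof. eapply Rle_trans; [apply Rmax_l|apply Rmax_Cmod]. Qed.

Lemma Cmod_snd_le (z : C) : Rabs (snd z) <= Cmod z.
Proof. eapply Rle_trans; [apply Rmax_r|apply Rmax_Cmod]. Qed.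

Lemma Cmod_le_add (z : C) : Cmod z <= Rabs (fst z) + Rabs (snd z).
Proof.
  destruct z as [x y]. unfold Cmod; simpl fst; simpl snd.
  assert (Hx := Rabs_pos x). assert (Hy := Rabs_pos y).
  rewrite <- (sqrt_Rsqr (Rabs x + Rabs y)) by lra.
  apply sqrt_le_1_alt. rewrite <- (pow2_abs x), <- (pow2_abs y). unfold Rsqr. nra.
Qed.

Lemma Cmod_RtoC (x : R) : 0 <= x -> Cmod (RtoC x) = x.
Proof. intros. rewrite Cmod_R. now apply Rabs_pos_eq. Qed.

Lemma Cmod_pos_neq (z : C) : 0 < Cmod z -> z <> RtoC 0.
Proof. apply Cmod_gt_0. Qed.

Lemma Cmod_eq0_sub (a b : C) : Cmod (a - b) = 0 -> a = b.
Proof. intros H. apply Cmod_eq_0 in H. now apply Ceq_minus. Qed.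

Lemma RtoC_neq (x : R) : x <> 0 -> RtoC x <> RtoC 0.
Proof. intros H E. apply H. now apply RtoC_inj. Qed.

Lemma Ceps_eq (a b : C) : (forall e, 0 < e -> Cmod (a - b) <= e) -> a = b.
Proof.
  intros H. apply Cmod_eq0_sub.
  destruct (Rle_lt_or_eq_dec _ _ (Cmod_ge_0 (a - b))) as [h|h]; [|now symmetry].
  specialize (H (Cmod (a-b) / 2) ltac:(lra)). lra.
Qed.

Lemma Rlt_Rmin (x a b : R) : x < Rmin a b -> x < a /\ x < b.
Proof. intros H. split; eapply Rlt_le_trans; eauto using Rmin_l, Rmin_r. Qed.

Lemma le_eps (a b : R) : (forall e, 0 < e -> a <= b + e) -> a <= b.
Proof. intros H. apply Rnot_lt_le. intros h. specialize (H ((a-b)/2) ltac:(lra)). lra. Qed.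

Lemma Cmod_mult_conj (z : C) : (z * Cconj z)%C = RtoC (Cmod z * Cmod z).
Proof. rewrite <- Cmod2_conj. f_equal. ring. Qed.

(** A unimodular factor turns a modulus into a real part, so bounds for integrals and functionals
    need only be proved for real parts. *)
Lemma exists_rotation (w : C) : exists c : C, Cmod c = 1 /\ (c * w)%C = RtoC (Cmod w).
Proof.
  destruct (Ceq_dec w 0) as [->|n].
  - exists 1. rewrite Cmod_1, Cmod_0. split; [reflexivity|ring].
  - assert (Hm : 0 < Cmod w) by now apply Cmod_gt_0.
    assert (Hn : RtoC (Cmod w) <> 0) by (apply RtoC_neq; lra).
    exists (Cconj w / RtoC (Cmod w))%C. split.
    + rewrite Cmod_div, Cmod_conj, Cmod_RtoC by (auto; lra). field; lra.
    + replace (Cconj w / RtoC (Cmod w) * w)%C with ((w * Cconj w) / RtoC (Cmod w))%C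
        by (field; auto).
      rewrite Cmod_mult_conj, RtoC_mult. field; auto.
Qed.

(** * Complex differentiability *)

(** The increment is multiplied out, so there is no division by [w - z] and the point [w = z] needs
    no exception. *)
Definition cdiff (f : C -> C) (z l : C) : Prop :=
  forall e, 0 < e -> exists d, 0 < d /\ forall w, Cmod (w - z) < d ->
    Cmod (f w - f z - l * (w - z)) <= e * Cmod (w - z).

Definition ccont (f : C -> C) (z : C) : Prop :=
  forall e, 0 < e -> exists d, 0 < d /\ forall w, Cmod (w - z) < d -> Cmod (f w - f z) < e.

Lemma is_derive_cdiff (f : C -> C) (z l : C) :
  is_derive (K := C_AbsRing) (V := AbsRing_NormedModule C_AbsRing) f z l <-> cdiff f z l.
Proof.
  assert (E : forall w, minus (minus (f w) (f z)) (scal (minus w z) l : C_AbsRing)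
    = (f w - f z - l * (w - z))%C).
  { intros w. change ((f w - f z - (w - z) * l)%C = (f w - f z - l * (w - z))%C). ring. }
  split.
  - intros [_ H] e He.
    destruct (H z (fun P HP => HP) (mkposreal e He)) as [[d Hd] K]. exists d. split; [exact Hd|].
    intros w Hw. rewrite <- E. exact (K w Hw).
  - intros H. split; [apply is_linear_scal_l|]. intros x Hx.
    apply (is_filter_lim_locally_unique (V := AbsRing_NormedModule C_AbsRing)) in Hx. subst x.
    intros [e He]. destruct (H e He) as [d [Hd K]]. exists (mkposreal d Hd). intros w Hw.
    specialize (K w Hw). rewrite <- E in K. exact K.
Qed.

(** [holomorphic_disc] speaks of [C_NormedModule], whereas the product and chain rules are applied
    over [AbsRing_NormedModule C_AbsRing]. The two derivative estimates agree up to conversion, and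
    [cdiff] is the bridge. *)
Lemma is_derive_C_cdiff (f : C -> C) (z l : C) :
  is_derive (K := C_AbsRing) (V := C_NormedModule) f z l <-> cdiff f z l.
Proof.
  rewrite <- is_derive_cdiff. split; intros [_ H]; (split; [apply is_linear_scal_l|exact H]).
Qed.

Lemma cdiff_C_derive (f : C -> C) (z l : C) : cdiff f z l -> C_derive f z = l.
Proof. intros H. apply is_C_derive_unique. now apply is_derive_C_cdiff. Qed.

Lemma ex_derive_cdiff (f : C -> C) (z : C) :
  ex_derive (K := C_AbsRing) (V := C_NormedModule) f z -> cdiff f z (C_derive f z).
Proof. intros H. apply is_derive_C_cdiff. now apply C_derive_correct. Qed.

Lemma cdiff_ex_derive (f : C -> C) (z l : C) :
  cdiff f z l -> ex_derive (K := C_AbsRing) (V := C_NormedModule) f z.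
Proof. intros H. exists l. now apply is_derive_C_cdiff. Qed.

Lemma cdiff_ccont f z l : cdiff f z l -> ccont f z.
Proof.
  intros H e He. destruct (H 1 Rlt_0_1) as [d [Hd H1]].
  assert (Hl := Cmod_ge_0 l).
  exists (Rmin d (e / (2 + Cmod l))). split.
  - apply Rmin_pos; auto. apply Rdiv_lt_0_compat; lra.
  - intros w Hw.
    destruct (Rlt_Rmin _ _ _ Hw) as [h1 h2].
    specialize (H1 w h1).
    replace (f w - f z)%C with ((f w - f z - l * (w - z)) + l * (w - z))%C by ring.
    eapply Rle_lt_trans; [apply Cmod_triangle|]. rewrite Cmod_mult.
    assert (Cmod (w - z) * (2 + Cmod l) < e).
    { apply Rlt_div_r in h2; lra. }
    assert (Hw0 := Cmod_ge_0 (w - z)). nra.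
Qed.

Lemma cdiff_ext_loc f g z l r : 0 < r -> (forall w, Cmod (w - z) < r -> f w = g w) ->
  cdiff f z l -> cdiff g z l.
Proof.
  intros Hr E H e He. destruct (H e He) as [d [Hd H1]].
  exists (Rmin d r). split; [now apply Rmin_pos|].
  intros w Hw.
  destruct (Rlt_Rmin _ _ _ Hw) as [h1 h2].
  rewrite <- (E w h2), <- (E z). auto.
  replace (z - z)%C with (RtoC 0) by ring. rewrite Cmod_0; lra.
Qed.

Lemma cdiff_eq f z l m : cdiff f z l -> l = m -> cdiff f z m.
Proof. now intros H <-. Qed.

Lemma cdiff_const c z : cdiff (fun _ => c) z (RtoC 0).
Proof. apply is_derive_cdiff. apply @is_derive_const. Qed.

Lemma cdiff_id z : cdiff (fun w => w) z (RtoC 1).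
Proof. apply is_derive_cdiff. apply @is_derive_id. Qed.

Lemma cdiff_plus f g z l m : cdiff f z l -> cdiff g z m ->
  cdiff (fun w => f w + g w)%C z (l + m)%C.
Proof. rewrite <- !is_derive_cdiff. apply @is_derive_plus. Qed.

Lemma cdiff_mult f g z l m : cdiff f z l -> cdiff g z m ->
  cdiff (fun w => f w * g w)%C z (l * g z + f z * m)%C.
Proof.
  rewrite <- !is_derive_cdiff. intros Hf Hg.
  exact (is_derive_mult (K := C_AbsRing) f g z l m Hf Hg Cmult_comm).
Qed.

Lemma cdiff_scal c f z l : cdiff f z l -> cdiff (fun w => c * f w)%C z (c * l)%C.
Proof.
  intros H. replace (c * l)%C with (0 * f z + c * l)%C by ring.
  apply (cdiff_mult (fun _ => c)); auto. apply cdiff_const.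
Qed.

Lemma cdiff_minus f g z l m : cdiff f z l -> cdiff g z m ->
  cdiff (fun w => f w - g w)%C z (l - m)%C.
Proof. rewrite <- !is_derive_cdiff. apply @is_derive_minus. Qed.

Lemma cdiff_comp f g z l m : cdiff g z l -> cdiff f (g z) m ->
  cdiff (fun w => f (g w)) z (m * l)%C.
Proof.
  rewrite <- !is_derive_cdiff, Cmult_comm. intros Hg Hf.
  exact (is_derive_comp (V := AbsRing_NormedModule C_AbsRing) f g z m l Hf Hg).
Qed.

(** The remainder is exactly [(w - z)^2 / (z^2 w)]. The radius [r / 2] keeps [Cmod w >= r / 2], and
    [e r^3 / 2] then makes the remainder at most [e * Cmod (w - z)]. *)
Lemma cdiff_Cinv z : z <> RtoC 0 -> cdiff Cinv z (- / (z * z))%C.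
Proof.
  intros Hz e He.
  assert (H0 : 0 < Cmod z) by now apply Cmod_gt_0.
  set (r := Cmod z) in *.
  exists (Rmin (r/2) (e * r ^ 3 / 2)). split.
  - apply Rmin_pos; [lra|]. apply Rdiv_lt_0_compat; [|lra].
    apply Rmult_lt_0_compat; auto. now apply pow_lt.
  - intros w Hw.
    destruct (Rlt_Rmin _ _ _ Hw) as [h1 h2].
    assert (Hwm : r/2 <= Cmod w).
    { assert (h := Cmod_sub_ge z w). rewrite Cmod_minus_sym in h. fold r in h. lra. }
    assert (Hw0 : w <> RtoC 0) by (apply Cmod_pos_neq; lra).
    replace (/ w - / z - - / (z * z) * (w - z))%C with ((w - z) * (w - z) / (z * z * w))%C
      by (field; auto).
    rewrite Cmod_div by (repeat apply Cmult_neq_0; auto).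
    rewrite !Cmod_mult. fold r.
    apply (Rmult_le_reg_r (r * r * Cmod w)).
    { repeat apply Rmult_lt_0_compat; lra. }
    unfold Rdiv. rewrite Rmult_assoc, Rinv_l, Rmult_1_r.
    2: { apply Rgt_not_eq. repeat apply Rmult_lt_0_compat; lra. }
    assert (Hp := Cmod_ge_0 (w - z)).
    rewrite (Rmult_comm e), (Rmult_assoc (Cmod (w - z))).
    apply Rmult_le_compat_l; auto.
    assert (e * (r * r * Cmod w) >= e * r^3 / 2); [|lra].
    assert (r * r * (r/2) <= r * r * Cmod w) by (apply Rmult_le_compat_l; nra).
    simpl. nra.
Qed.

Lemma cdiff_inv f z l : cdiff f z l -> f z <> RtoC 0 ->
  cdiff (fun w => / f w)%C z (- / (f z * f z) * l)%C.
Proof. intros H Hf. apply (cdiff_comp Cinv f); auto. now apply cdiff_Cinv. Qed.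

Lemma cdiff_div f g z l m : cdiff f z l -> cdiff g z m -> g z <> RtoC 0 ->
  cdiff (fun w => f w / g w)%C z ((l * g z - f z * m) / (g z * g z))%C.
Proof.
  intros Hf Hg Hz.
  replace ((l * g z - f z * m) / (g z * g z))%C with
    (l * / g z + f z * (- / (g z * g z) * m))%C by (field; auto).
  apply (cdiff_mult f (fun w => / g w)%C); auto. now apply cdiff_inv.
Qed.

(* The value type of [RInt] is a module structure, which [ring] does not recognize as [R]. *)
Ltac eq_in_R := match goal with |- @eq _ ?a ?b => change (@eq R a b) end.

(** * Integrals of complex functions of a real variable *)

Definition rcont (u : R -> R) (t : R) : Prop :=
  continuous (T := R_UniformSpace) (U := R_UniformSpace) u t.

Lemma rcont_const c t : rcont (fun _ => c) t.
Proof. apply continuous_const. Qed.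
Lemma rcont_id t : rcont (fun s => s) t.
Proof. apply continuous_id. Qed.
Lemma rcont_plus u v t : rcont u t -> rcont v t -> rcont (fun s => u s + v s) t.
Proof. apply (continuous_plus (V := R_NormedModule)). Qed.
Lemma rcont_opp u t : rcont u t -> rcont (fun s => - u s) t.
Proof. apply (continuous_opp (V := R_NormedModule)). Qed.
Lemma rcont_minus u v t : rcont u t -> rcont v t -> rcont (fun s => u s - v s) t.
Proof. intros. apply rcont_plus; auto. now apply rcont_opp. Qed.
Lemma rcont_mult u v t : rcont u t -> rcont v t -> rcont (fun s => u s * v s) t.
Proof. apply (continuous_mult (K := R_AbsRing)). Qed.
Lemma rcont_inv u t : rcont u t -> u t <> 0 -> rcont (fun s => / u s) t.
Proof. apply continuous_Rinv_comp. Qed.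
Lemma rcont_comp u v t : rcont v t -> rcont u (v t) -> rcont (fun s => u (v s)) t.
Proof. apply continuous_comp. Qed.
Lemma rcont_cos t : rcont cos t.
Proof. apply continuity_pt_filterlim, continuity_cos. Qed.
Lemma rcont_sin t : rcont sin t.
Proof. apply continuity_pt_filterlim, continuity_sin. Qed.

Lemma rcont_eps u t : rcont u t <->
  forall e, 0 < e -> exists d, 0 < d /\ forall s, Rabs (s - t) < d -> Rabs (u s - u t) < e.
Proof.
  split.
  - intros H e He.
    assert (K := proj1 (filterlim_locally u (u t)) H (mkposreal e He)).
    destruct K as [[d Hd] K].
    exists d. split; [exact Hd|]. intros s Hs. apply K. exact Hs.
  - intros H. apply filterlim_locally. intros [e He].
    destruct (H e He) as [d [Hd K]]. exists (mkposreal d Hd). intros s Hs. apply K. exact Hs.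
Qed.

(** Componentwise, because integrals are taken componentwise; [ccurve_eps] gives the equivalent form
    with the modulus. *)
Definition ccurve (f : R -> C) (t : R) : Prop :=
  rcont (fun s => fst (f s)) t /\ rcont (fun s => snd (f s)) t.

Lemma ccurve_eps f t : ccurve f t <->
  forall e, 0 < e -> exists d, 0 < d /\ forall s, Rabs (s - t) < d -> Cmod (f s - f t) < e.
Proof.
  unfold ccurve. rewrite !rcont_eps. split.
  - intros [H1 H2] e He.
    destruct (H1 (e/2) ltac:(lra)) as [d1 [Hd1 K1]].
    destruct (H2 (e/2) ltac:(lra)) as [d2 [Hd2 K2]].
    exists (Rmin d1 d2). split; [now apply Rmin_pos|]. intros s Hs.
    destruct (Rlt_Rmin _ _ _ Hs) as [Hs1 Hs2].
    specialize (K1 s Hs1). specialize (K2 s Hs2).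
    eapply Rle_lt_trans; [apply Cmod_le_add|]. simpl. unfold Rminus in *. lra.
  - intros H; split; intros e He; destruct (H e He) as [d [Hd K]]; exists d; split; auto;
    intros s Hs; specialize (K s Hs); eapply Rle_lt_trans; try exact K.
    + apply (Cmod_fst_le (f s - f t)%C).
    + apply (Cmod_snd_le (f s - f t)%C).
Qed.

Lemma ccurve_const c t : ccurve (fun _ => c) t.
Proof. split; apply rcont_const. Qed.
Lemma ccurve_RtoC u t : rcont u t -> ccurve (fun s => RtoC (u s)) t.
Proof. split; simpl; auto. apply rcont_const. Qed.
Lemma ccurve_minus f g t : ccurve f t -> ccurve g t -> ccurve (fun s => f s - g s)%C t.
Proof. intros [? ?] [? ?]; split; simpl; now apply rcont_minus. Qed.
Lemma ccurve_mult f g t : ccurve f t -> ccurve g t -> ccurve (fun s => f s * g s)%C t.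
Proof.
  intros [? ?] [? ?]; split; simpl;
  [apply rcont_minus|apply rcont_plus]; now apply rcont_mult.
Qed.
Lemma ccurve_comp f g t : ccurve g t -> ccont f (g t) -> ccurve (fun s => f (g s)) t.
Proof.
  rewrite !ccurve_eps. intros Hg Hf e He.
  destruct (Hf e He) as [d [Hd K]]. destruct (Hg d Hd) as [d' [Hd' K']].
  exists d'. split; auto.
Qed.
Lemma ccurve_inv f t : ccurve f t -> f t <> RtoC 0 -> ccurve (fun s => / f s)%C t.
Proof.
  intros H Hf. apply (ccurve_comp Cinv f); auto.
  eapply cdiff_ccont. now apply cdiff_Cinv.
Qed.
Lemma ccurve_div f g t : ccurve f t -> ccurve g t -> g t <> RtoC 0 ->
  ccurve (fun s => f s / g s)%C t.
Proof. intros. apply ccurve_mult; auto. now apply ccurve_inv. Qed.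
Lemma rcont_Cmod f t : ccurve f t -> rcont (fun s => Cmod (f s)) t.
Proof.
  rewrite ccurve_eps, rcont_eps. intros H e He.
  destruct (H e He) as [d [Hd K]]. exists d. split; auto.
  intros s Hs. specialize (K s Hs).
  assert (h := Cmod_sub_ge (f s) (f t)). assert (h' := Cmod_sub_ge (f t) (f s)).
  rewrite Cmod_minus_sym in h'.
  apply Rabs_lt_between. lra.
Qed.

Lemma ex_RInt_rcont u a b : a <= b -> (forall t, a <= t <= b -> rcont u t) -> ex_RInt u a b.
Proof.
  intros Hab H. apply (ex_RInt_continuous (V := R_CompleteNormedModule)).
  rewrite Rmin_left, Rmax_right by auto. exact H.
Qed.

(** A pair of real integrals, so that the real theory of [RInt] applies; [RInt_Cint] identifies it
    with the integral used in [segment_integral]. *)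
Definition Cint (f : R -> C) (a b : R) : C :=
  (RInt (fun t => fst (f t)) a b, RInt (fun t => snd (f t)) a b).

Definition ccurve_on (f : R -> C) (a b : R) : Prop := forall t, a <= t <= b -> ccurve f t.

Lemma ccurve_on_ex_fst f a b : a <= b -> ccurve_on f a b -> ex_RInt (fun t => fst (f t)) a b.
Proof. intros Hab H. apply ex_RInt_rcont; auto. intros t Ht. apply (H t Ht). Qed.
Lemma ccurve_on_ex_snd f a b : a <= b -> ccurve_on f a b -> ex_RInt (fun t => snd (f t)) a b.
Proof. intros Hab H. apply ex_RInt_rcont; auto. intros t Ht. apply (H t Ht). Qed.

Lemma Cint_ext f g a b : a <= b -> (forall t, a <= t <= b -> f t = g t) ->
  Cint f a b = Cint g a b.
Proof.
  intros Hab H. unfold Cint. f_equal; apply RInt_ext; rewrite Rmin_left, Rmax_right by auto;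
  intros t Ht; rewrite H; auto; lra.
Qed.

Lemma Cint_plus f g a b : a <= b -> ccurve_on f a b -> ccurve_on g a b ->
  Cint (fun t => f t + g t)%C a b = (Cint f a b + Cint g a b)%C.
Proof.
  intros Hab Hf Hg. unfold Cint, Cplus; simpl fst; simpl snd. f_equal.
  - apply (RInt_plus (V := R_CompleteNormedModule)); now apply ccurve_on_ex_fst.
  - apply (RInt_plus (V := R_CompleteNormedModule)); now apply ccurve_on_ex_snd.
Qed.

Lemma RInt_lin2 (u v : R -> R) (x y a b : R) : ex_RInt u a b -> ex_RInt v a b ->
  RInt (fun t => x * u t + y * v t) a b = x * RInt u a b + y * RInt v a b.
Proof.
  intros Hu Hv.
  rewrite (RInt_plus (V := R_CompleteNormedModule) (fun t => x * u t) (fun t => y * v t)).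
  - change (RInt (fun t => x * u t) a b + RInt (fun t => y * v t) a b
      = x * RInt u a b + y * RInt v a b).
    apply f_equal2; [apply (RInt_scal (V := R_CompleteNormedModule) u a b x Hu)
                    |apply (RInt_scal (V := R_CompleteNormedModule) v a b y Hv)].
  - now apply (ex_RInt_scal (V := R_NormedModule)).
  - now apply (ex_RInt_scal (V := R_NormedModule)).
Qed.

Lemma Cint_scal c f a b : a <= b -> ccurve_on f a b ->
  Cint (fun t => c * f t)%C a b = (c * Cint f a b)%C.
Proof.
  intros Hab Hf. unfold Cint, Cmult; simpl fst; simpl snd.
  assert (H1 := ccurve_on_ex_fst _ _ _ Hab Hf). assert (H2 := ccurve_on_ex_snd _ _ _ Hab Hf).
  f_equal.
  - transitivity (RInt (fun t => fst c * fst (f t) + (- snd c) * snd (f t)) a b).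
    + apply RInt_ext; intros t _. change (fst c * fst (f t) - snd c * snd (f t)
        = fst c * fst (f t) + - snd c * snd (f t)). ring.
    + rewrite RInt_lin2; auto. eq_in_R. ring.
  - rewrite RInt_lin2; auto.
Qed.

Lemma Cint_minus f g a b : a <= b -> ccurve_on f a b -> ccurve_on g a b ->
  Cint (fun t => f t - g t)%C a b = (Cint f a b - Cint g a b)%C.
Proof.
  intros Hab Hf Hg.
  rewrite <- (Cint_ext (fun t => f t + (-(1)) * g t)%C) by (auto; intros; ring).
  rewrite Cint_plus, Cint_scal; auto.
  - ring.
  - intros t Ht. apply ccurve_mult; [apply ccurve_const|now apply Hg].
Qed.

Lemma RInt_const_R (c a b : R) : RInt (fun _ => c) a b = (b - a) * c.
Proof. exact (RInt_const (V := R_CompleteNormedModule) a b c). Qed.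

Lemma Cint_const c a b : Cint (fun _ => c) a b = (RtoC (b - a) * c)%C.
Proof.
  unfold Cint. rewrite !RInt_const_R. apply injective_projections; simpl; ring.
Qed.

Lemma Cint_Chasles f a b c : a <= b -> b <= c -> ccurve_on f a c ->
  Cint f a c = (Cint f a b + Cint f b c)%C.
Proof.
  intros Hab Hbc Hf.
  assert (H1 : ccurve_on f a b) by (intros t Ht; apply Hf; lra).
  assert (H2 : ccurve_on f b c) by (intros t Ht; apply Hf; lra).
  unfold Cint, Cplus; simpl fst; simpl snd. f_equal; symmetry.
  - apply (RInt_Chasles (V := R_CompleteNormedModule)); now apply ccurve_on_ex_fst.
  - apply (RInt_Chasles (V := R_CompleteNormedModule)); now apply ccurve_on_ex_snd.
Qed.

(** After a rotation the integral has its modulus as real part, and the real part of the rotated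
    integrand is at most [u]. *)
Lemma Cint_Cmod_le f u a b : a <= b -> ccurve_on f a b -> ex_RInt u a b ->
  (forall t, a <= t <= b -> Cmod (f t) <= u t) -> Cmod (Cint f a b) <= RInt u a b.
Proof.
  intros Hab Hf Hu H.
  destruct (exists_rotation (Cint f a b)) as [c [Hc E]].
  assert (Hcf : ccurve_on (fun t => c * f t)%C a b).
  { intros t Ht. apply ccurve_mult; [apply ccurve_const|now apply Hf]. }
  rewrite <- Cint_scal in E by auto. apply (f_equal fst) in E. simpl fst at 2 in E. rewrite <- E.
  apply RInt_le; auto.
  - now apply (ccurve_on_ex_fst (fun t => c * f t)%C).
  - intros t Ht. eapply Rle_trans; [apply Rle_abs|].
    eapply Rle_trans; [apply (Cmod_fst_le (c * f t)%C)|].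
    rewrite Cmod_mult, Hc, Rmult_1_l. apply H. lra.
Qed.

Lemma Cint_bound f M a b : a <= b -> ccurve_on f a b ->
  (forall t, a <= t <= b -> Cmod (f t) <= M) -> Cmod (Cint f a b) <= (b - a) * M.
Proof.
  intros Hab Hf H.
  rewrite <- RInt_const_R.
  apply Cint_Cmod_le; auto. apply ex_RInt_const.
Qed.

(** * Means over a full period *)

Definition rmean (u : R -> R) : R := / (2 * PI) * RInt u 0 (2 * PI).
Definition cmean (f : R -> C) : C := (RtoC (/ (2 * PI)) * Cint f 0 (2 * PI))%C.

Definition rcontinuous (u : R -> R) := forall t, rcont u t.
Definition ccontinuous (f : R -> C) := forall t, ccurve f t.

Lemma rcontinuous_lin u v x y : rcontinuous u -> rcontinuous v ->
  rcontinuous (fun t => x * u t + y * v t).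
Proof.
  intros Hu Hv t. exact (rcont_plus _ _ t (rcont_mult _ u t (rcont_const x t) (Hu t))
    (rcont_mult _ v t (rcont_const y t) (Hv t))).
Qed.

Lemma two_PI_pos : 0 < 2 * PI.
Proof. assert (h := PI_RGT_0). lra. Qed.

Lemma ex_RInt_rcontinuous u a b : rcontinuous u -> ex_RInt u a b.
Proof. intros H. apply (ex_RInt_continuous (V := R_CompleteNormedModule)). intros; apply H. Qed.

Lemma rmean_ext u v : (forall t, u t = v t) -> rmean u = rmean v.
Proof. intros H. f_equal. now apply functional_extensionality. Qed.

Lemma rmean_le u v : rcontinuous u -> rcontinuous v -> (forall t, u t <= v t) ->
  rmean u <= rmean v.
Proof.
  intros Hu Hv H. unfold rmean. apply Rmult_le_compat_l.
  - apply Rlt_le, Rinv_0_lt_compat, two_PI_pos.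
  - apply RInt_le; auto using ex_RInt_rcontinuous. apply Rlt_le, two_PI_pos.
Qed.

Lemma rmean_lin u v x y : rcontinuous u -> rcontinuous v ->
  rmean (fun t => x * u t + y * v t) = x * rmean u + y * rmean v.
Proof.
  intros Hu Hv. unfold rmean. rewrite RInt_lin2 by (now apply ex_RInt_rcontinuous). ring.
Qed.

Lemma rmean_const c : rmean (fun _ => c) = c.
Proof.
  unfold rmean. rewrite RInt_const_R.
  assert (h := two_PI_pos). field. lra.
Qed.

Lemma rmean_scal u c : rcontinuous u -> rmean (fun t => c * u t) = c * rmean u.
Proof.
  intros H. rewrite <- (rmean_ext (fun t => c * u t + 0 * u t)) by (intros; ring).
  rewrite rmean_lin by auto. ring.
Qed.

Lemma rmean_ge_0 u : rcontinuous u -> (forall t, 0 <= u t) -> 0 <= rmean u.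
Proof.
  intros H K. rewrite <- (rmean_const 0). apply rmean_le; auto.
  intro; apply rcont_const.
Qed.

Lemma ccontinuous_on f a b : ccontinuous f -> ccurve_on f a b.
Proof. intros H t _. apply H. Qed.

Lemma cmean_ext f g : (forall t, f t = g t) -> cmean f = cmean g.
Proof. intros H. f_equal. now apply functional_extensionality. Qed.

Lemma cmean_plus f g : ccontinuous f -> ccontinuous g ->
  cmean (fun t => f t + g t)%C = (cmean f + cmean g)%C.
Proof.
  intros. unfold cmean.
  rewrite Cint_plus; auto using ccontinuous_on, Rlt_le, two_PI_pos. ring.
Qed.

Lemma cmean_minus f g : ccontinuous f -> ccontinuous g ->
  cmean (fun t => f t - g t)%C = (cmean f - cmean g)%C.
Proof.
  intros. unfold cmean.
  rewrite Cint_minus; auto using ccontinuous_on, Rlt_le, two_PI_pos. ring.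
Qed.

Lemma cmean_scal c f : ccontinuous f ->
  cmean (fun t => c * f t)%C = (c * cmean f)%C.
Proof.
  intros. unfold cmean.
  rewrite Cint_scal; auto using ccontinuous_on, Rlt_le, two_PI_pos. ring.
Qed.

Lemma cmean_const c : cmean (fun _ => c) = c.
Proof.
  unfold cmean. rewrite Cint_const, Cmult_assoc, <- RtoC_mult.
  assert (h := two_PI_pos).
  replace (/ (2 * PI) * (2 * PI - 0)) with 1 by (field; lra). ring.
Qed.

Lemma cmean_Cmod_le f u : ccontinuous f -> rcontinuous u ->
  (forall t, Cmod (f t) <= u t) -> Cmod (cmean f) <= rmean u.
Proof.
  intros Hf Hu H. unfold cmean, rmean. assert (h := two_PI_pos).
  rewrite Cmod_mult, Cmod_RtoC by (apply Rlt_le, Rinv_0_lt_compat; auto).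
  apply Rmult_le_compat_l; [apply Rlt_le, Rinv_0_lt_compat; auto|].
  apply Cint_Cmod_le; auto using ccontinuous_on, ex_RInt_rcontinuous, Rlt_le.
Qed.

Lemma cmean_bound f M : ccontinuous f -> (forall t, Cmod (f t) <= M) -> Cmod (cmean f) <= M.
Proof.
  intros Hf H. rewrite <- (rmean_const M).
  apply cmean_Cmod_le; auto. intro; apply rcont_const.
Qed.

Lemma cmean_conj f : ccontinuous f -> cmean (fun t => Cconj (f t)) = Cconj (cmean f).
Proof.
  intros Hf. unfold cmean. rewrite Cmult_conj. f_equal.
  - unfold Cconj, RtoC; simpl. now rewrite Ropp_0.
  - unfold Cint, Cconj; simpl. f_equal.
    apply (RInt_opp (V := R_CompleteNormedModule)).
    apply (ccurve_on_ex_snd f); auto using ccontinuous_on, Rlt_le, two_PI_pos.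
Qed.

(** * Goursat's theorem *)

(* The contour integral, with opposite sides paired: for affine [K] the integrands are constant. *)
Definition rect_integral (K : C -> C) (a b c d : R) : C :=
  (Cint (fun x => K (x, c) - K (x, d))%C a b
   + Ci * Cint (fun y => K (b, y) - K (a, y))%C c d)%C.

Definition cdiff_rect (K : C -> C) (a b c d : R) : Prop :=
  forall x y, a <= x <= b -> c <= y <= d -> exists l, cdiff K (x, y) l.

Lemma ccurve_horizontal K x y l : cdiff K (x, y) l -> ccurve (fun s => K (s, y)) x.
Proof.
  intros H. apply (ccurve_comp K (fun s => (s, y))).
  - split; simpl; [apply rcont_id|apply rcont_const].
  - eapply cdiff_ccont; eauto.
Qed.

Lemma ccurve_vertical K x y l : cdiff K (x, y) l -> ccurve (fun s => K (x, s)) y.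
Proof.
  intros H. apply (ccurve_comp K (fun s => (x, s))).
  - split; simpl; [apply rcont_const|apply rcont_id].
  - eapply cdiff_ccont; eauto.
Qed.

Lemma cdiff_rect_horizontal K a b c d y : cdiff_rect K a b c d -> c <= y <= d ->
  ccurve_on (fun x => K (x, y)) a b.
Proof. intros H Hy x Hx. destruct (H x y Hx Hy) as [l Hl]. eapply ccurve_horizontal; eauto. Qed.

Lemma cdiff_rect_vertical K a b c d x : cdiff_rect K a b c d -> a <= x <= b ->
  ccurve_on (fun y => K (x, y)) c d.
Proof. intros H Hx y Hy. destruct (H x y Hx Hy) as [l Hl]. eapply ccurve_vertical; eauto. Qed.

Lemma ccurve_on_minus f g a b : ccurve_on f a b -> ccurve_on g a b ->
  ccurve_on (fun t => f t - g t)%C a b.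
Proof. intros Hf Hg t Ht. apply ccurve_minus; auto. Qed.

Lemma rect_integral_split_x K a m b c d : a <= m <= b -> c <= d -> cdiff_rect K a b c d ->
  rect_integral K a b c d = (rect_integral K a m c d + rect_integral K m b c d)%C.
Proof.
  intros Hm Hcd H. unfold rect_integral.
  rewrite (Cint_Chasles _ a m b); try lra.
  2: { apply ccurve_on_minus; eapply cdiff_rect_horizontal; eauto; lra. }
  rewrite !(Cint_minus (fun y => K (_, y)) (fun y => K (_, y))); auto;
    try (eapply cdiff_rect_vertical; eauto; lra).
  ring.
Qed.

Lemma rect_integral_split_y K a b c m d : a <= b -> c <= m <= d -> cdiff_rect K a b c d ->
  rect_integral K a b c d = (rect_integral K a b c m + rect_integral K a b m d)%C.
Proof.
  intros Hab Hm H. unfold rect_integral.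
  rewrite (Cint_Chasles _ c m d); try lra.
  2: { apply ccurve_on_minus; eapply cdiff_rect_vertical; eauto; lra. }
  rewrite !(Cint_minus (fun x => K (x, _)) (fun x => K (x, _))); auto;
    try (eapply cdiff_rect_horizontal; eauto; lra).
  ring.
Qed.

(** Replace [K] by its affine approximation at [z]: the two paired integrands become the constants
    [l (c - d) i] and [l (b - a)], and their contributions cancel. Each pair of sides leaves a
    deviation of at most [2 e s], over lengths [b - a] and [d - c] that sum to [s]. *)
Lemma rect_integral_small K a b c d z l e :
  0 <= e -> a <= b -> c <= d -> cdiff_rect K a b c d ->
  a <= fst z <= b -> c <= snd z <= d ->
  (forall w, a <= fst w <= b -> c <= snd w <= d ->
     Cmod (K w - K z - l * (w - z)) <= e * Cmod (w - z)) ->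
  Cmod (rect_integral K a b c d) <= 2 * e * ((b - a) + (d - c)) ^ 2.
Proof.
  intros He Hab Hcd HK Hz1 Hz2 H.
  set (s := (b - a) + (d - c)).
  assert (Hs : forall w, a <= fst w <= b -> c <= snd w <= d ->
     Cmod (K w - K z - l * (w - z)) <= e * s).
  { intros w Hw1 Hw2. eapply Rle_trans; [apply H; auto|].
    apply Rmult_le_compat_l; auto.
    eapply Rle_trans; [apply Cmod_le_add|]. simpl.
    unfold s. assert (Rabs (fst w + - fst z) <= b - a) by (apply Rabs_le; lra).
    assert (Rabs (snd w + - snd z) <= d - c) by (apply Rabs_le; lra). lra. }
  assert (I1 : Cmod (Cint (fun x => (K (x, c) - K (x, d)) - l * (0, (c - d)%R))%C a b)
     <= (b - a) * (2 * (e * s))).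
  { apply Cint_bound; auto.
    - apply ccurve_on_minus; [|intros t _; apply ccurve_const].
      apply ccurve_on_minus; eapply cdiff_rect_horizontal; eauto; lra.
    - intros t Ht.
      replace (K (t, c) - K (t, d) - l * (0, (c - d)%R))%C with
        ((K (t, c) - K z - l * ((t, c) - z)) - (K (t, d) - K z - l * ((t, d) - z)))%C.
      + eapply Rle_trans; [apply Cmod_sub_le|].
        assert (h1 := Hs (t, c) Ht ltac:(simpl; lra)).
        assert (h2 := Hs (t, d) Ht ltac:(simpl; lra)). lra.
      + replace (0, (c - d)%R) with ((t, c) - (t, d))%C; [ring|].
        apply injective_projections; simpl; ring. }
  assert (I2 : Cmod (Cint (fun y => (K (b, y) - K (a, y)) - l * ((b - a)%R, 0))%C c d)
     <= (d - c) * (2 * (e * s))).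
  { apply Cint_bound; auto.
    - apply ccurve_on_minus; [|intros t _; apply ccurve_const].
      apply ccurve_on_minus; eapply cdiff_rect_vertical; eauto; lra.
    - intros t Ht.
      replace (K (b, t) - K (a, t) - l * ((b - a)%R, 0))%C with
        ((K (b, t) - K z - l * ((b, t) - z)) - (K (a, t) - K z - l * ((a, t) - z)))%C.
      + eapply Rle_trans; [apply Cmod_sub_le|].
        assert (h1 := Hs (b, t) ltac:(simpl; lra) Ht).
        assert (h2 := Hs (a, t) ltac:(simpl; lra) Ht). lra.
      + replace ((b - a)%R, 0) with ((b, t) - (a, t))%C; [ring|].
        apply injective_projections; simpl; ring. }
  rewrite Cint_minus, Cint_const in I1; auto.
  2: { apply ccurve_on_minus; eapply cdiff_rect_horizontal; eauto; lra. }
  2: { intros t _; apply ccurve_const. }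
  rewrite Cint_minus, Cint_const in I2; auto.
  2: { apply ccurve_on_minus; eapply cdiff_rect_vertical; eauto; lra. }
  2: { intros t _; apply ccurve_const. }
  unfold rect_integral.
  set (A := Cint _ a b) in *. set (B := Cint _ c d) in *.
  replace (A + Ci * B)%C with
    ((A - (b - a)%R * (l * (0, (c - d)%R))) + Ci * (B - (d - c)%R * (l * ((b - a)%R, 0))))%C.
  - eapply Rle_trans; [apply Cmod_triangle|]. rewrite Cmod_mult, Cmod_Ci.
    unfold s in *. nra.
  - assert (E : ((b - a)%R * (0, (c - d)%R) + Ci * (d - c)%R * ((b - a)%R, 0) = 0)%C)
      by (apply injective_projections; simpl; ring).
    transitivity (A + Ci * B - l * ((b - a)%R * (0, (c - d)%R) + Ci * (d - c)%R * ((b - a)%R, 0)))%C;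
      [ring|]. rewrite E. ring.
Qed.

Record rect := Rect { r_a : R; r_b : R; r_c : R; r_d : R }.

Definition rect_size (s : rect) : R := (r_b s - r_a s) + (r_d s - r_c s).

(** A bad rectangle violates the bound of [rect_integral_small]. The bound is quadratic in the size,
    which is what lets badness pass to a quarter. *)
Definition bad_rect (K : C -> C) (e : R) (R0 s : rect) : Prop :=
  r_a R0 <= r_a s /\ r_a s <= r_b s /\ r_b s <= r_b R0 /\
  r_c R0 <= r_c s /\ r_c s <= r_d s /\ r_d s <= r_d R0 /\
  2 * e * rect_size s ^ 2 < Cmod (rect_integral K (r_a s) (r_b s) (r_c s) (r_d s)).

Definition half_rect (s s' : rect) : Prop :=
  r_a s <= r_a s' /\ r_b s' <= r_b s /\ r_c s <= r_c s' /\ r_d s' <= r_d s /\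
  rect_size s' = rect_size s / 2.

(** Halving the size divides the bound by four. If all four quarters obeyed it, the sum of their
    integrals would obey the bound for the whole rectangle. *)
Lemma bad_rect_half K e R0 s : cdiff_rect K (r_a R0) (r_b R0) (r_c R0) (r_d R0) ->
  bad_rect K e R0 s -> exists s', bad_rect K e R0 s' /\ half_rect s s'.
Proof.
  intros HK [H1 [H2 [H3 [H4 [H5 [H6 H7]]]]]]. destruct s as [a b c d]. simpl in *.
  set (mx := (a + b) / 2). set (my := (c + d) / 2).
  assert (Hmx : a <= mx <= b) by (unfold mx; lra).
  assert (Hmy : c <= my <= d) by (unfold my; lra).
  assert (HK0 : cdiff_rect K a b c d) by (intros x y Hx Hy; apply HK; lra).
  apply NNPP. intros N.
  assert (P : forall s', r_a s' <= r_b s' -> r_c s' <= r_d s' ->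
     half_rect (Rect a b c d) s' ->
     Cmod (rect_integral K (r_a s') (r_b s') (r_c s') (r_d s'))
       <= 2 * e * (rect_size (Rect a b c d) / 2) ^ 2).
  { intros s' k1 k2 k3. apply Rnot_lt_le. intros k4. apply N. exists s'. split; auto.
    destruct k3 as [q1 [q2 [q3 [q4 q5]]]]. simpl in *.
    unfold bad_rect. rewrite q5. repeat split; auto; lra. }
  assert (E : rect_integral K a b c d =
    ((rect_integral K a mx c my + rect_integral K a mx my d)
     + (rect_integral K mx b c my + rect_integral K mx b my d))%C).
  { rewrite (rect_integral_split_x K a mx b) by (auto; lra).
    f_equal; apply rect_integral_split_y; try lra;
    intros x y Hx Hy; apply HK0; lra. }
  rewrite E in H7.
  assert (P1 := P (Rect a mx c my)). assert (P2 := P (Rect a mx my d)).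
  assert (P3 := P (Rect mx b c my)). assert (P4 := P (Rect mx b my d)).
  unfold half_rect, rect_size in P1, P2, P3, P4, H7. simpl in P1, P2, P3, P4, H7.
  assert (Q1 := P1 ltac:(lra) ltac:(lra) ltac:(unfold mx, my in *; repeat split; lra)).
  assert (Q2 := P2 ltac:(lra) ltac:(lra) ltac:(unfold mx, my in *; repeat split; lra)).
  assert (Q3 := P3 ltac:(lra) ltac:(lra) ltac:(unfold mx, my in *; repeat split; lra)).
  assert (Q4 := P4 ltac:(lra) ltac:(lra) ltac:(unfold mx, my in *; repeat split; lra)).
  clear P1 P2 P3 P4.
  assert (T := Cmod_triangle (rect_integral K a mx c my + rect_integral K a mx my d)
    (rect_integral K mx b c my + rect_integral K mx b my d)).
  assert (T1 := Cmod_triangle (rect_integral K a mx c my) (rect_integral K a mx my d)).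
  assert (T2 := Cmod_triangle (rect_integral K mx b c my) (rect_integral K mx b my d)).
  lra.
Qed.

Lemma nested_point (a b : nat -> R) :
  (forall n, a n <= a (S n)) -> (forall n, b (S n) <= b n) -> (forall n, a n <= b n) ->
  exists x, forall n, a n <= x <= b n.
Proof.
  intros Ha Hb Hab.
  assert (Ma : forall n k, a n <= a (n + k)%nat).
  { intros n k. induction k. rewrite Nat.add_0_r; lra.
    rewrite Nat.add_succ_r. eapply Rle_trans; eauto. }
  assert (Mb : forall n k, b (n + k)%nat <= b n).
  { intros n k. induction k. rewrite Nat.add_0_r; lra.
    rewrite Nat.add_succ_r. eapply Rle_trans; eauto. }
  assert (U : forall n m, a n <= b m).
  { intros n m. eapply Rle_trans; [apply (Ma n m)|].
    rewrite Nat.add_comm. eapply Rle_trans; [apply Hab|]. apply Mb. }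
  destruct (completeness (fun r => exists n, r = a n)) as [x [Hx1 Hx2]].
  - exists (b O). intros r [n ->]. apply U.
  - exists (a O). now exists O.
  - exists x. intros n. split.
    + apply Hx1. now exists n.
    + apply Hx2. intros r [m ->]. apply U.
Qed.

(** Repeated quartering of a bad rectangle shrinks to a point, where differentiability makes
    [rect_integral_small] applicable to a late rectangle. So nothing is bad, whatever [e] is. *)
Theorem goursat K a b c d : a <= b -> c <= d -> cdiff_rect K a b c d ->
  rect_integral K a b c d = RtoC 0.
Proof.
  intros Hab Hcd HK.
  set (s0 := (b - a) + (d - c)).
  assert (Main : forall e, 0 < e -> Cmod (rect_integral K a b c d) <= 2 * e * s0 ^ 2).
  { intros e He. apply Rnot_lt_le. intros Hbad.
    set (R0 := Rect a b c d).
    assert (B0 : bad_rect K e R0 R0) by (unfold R0; repeat split; simpl; auto; lra).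
    (* The subtype carries the proof of badness, so the choice of a bad quarter can be iterated. *)
    set (next := fun s : {s | bad_rect K e R0 s} =>
      let w := constructive_indefinite_description _ (bad_rect_half K e R0 _ HK (proj2_sig s)) in
      exist (bad_rect K e R0) (proj1_sig w) (proj1 (proj2_sig w))).
    set (u := fun n => Nat.iter n next (exist _ R0 B0)).
    set (v := fun n => proj1_sig (u n)).
    assert (Hv : forall n, bad_rect K e R0 (v n)) by (intros n; apply (proj2_sig (u n))).
    assert (Hh : forall n, half_rect (v n) (v (S n))).
    { intros n. unfold v. change (u (S n)) with (next (u n)).
      unfold next. cbn [proj1_sig].
      destruct (constructive_indefinite_description _ _) as [w [w1 w2]]. exact w2. }
    assert (Hsz : forall n, rect_size (v n) = s0 * (/ 2) ^ n).
    { induction n.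
      - simpl. unfold v, u, rect_size, s0; simpl. ring.
      - destruct (Hh n) as [_ [_ [_ [_ h]]]]. rewrite h, IHn. simpl. field. }
    destruct (nested_point (fun n => r_a (v n)) (fun n => r_b (v n))) as [x Hx].
    { intros n; apply (Hh n). } { intros n; apply (Hh n). } { intros n; apply (Hv n). }
    destruct (nested_point (fun n => r_c (v n)) (fun n => r_d (v n))) as [y Hy].
    { intros n; apply (Hh n). } { intros n; apply (Hh n). } { intros n; apply (Hv n). }
    destruct (HK x y) as [l Hl].
    { apply (Hx O). } { apply (Hy O). }
    destruct (Hl e He) as [dl [Hdl Hl']].
    assert (Hs0 : 0 <= s0) by (unfold s0; lra).
    (* The rectangle may be degenerate with [s0 = 0]; dividing by [s0 + 1] is always allowed. *)
    destruct (pow_lt_1_zero (/ 2) ltac:(rewrite Rabs_pos_eq; lra) (dl / (s0 + 1)))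
      as [n Hn]. { apply Rdiv_lt_0_compat; lra. }
    specialize (Hn n (Nat.le_refl n)).
    rewrite Rabs_pos_eq in Hn by (apply pow_le; lra).
    assert (Hsmall : rect_size (v n) < dl).
    { rewrite Hsz. apply Rle_lt_trans with ((s0 + 1) * (/2)^n).
      - apply Rmult_le_compat_r; [apply pow_le; lra|lra].
      - apply (Rmult_lt_compat_l (s0 + 1)) in Hn; [|lra].
        replace ((s0 + 1) * (dl / (s0 + 1))) with dl in Hn by (field; lra). exact Hn. }
    destruct (Hv n) as [q1 [q2 [q3 [q4 [q5 [q6 q7]]]]]]. simpl in q1, q3, q4, q6.
    apply (Rlt_irrefl (2 * e * rect_size (v n) ^ 2)).
    eapply Rlt_le_trans; [exact q7|].
    apply (rect_integral_small K _ _ _ _ (x, y) l); auto; try lra.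
    - intros x' y' Hx' Hy'. apply HK; lra.
    - intros w Hw1 Hw2. apply Hl'. eapply Rle_lt_trans; [apply Cmod_le_add|].
      eapply Rle_lt_trans; [|exact Hsmall]. unfold rect_size. simpl.
      specialize (Hx n). specialize (Hy n). simpl in Hx, Hy.
      assert (Rabs (fst w + - x) <= r_b (v n) - r_a (v n)) by (apply Rabs_le; lra).
      assert (Rabs (snd w + - y) <= r_d (v n) - r_c (v n)) by (apply Rabs_le; lra). lra. }
  apply Ceps_eq. intros e He.
  assert (Hs0 : 0 <= s0 ^ 2) by apply pow2_ge_0.
  specialize (Main (e / (2 * (s0 ^ 2 + 1))) ltac:(apply Rdiv_lt_0_compat; lra)).
  replace (rect_integral K a b c d - 0)%C with (rect_integral K a b c d) by ring.
  eapply Rle_trans; [exact Main|].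
  replace (2 * (e / (2 * (s0 ^ 2 + 1))) * s0 ^ 2) with (e * (s0 ^ 2 / (s0 ^ 2 + 1))) by (field; lra).
  rewrite <- (Rmult_1_r e) at 2. apply Rmult_le_compat_l; [lra|].
  apply Rle_div_l; lra.
Qed.

(** * Points on circles and the complex exponential *)

Lemma Cmod_circle_point r t : 0 <= r -> Cmod (circle_point r t) = r.
Proof.
  intros Hr. unfold Cmod, circle_point; simpl fst; simpl snd.
  rewrite <- (sqrt_pow2 r) at 3 by auto. f_equal.
  assert (h := sin2_cos2 t). unfold Rsqr in h. simpl.
  replace (r * cos t * (r * cos t * 1) + r * sin t * (r * sin t * 1)) with
    (r * r * (sin t * sin t + cos t * cos t)) by ring. rewrite h. ring.
Qed.

Lemma ccontinuous_circle_point r : ccontinuous (circle_point r).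
Proof.
  intros t. split; simpl; apply rcont_mult; try apply rcont_const;
  [apply rcont_cos|apply rcont_sin].
Qed.

Lemma exp_le_compat x y : x <= y -> exp x <= exp y.
Proof.
  intros [h | ->]; [|apply Rle_refl]. now apply Rlt_le, exp_increasing.
Qed.

Lemma circle_point_mult r s t u :
  (circle_point r t * circle_point s u)%C = circle_point (r * s) (t + u).
Proof.
  unfold circle_point. rewrite cos_plus, sin_plus.
  apply injective_projections; simpl; ring.
Qed.

Lemma circle_point_conj r t : (circle_point r t * Cconj (circle_point r t))%C = RtoC (r * r).
Proof.
  assert (h := sin2_cos2 t). unfold Rsqr in h.
  apply injective_projections; simpl; [|ring].
  transitivity (r * r * (sin t * sin t + cos t * cos t)); [ring|rewrite h; ring].
Qed.

Lemma circle_point_2PI r : circle_point r (2 * PI) = circle_point r 0.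
Proof. unfold circle_point. now rewrite cos_2PI, sin_2PI, cos_0, sin_0. Qed.

Lemma circle_point_sub_ge r t a : 0 <= r -> r - Cmod a <= Cmod (circle_point r t - a).
Proof.
  intros Hr. rewrite <- (Cmod_circle_point r t Hr) at 1. apply Cmod_sub_ge.
Qed.

Lemma circle_point_sub_neq r t a : Cmod a < r -> (circle_point r t - a)%C <> 0.
Proof.
  intros Ha. apply Cmod_pos_neq. assert (h0 := Cmod_ge_0 a).
  assert (h := circle_point_sub_ge r t a ltac:(lra)). lra.
Qed.

Lemma ccontinuous_circle_sub r a : ccontinuous (fun t => circle_point r t - a)%C.
Proof. intro t. apply ccurve_minus; [apply ccontinuous_circle_point|apply ccurve_const]. Qed.

Lemma ccontinuous_inv f : ccontinuous f -> (forall t, f t <> RtoC 0) ->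
  ccontinuous (fun t => / f t)%C.
Proof. intros H Hn t. now apply ccurve_inv. Qed.

(** Polar form: the vertical segment of height [2 * PI] over [ln r] winds once around the circle of
    radius [r]. *)
Definition cexp (w : C) : C := circle_point (exp (fst w)) (snd w).

Lemma cexp_plus v w : cexp (v + w) = (cexp v * cexp w)%C.
Proof. unfold cexp. rewrite circle_point_mult. simpl. now rewrite exp_plus. Qed.

Lemma Cmod_cexp w : Cmod (cexp w) = exp (fst w).
Proof. apply Cmod_circle_point. apply Rlt_le, exp_pos. Qed.

Lemma derivable_pt_lim_0 (u : R -> R) l e : derivable_pt_lim u 0 l -> 0 < e ->
  exists d, 0 < d /\ forall h, Rabs h < d -> Rabs (u h - u 0 - l * h) <= e * Rabs h.
Proof.
  intros H He. destruct (H e He) as [[d Hd] K]. exists d. split; [exact Hd|].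
  intros h Hh. destruct (Req_dec h 0) as [->|Hn].
  - replace (u 0 - u 0 - l * 0) with 0 by ring. rewrite Rabs_R0. lra.
  - specialize (K h Hn Hh). rewrite Rplus_0_l in K.
    replace (u h - u 0 - l * h) with (((u h - u 0) / h - l) * h) by (field; auto).
    rewrite Rabs_mult. apply Rmult_le_compat_r; [apply Rabs_pos|lra].
Qed.

(** The functional equation moves the question to 0, where the real derivatives of exp, cos and sin
    suffice. *)
Lemma cdiff_cexp w : cdiff cexp w (cexp w).
Proof.
  assert (H0 : cdiff cexp 0 1).
  { intros e He.
    (* The error terms [T1] and [T2] count [3 * e' * m] each because [exp x <= 3], and [T3], [T4]
       count [e' * m] each: eight in all. The cap at 1 serves the bound on [exp x]. *)
    set (e' := Rmin (e / 8) 1).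
    assert (He' : 0 < e') by (apply Rmin_pos; lra).
    assert (He1 : e' <= e / 8) by apply Rmin_l. assert (He2 : e' <= 1) by apply Rmin_r.
    destruct (derivable_pt_lim_0 exp 1 e') as [d1 [Hd1 K1]]; auto.
    { rewrite <- exp_0. apply derivable_pt_lim_exp. }
    destruct (derivable_pt_lim_0 cos 0 e') as [d2 [Hd2 K2]]; auto.
    { replace 0 with (- sin 0) at 2 by (rewrite sin_0; ring). apply derivable_pt_lim_cos. }
    destruct (derivable_pt_lim_0 sin 1 e') as [d3 [Hd3 K3]]; auto.
    { rewrite <- cos_0. apply derivable_pt_lim_sin. }
    rewrite exp_0 in K1. rewrite cos_0 in K2. rewrite sin_0 in K3.
    exists (Rmin (Rmin d1 d2) (Rmin d3 (e' / 2))). split.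
    { repeat apply Rmin_pos; lra. }
    intros h Hh.
    destruct (Rlt_Rmin _ _ _ Hh) as [h12 h34].
    destruct (Rlt_Rmin _ _ _ h12) as [h1 h2].
    destruct (Rlt_Rmin _ _ _ h34) as [h3 h4]. clear h12 h34 Hh.
    replace (h - 0)%C with h in * by ring.
    assert (Hx := Cmod_fst_le h). assert (Hy := Cmod_snd_le h).
    destruct h as [x y]. simpl fst in *. simpl snd in *.
    set (m := Cmod (x, y)) in *.
    specialize (K1 x ltac:(lra)). specialize (K2 y ltac:(lra)). specialize (K3 y ltac:(lra)).
    assert (Hx0 := Rabs_pos x). assert (Hy0 := Rabs_pos y).
    assert (Hexp : Rabs (exp x - 1) <= 2 * m).
    { replace (exp x - 1) with ((exp x - 1 - 1 * x) + x) by ring.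
      eapply Rle_trans; [apply Rabs_triang|]. nra. }
    assert (Hexp3 : exp x <= 3).
    { assert (q := Rle_abs (exp x - 1)). lra. }
    assert (Hexp0 := exp_pos x).
    eapply Rle_trans; [apply Cmod_le_add|].
    unfold cexp, circle_point. simpl. rewrite exp_0, cos_0, sin_0.
    replace (exp x * cos y + - (1 * 1) + - (1 * x - 0 * y)) with
      (exp x * (cos y - 1 - 0 * y) + (exp x - 1 - 1 * x)) by ring.
    replace (exp x * sin y + - (1 * 0) + - (1 * y + 0 * x)) with
      (exp x * (sin y - 0 - 1 * y) + (exp x - 1) * y) by ring.
    assert (T1 : Rabs (exp x * (cos y - 1 - 0 * y)) <= 3 * (e' * m)).
    { rewrite Rabs_mult, (Rabs_pos_eq (exp x)) by lra.
      apply Rmult_le_compat; try apply Rabs_pos; try lra. nra. }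
    assert (T2 : Rabs (exp x * (sin y - 0 - 1 * y)) <= 3 * (e' * m)).
    { rewrite Rabs_mult, (Rabs_pos_eq (exp x)) by lra.
      apply Rmult_le_compat; try apply Rabs_pos; try lra. nra. }
    assert (T3 : Rabs ((exp x - 1) * y) <= e' * m).
    { rewrite Rabs_mult. apply Rmult_le_compat; try apply Rabs_pos; lra. }
    assert (T4 : Rabs (exp x - 1 - 1 * x) <= e' * m) by nra.
    assert (G1 := Rabs_triang (exp x * (cos y - 1 - 0 * y)) (exp x - 1 - 1 * x)).
    assert (G2 := Rabs_triang (exp x * (sin y - 0 - 1 * y)) ((exp x - 1) * y)).
    assert (8 * (e' * m) <= e * m) by nra. lra. }
  apply (cdiff_ext_loc (fun v => cexp w * cexp (v - w))%C _ _ _ 1); [lra| |].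
  - intros v _. rewrite <- cexp_plus. f_equal. ring.
  - apply (cdiff_eq _ _ (cexp w * (1 * (1 - 0)))%C); [|ring].
    apply cdiff_scal. apply (cdiff_comp cexp (fun v => v - w)%C).
    + apply cdiff_minus; [apply cdiff_id|apply cdiff_const].
    + replace (w - w)%C with (RtoC 0) by ring. exact H0.
Qed.

(** * Means over circles *)

Definition circle_mean (r : R) (k : C -> C) : C := cmean (fun t => k (circle_point r t)).

Definition circle_cont (r : R) (k : C -> C) : Prop :=
  forall z, Cmod z = r -> ccont k z.

Lemma circle_cont_ccontinuous r k : 0 <= r -> circle_cont r k ->
  ccontinuous (fun t => k (circle_point r t)).
Proof.
  intros Hr H t. apply (ccurve_comp k (circle_point r)); [apply ccontinuous_circle_point|].
  apply H. now apply Cmod_circle_point.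
Qed.

Lemma cmean_bound_on f M : ccontinuous f -> (forall t, 0 <= t <= 2 * PI -> Cmod (f t) <= M) ->
  Cmod (cmean f) <= M.
Proof.
  intros Hf H. unfold cmean. assert (h := two_PI_pos).
  rewrite Cmod_mult, Cmod_RtoC by (apply Rlt_le, Rinv_0_lt_compat; auto).
  apply Rmult_le_reg_l with (2 * PI); auto. rewrite <- Rmult_assoc, Rinv_r, Rmult_1_l by lra.
  replace (2 * PI * M) with ((2 * PI - 0) * M) by ring.
  apply Cint_bound; auto using ccontinuous_on. lra.
Qed.

(* In the logarithmic coordinate the annulus becomes a rectangle whose two
   horizontal sides carry the same values. *)
Lemma circle_mean_annulus k r1 r2 : 0 < r1 <= r2 ->
  (forall z, r1 <= Cmod z <= r2 -> exists l, cdiff k z l) ->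
  circle_mean r1 k = circle_mean r2 k.
Proof.
  intros Hr H.
  assert (Hln : ln r1 <= ln r2).
  { destruct (Rle_lt_or_eq_dec r1 r2) as [h|h]; [lra| |subst; lra].
    apply Rlt_le, ln_increasing; lra. }
  assert (h := two_PI_pos).
  assert (HK : cdiff_rect (fun w => k (cexp w)) (ln r1) (ln r2) 0 (2 * PI)).
  { intros x y Hx Hy. destruct (H (cexp (x, y))) as [l Hl].
    - rewrite Cmod_cexp. simpl. rewrite <- (exp_ln r1), <- (exp_ln r2) by lra.
      split; apply exp_le_compat; lra.
    - exists (l * cexp (x, y))%C. apply (cdiff_comp k cexp); auto. apply cdiff_cexp. }
  assert (G := goursat _ _ _ _ _ Hln (Rlt_le _ _ h) HK).
  unfold rect_integral in G.
  rewrite (Cint_ext _ (fun _ => RtoC 0)) in G; auto.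
  2: { intros x Hx. unfold cexp. simpl. rewrite circle_point_2PI. ring. }
  rewrite Cint_const in G.
  rewrite (Cint_ext _ (fun y => k (circle_point r2 y) - k (circle_point r1 y))%C) in G; [|lra|].
  2: { intros y Hy. unfold cexp; simpl. rewrite !exp_ln by lra. reflexivity. }
  assert (C1 : ccontinuous (fun t => k (circle_point r1 t))).
  { apply circle_cont_ccontinuous; [lra|]. intros z Hz.
    destruct (H z ltac:(lra)) as [l Hl]. eapply cdiff_ccont; eauto. }
  assert (C2 : ccontinuous (fun t => k (circle_point r2 t))).
  { apply circle_cont_ccontinuous; [lra|]. intros z Hz.
    destruct (H z ltac:(lra)) as [l Hl]. eapply cdiff_ccont; eauto. }
  rewrite Cint_minus in G; auto using ccontinuous_on; try lra.
  unfold circle_mean, cmean. f_equal.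
  set (A := Cint _ _ _) in *. set (B := Cint (fun t => k (circle_point r1 t)) _ _) in *.
  symmetry. apply Ceq_minus.
  transitivity (- Ci * (RtoC (ln r2 - ln r1) * 0 + Ci * (A - B)))%C.
  - apply injective_projections; simpl; ring.
  - rewrite G. ring.
Qed.

(** [k] is continuous in the plane at every point of the circle; compactness of one period makes it
    uniformly close to its values on neighbouring circles. *)
Lemma circle_mean_radius_cont k r : 0 <= r -> circle_cont r k ->
  forall e, 0 < e -> exists d, 0 < d /\ forall s, 0 <= s -> Rabs (s - r) < d ->
    circle_cont s k -> Cmod (circle_mean s k - circle_mean r k) <= e.
Proof.
  intros Hr Hk e He.
  assert (Hp : forall u v s t, Cmod (circle_point u v - circle_point s t) <=
     Rabs (u * cos v - s * cos t) + Rabs (u * sin v - s * sin t)).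
  { intros. eapply Rle_trans; [apply Cmod_le_add|]. simpl. unfold Rminus. lra. }
  assert (K : forall t e', 0 < e' -> exists d, 0 < d /\ forall u v, Rabs (u - t) < d ->
     Rabs (v - r) < d -> Cmod (k (circle_point v u) - k (circle_point r t)) < e').
  { intros t e' He'.
    destruct (Hk (circle_point r t) (Cmod_circle_point r t Hr) e' He') as [d [Hd HH]].
    assert (c1 : continuity_2d_pt (fun u v => v * cos u) t r).
    { apply continuity_2d_pt_mult; [apply continuity_2d_pt_id2|].
      apply (continuity_1d_2d_pt_comp cos); [apply continuity_cos|apply continuity_2d_pt_id1]. }
    assert (c2 : continuity_2d_pt (fun u v => v * sin u) t r).
    { apply continuity_2d_pt_mult; [apply continuity_2d_pt_id2|].
      apply (continuity_1d_2d_pt_comp sin); [apply continuity_sin|apply continuity_2d_pt_id1]. }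
    destruct (c1 (mkposreal (d/2) ltac:(lra))) as [[d1 Hd1] L1].
    destruct (c2 (mkposreal (d/2) ltac:(lra))) as [[d2 Hd2] L2]. simpl in L1, L2.
    exists (Rmin d1 d2). split; [now apply Rmin_pos|]. intros u v Hu Hv.
    apply HH. eapply Rle_lt_trans; [apply Hp|].
    specialize (L1 u v (Rlt_le_trans _ _ _ Hu (Rmin_l _ _)) (Rlt_le_trans _ _ _ Hv (Rmin_l _ _))).
    specialize (L2 u v (Rlt_le_trans _ _ _ Hu (Rmin_r _ _)) (Rlt_le_trans _ _ _ Hv (Rmin_r _ _))).
    lra. }
  (* The variables are the angle [u] and the radius [v]. Since [F] vanishes at radius [r], its
     uniform continuity there says that it is small at nearby radii. *)
  set (F := fun u v => Cmod (k (circle_point v u) - k (circle_point r u))).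
  assert (F0 : forall u, F u r = 0).
  { intros u. unfold F. replace (_ - _)%C with (RtoC 0) by ring. apply Cmod_0. }
  destruct (uniform_continuity_2d_1d F 0 (2 * PI) r) with (eps := mkposreal e He)
    as [[d Hd] L].
  { intros t _ [e' He']. destruct (K t (e' / 2) ltac:(lra)) as [d [Hd HH]].
    exists (mkposreal d Hd). intros u v Hu Hv. simpl in *.
    rewrite F0, Rminus_0_r, Rabs_pos_eq by apply Cmod_ge_0.
    eapply Rle_lt_trans; [apply (Cmod_triangle_minus _ (k (circle_point r t)))|].
    assert (Hrr : Rabs (r - r) < d) by (rewrite Rminus_diag, Rabs_R0; lra).
    assert (A := HH u v Hu Hv). assert (B := HH u r Hu Hrr).
    rewrite Cmod_minus_sym in B. lra. }
  simpl in L. exists d. split; auto. intros s Hs Hsr Hsk. apply Rabs_lt_between in Hsr.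
  assert (C1 := circle_cont_ccontinuous _ _ Hs Hsk).
  assert (C2 := circle_cont_ccontinuous _ _ Hr Hk).
  unfold circle_mean. rewrite <- cmean_minus by auto.
  apply cmean_bound_on; [intro; apply ccurve_minus; auto|].
  intros t Ht. assert (z : Rabs (t - t) < d) by (rewrite Rminus_diag, Rabs_R0; lra).
  specialize (L t r t s Ht ltac:(lra) Ht ltac:(lra) z).
  rewrite F0, Rminus_0_r, Rabs_pos_eq in L by apply Cmod_ge_0. apply Rlt_le, L.
Qed.

(* Differentiability may fail at the centre and on one further circle, by continuity of the mean
   in the radius. *)
Lemma circle_mean_center k r r0 : 0 < r -> 0 <= r0 < r ->
  (forall z, Cmod z <= r -> ccont k z) ->
  (forall z, 0 < Cmod z <= r -> Cmod z <> r0 -> exists l, cdiff k z l) ->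
  circle_mean r k = k (RtoC 0).
Proof.
  intros Hr Hr0 Hc Hd.
  assert (CC : forall s, s <= r -> circle_cont s k) by (intros s Hs z Hz; apply Hc; lra).
  assert (Near : forall e, 0 < e -> exists d, 0 < d /\ forall s, 0 < s < d -> s <= r ->
     Cmod (circle_mean s k - k (RtoC 0)) <= e).
  { intros e He. destruct (Hc (RtoC 0) ltac:(rewrite Cmod_0; lra) e He) as [d [Hd0 K]].
    exists d. split; auto. intros s Hs Hsr.
    rewrite <- (cmean_const (k (RtoC 0))). unfold circle_mean.
    rewrite <- cmean_minus.
    - apply cmean_bound.
      + intro; apply ccurve_minus; [|apply ccurve_const].
        apply circle_cont_ccontinuous; [lra|]. apply CC; lra.
      + intros t. apply Rlt_le, K.
        replace (circle_point s t - 0)%C with (circle_point s t) by ring.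
        rewrite Cmod_circle_point; lra.
    - apply circle_cont_ccontinuous; [lra|]. apply CC; lra.
    - intro; apply ccurve_const. }
  apply Ceps_eq. intros e He.
  destruct (Near (e/3) ltac:(lra)) as [d [Hd0 K]].
  destruct (Rle_lt_or_eq_dec 0 r0 (proj1 Hr0)) as [h|h].
  - destruct (circle_mean_radius_cont k r0 (proj1 Hr0) (CC r0 ltac:(lra)) (e/3) ltac:(lra))
      as [d' [Hd' K']].
    (* The radii [s1 < r0 < s2] straddle the exceptional circle within [d']. The annulus lemma joins
       [s] to [s1] and [s2] to [r], and continuity in the radius bridges the gap. *)
    set (s := Rmin (d/2) (r0/2)).
    assert (Hs1 : s <= d/2) by apply Rmin_l. assert (Hs2 : s <= r0/2) by apply Rmin_r.
    assert (Hs0 : 0 < s) by (apply Rmin_pos; lra).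
    specialize (K s ltac:(lra) ltac:(lra)).
    set (s1 := Rmax s (r0 - d'/2)).
    assert (s <= s1) by apply Rmax_l. assert (r0 - d'/2 <= s1) by apply Rmax_r.
    assert (s1 < r0) by (apply Rmax_lub_lt; lra).
    set (s2 := Rmin r (r0 + d'/2)).
    assert (s2 <= r) by apply Rmin_l. assert (s2 <= r0 + d'/2) by apply Rmin_r.
    assert (r0 < s2) by (apply Rmin_glb_lt; lra).
    assert (E1 : circle_mean s k = circle_mean s1 k).
    { apply circle_mean_annulus; [lra|]. intros z Hz. apply Hd; lra. }
    assert (E2 : circle_mean s2 k = circle_mean r k).
    { apply circle_mean_annulus; [lra|]. intros z Hz. apply Hd; lra. }
    assert (Q1 := K' s1 ltac:(lra) ltac:(apply Rabs_lt_between; lra) (CC s1 ltac:(lra))).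
    assert (Q2 := K' s2 ltac:(lra) ltac:(apply Rabs_lt_between; lra) (CC s2 ltac:(lra))).
    rewrite <- E1 in Q1. rewrite E2 in Q2.
    eapply Rle_trans; [apply (Cmod_triangle_minus _ (circle_mean s k))|].
    eapply Rle_trans; [apply Rplus_le_compat_r; apply (Cmod_triangle_minus _ (circle_mean r0 k))|].
    rewrite (Cmod_minus_sym (circle_mean r0 k)). lra.
  - set (s := Rmin (d/2) r).
    assert (Hs1 : s <= d/2) by apply Rmin_l. assert (Hs2 : s <= r) by apply Rmin_r.
    assert (Hs0 : 0 < s) by (apply Rmin_pos; lra).
    specialize (K s ltac:(lra) ltac:(lra)).
    assert (E1 : circle_mean s k = circle_mean r k).
    { apply circle_mean_annulus; [lra|]. intros z Hz. apply Hd; lra. }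
    rewrite <- E1. lra.
Qed.

Lemma ccont_continuous f z : ccont f z <->
  continuous (T := AbsRing_UniformSpace C_AbsRing) (U := AbsRing_UniformSpace C_AbsRing) f z.
Proof.
  unfold continuous. rewrite filterlim_locally. split.
  - intros H [e He]. destruct (H e He) as [d [Hd K]]. now exists (mkposreal d Hd).
  - intros H e He. destruct (H (mkposreal e He)) as [[d Hd] K]. now exists d.
Qed.

Lemma ccont_mult f g z : ccont f z -> ccont g z -> ccont (fun w => f w * g w)%C z.
Proof.
  rewrite !ccont_continuous.
  apply (continuous_mult (U := AbsRing_UniformSpace C_AbsRing) (K := C_AbsRing)).
Qed.

(** * Cauchy's formula and its consequences *)

Definition hol (f : C -> C) : Prop := forall z, Cmod z < 1 -> exists l, cdiff f z l.

Lemma hol_ccont f z : hol f -> Cmod z < 1 -> ccont f z.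
Proof. intros H Hz. destruct (H z Hz) as [l Hl]. eapply cdiff_ccont; eauto. Qed.

Lemma hol_circle f r : hol f -> 0 <= r < 1 -> ccontinuous (fun t => f (circle_point r t)).
Proof.
  intros H Hr. apply circle_cont_ccontinuous; [lra|]. intros z Hz. apply hol_ccont; auto; lra.
Qed.

Lemma ccontinuous_cauchy_kernel r a : Cmod a < r ->
  ccontinuous (fun t => circle_point r t / (circle_point r t - a))%C.
Proof.
  intros Ha t. apply ccurve_div; [apply ccontinuous_circle_point|apply ccontinuous_circle_sub|].
  now apply circle_point_sub_neq.
Qed.

Lemma reflected_neq r a z : 0 < r -> Cmod a < r -> Cmod z <= r ->
  (RtoC (r * r) - Cconj a * z)%C <> 0.
Proof.
  intros Hr Ha Hz. apply Cmod_pos_neq. eapply Rlt_le_trans; [|apply Cmod_sub_ge].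
  rewrite Cmod_RtoC, Cmod_mult, Cmod_conj by nra.
  assert (h := Cmod_ge_0 a). assert (h' := Cmod_ge_0 z). nra.
Qed.

(** On the circle [z * Cconj z = r^2], so the conjugate of the kernel equals
    [r^2 / (r^2 - Cconj a * z)]. This function is holomorphic up to the circle and has the value 1
    at the centre. *)
Lemma circle_mean_kernel r a : 0 < r -> Cmod a < r ->
  circle_mean r (fun z => z / (z - a))%C = RtoC 1.
Proof.
  intros Hr Ha.
  assert (Hne := fun t => circle_point_sub_neq r t a Ha).
  assert (Hcont := ccontinuous_cauchy_kernel r a Ha).
  rewrite <- (Cconj_conj (circle_mean _ _)). unfold circle_mean.
  rewrite <- cmean_conj by auto.
  set (k := fun z => (RtoC (r * r) / (RtoC (r * r) - Cconj a * z))%C).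
  assert (Hk : forall z, Cmod z <= r -> (RtoC (r * r) - Cconj a * z)%C <> 0)
    by (intros z Hz; apply reflected_neq; lra).
  assert (Hd : forall z, Cmod z <= r -> exists l, cdiff k z l).
  { intros z Hz. eexists. apply cdiff_div; [apply cdiff_const| |now apply Hk].
    apply cdiff_minus; [apply cdiff_const|]. apply cdiff_scal, cdiff_id. }
  assert (E : circle_mean r k = k 0).
  { apply (circle_mean_center k r 0); auto; try lra.
    - intros z Hz. destruct (Hd z Hz) as [l Hl]. eapply cdiff_ccont; eauto.
    - intros z Hz _. apply Hd; lra. }
  assert (E0 : k 0 = 1).
  { unfold k. replace (RtoC (r * r) - Cconj a * 0)%C with (RtoC (r * r)) by ring.
    apply Cinv_r, RtoC_neq; nra. }
  rewrite E0 in E.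
  rewrite (cmean_ext _ (fun t => k (circle_point r t))).
  - change (Cconj (circle_mean r k) = 1). rewrite E.
    apply injective_projections; simpl; ring.
  - intros t. unfold k. rewrite Cdiv_conj by auto. rewrite Cminus_conj.
    assert (Hz := circle_point_conj r t). set (z := circle_point r t) in *.
    assert (Hz0 : z <> 0).
    { apply Cmod_pos_neq. unfold z. rewrite Cmod_circle_point; lra. }
    rewrite <- Hz.
    assert (Hne' : (Cconj z - Cconj a)%C <> 0).
    { rewrite <- Cminus_conj. apply Cmod_pos_neq. rewrite Cmod_conj.
      apply Cmod_gt_0, Hne. }
    field. split; auto.
    replace (z * Cconj z - Cconj a * z)%C with (z * (Cconj z - Cconj a))%C by ring.
    now apply Cmult_neq_0.
Qed.

(** The difference quotient [q], completed at [a] by the derivative, is continuous there but not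
    known to be differentiable. Taking [Cmod z = Cmod a] as the exceptional circle, [z * q z] has
    mean 0, and the mean of the kernel is 1. *)
Theorem cauchy_formula f r a : hol f -> 0 < r < 1 -> Cmod a < r ->
  circle_mean r (fun z => f z * (z / (z - a)))%C = f a.
Proof.
  intros Hf Hr Ha.
  destruct (Hf a ltac:(lra)) as [l Hl].
  set (q := fun z => if Ceq_dec z a then l else ((f z - f a) / (z - a))%C).
  assert (Hne : forall z, z <> a -> (z - a)%C <> 0).
  { intros z Hz E. apply Hz. now apply Ceq_minus. }
  assert (Hq1 : ccont q a).
  { intros e He. destruct (Hl (e/2) ltac:(lra)) as [d [Hd K]]. exists d. split; auto.
    intros w Hw. unfold q. destruct (Ceq_dec a a) as [_|n]; [|congruence].
    destruct (Ceq_dec w a) as [->|n].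
    - replace (l - l)%C with (RtoC 0) by ring. rewrite Cmod_0; lra.
    - specialize (K w Hw).
      replace ((f w - f a) / (w - a) - l)%C with ((f w - f a - l * (w - a)) / (w - a))%C
        by (field; auto).
      rewrite Cmod_div by auto.
      assert (0 < Cmod (w - a)) by (apply Cmod_gt_0; auto).
      apply Rle_lt_trans with (e/2); [|lra].
      apply Rmult_le_reg_r with (Cmod (w - a)); auto.
      unfold Rdiv at 1. rewrite Rmult_assoc, Rinv_l; lra. }
  assert (Hq2 : forall z, Cmod z < 1 -> z <> a -> exists m, cdiff q z m).
  { intros z Hz Hza. destruct (Hf z Hz) as [m Hm]. eexists.
    apply (cdiff_ext_loc (fun w => (f w - f a) / (w - a))%C _ _ _ (Cmod (z - a))).
    - apply Cmod_gt_0; auto.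
    - intros w Hw. unfold q. destruct (Ceq_dec w a) as [->|n]; auto.
      rewrite Cmod_minus_sym in Hw. lra.
    - apply cdiff_div; auto; apply cdiff_minus; eauto; try apply cdiff_const. apply cdiff_id. }
  assert (Z : circle_mean r (fun z => z * q z)%C = (0 * q 0)%C).
  { apply (circle_mean_center (fun z => z * q z)%C r (Cmod a)); try lra.
    - split; auto. apply Cmod_ge_0.
    - intros z Hz. apply ccont_mult; [eapply cdiff_ccont, cdiff_id|].
      destruct (Ceq_dec z a) as [->|n]; auto.
      destruct (Hq2 z ltac:(lra) n) as [m Hm]. eapply cdiff_ccont; eauto.
    - intros z Hz Hza. destruct (Hq2 z ltac:(lra)) as [m Hm]; [congruence|].
      eexists. apply cdiff_mult; eauto. apply cdiff_id. }
  assert (Hne' := fun t => circle_point_sub_neq r t a Ha).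
  assert (Hcont := ccontinuous_cauchy_kernel r a Ha).
  assert (E : circle_mean r (fun z => z * q z)%C =
    (circle_mean r (fun z => f z * (z / (z - a))) - f a * circle_mean r (fun z => z / (z - a)))%C).
  { unfold circle_mean. rewrite <- cmean_scal, <- cmean_minus; auto.
    - apply cmean_ext. intros t. unfold q.
      destruct (Ceq_dec (circle_point r t) a) as [e|n].
      + exfalso. apply (Hne' t). rewrite e. ring.
      + field. auto.
    - intro t. apply ccurve_mult; auto. apply (hol_circle f r); auto; lra.
    - intro t. apply ccurve_mult; auto. apply ccurve_const. }
  rewrite Z, circle_mean_kernel in E by lra.
  clear Z. match goal with |- ?X = _ => set (A := X) in * end.
  transitivity ((A - f a * 1) + f a)%C; [ring|]. rewrite <- E. ring.
Qed.

Lemma rcontinuous_bounded u a b : a <= b -> rcontinuous u ->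
  exists M, 0 < M /\ forall t, a <= t <= b -> u t <= M.
Proof.
  intros Hab H.
  destruct (continuity_ab_maj u a b Hab) as [m [Hm _]].
  { intros c _. apply continuity_pt_filterlim, H. }
  exists (Rmax 1 (u m)). split.
  - apply Rlt_le_trans with 1; [lra|apply Rmax_l].
  - intros t Ht. eapply Rle_trans; [apply Hm; auto|apply Rmax_r].
Qed.

Lemma ccontinuous_bounded f : ccontinuous f ->
  exists M, 0 < M /\ forall t, 0 <= t <= 2 * PI -> Cmod (f t) <= M.
Proof.
  intros H. apply (rcontinuous_bounded (fun t => Cmod (f t))).
  - apply Rlt_le, two_PI_pos.
  - intro. now apply rcont_Cmod.
Qed.

Lemma ccontinuous_mult f g : ccontinuous f -> ccontinuous g ->
  ccontinuous (fun t => f t * g t)%C.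
Proof. intros Hf Hg t. now apply ccurve_mult. Qed.

Lemma ccontinuous_minus f g : ccontinuous f -> ccontinuous g ->
  ccontinuous (fun t => f t - g t)%C.
Proof. intros Hf Hg t. now apply ccurve_minus. Qed.

Lemma ccontinuous_const c : ccontinuous (fun _ => c).
Proof. intros t. apply ccurve_const. Qed.

(** Differentiation under the mean: a quadratic remainder uniform in [t] survives multiplication by
    the bounded density [phi]. *)
Lemma cdiff_cmean (phi k' : R -> C) (k : R -> C -> C) a s M :
  ccontinuous phi -> ccontinuous k' -> 0 < s -> 0 < M ->
  (forall b, Cmod (b - a) < s -> ccontinuous (fun t => k t b)) ->
  (forall b t, Cmod (b - a) < s ->
     Cmod (k t b - k t a - (b - a) * k' t) <= M * Cmod (b - a) ^ 2) ->
  cdiff (fun b => cmean (fun t => phi t * k t b)%C) a (cmean (fun t => phi t * k' t)%C).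
Proof.
  intros Hphi Hk' Hs HM Hc Hb e He.
  destruct (ccontinuous_bounded phi Hphi) as [B [HB HB']].
  exists (Rmin s (e / (B * M))). split.
  { apply Rmin_pos; auto. apply Rdiv_lt_0_compat; auto. now apply Rmult_lt_0_compat. }
  intros b Hbs.
  destruct (Rlt_Rmin _ _ _ Hbs) as [h1 h2].
  assert (Ha : Cmod (a - a) < s).
  { replace (a - a)%C with (RtoC 0) by ring. now rewrite Cmod_0. }
  assert (C1 := ccontinuous_mult _ _ Hphi (Hc b h1)).
  assert (C2 := ccontinuous_mult _ _ Hphi (Hc a Ha)).
  assert (C3 := ccontinuous_mult _ _ Hphi Hk').
  assert (C4 := ccontinuous_minus _ _ C1 C2).
  assert (C5 := ccontinuous_mult _ _ (ccontinuous_const (b - a)%C) C3).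
  rewrite Cmult_comm, <- (cmean_scal _ _ C3), <- (cmean_minus _ _ C1 C2),
    <- (cmean_minus _ _ C4 C5).
  apply cmean_bound_on; [exact (ccontinuous_minus _ _ C4 C5)|].
  - intros t Ht.
    replace (phi t * k t b - phi t * k t a - (b - a) * (phi t * k' t))%C with
      (phi t * (k t b - k t a - (b - a) * k' t))%C by ring.
    rewrite Cmod_mult.
    apply Rle_trans with (B * (M * Cmod (b - a) ^ 2)).
    + apply Rmult_le_compat; auto using Cmod_ge_0.
    + assert (h := Cmod_ge_0 (b - a)).
      apply (Rmult_lt_compat_l (B * M)) in h2; [|now apply Rmult_lt_0_compat].
      replace (B * M * (e / (B * M))) with e in h2 by (field; lra).
      nra.
Qed.

(** The factor [z] that the parametrization of the circle produces is left to [phi]. With it,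
    [n = 1] reproduces a function and [n = 2] its derivative; without it, [n = 1] divides the
    function by the variable when it vanishes at 0. *)
Definition cauchy_transform (n : nat) (phi : R -> C) (r : R) (a : C) : C :=
  cmean (fun t => phi t * (/ (circle_point r t - a)) ^ n)%C.

Lemma ccontinuous_pow f n : ccontinuous f -> ccontinuous (fun t => f t ^ n)%C.
Proof.
  intros H. induction n.
  - intro t. apply ccurve_const.
  - intro t. apply (ccurve_mult f (fun t => f t ^ n)%C); auto.
Qed.

Lemma ccontinuous_kernel n r a : Cmod a < r ->
  ccontinuous (fun t => (/ (circle_point r t - a)) ^ n)%C.
Proof.
  intros Ha. apply ccontinuous_pow, ccontinuous_inv; [apply ccontinuous_circle_sub|].
  intros t. now apply circle_point_sub_neq.
Qed.

Lemma Cmod_inv_le z s : 0 < s -> s <= Cmod z -> Cmod (/ z) <= / s.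
Proof.
  intros Hs Hz. rewrite Cmod_inv by (apply Cmod_pos_neq; lra).
  apply Rinv_le_contravar; auto.
Qed.

(** The second part is the point: it makes derivatives of holomorphic functions differentiable
    again. The remainders are [(b - a)^2] times three, respectively four, kernel factors of modulus
    at most [/ s]. *)
Lemma cdiff_cauchy_transform phi r a : ccontinuous phi -> Cmod a < r ->
  cdiff (cauchy_transform 1 phi r) a (cauchy_transform 2 phi r a) /\
  exists l, cdiff (cauchy_transform 2 phi r) a l.
Proof.
  intros Hphi Ha. assert (h0 := Cmod_ge_0 a).
  (* Half the distance to the circle: every [b] within [s] of [a] still has distance at least [s]
     from the circle. *)
  set (s := (r - Cmod a) / 2).
  assert (Hs : 0 < s) by (unfold s; lra). assert (Hs' := Rinv_0_lt_compat s Hs).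
  assert (Hball : forall b, Cmod (b - a) < s -> Cmod b < r /\
    forall t, Cmod (/ (circle_point r t - b)) <= / s).
  { intros b Hb. assert (h := Cmod_sub_ge b a).
    assert (Cmod b < r - s) by (unfold s in *; lra).
    split; [lra|]. intros t. assert (h2 := circle_point_sub_ge r t b ltac:(lra)).
    apply Cmod_inv_le; lra. }
  assert (Haa : Cmod (a - a) < s).
  { replace (a - a)%C with (RtoC 0) by ring. now rewrite Cmod_0. }
  destruct (Hball a Haa) as [_ Hat].
  split; [|eexists].
  - apply (cdiff_cmean phi (fun t => (/ (circle_point r t - a)) ^ 2)%C
     (fun t b => (/ (circle_point r t - b)) ^ 1)%C a s ((/ s) ^ 3)); auto.
    + now apply ccontinuous_kernel.
    + now apply pow_lt.
    + intros b Hb. apply ccontinuous_kernel. now apply Hball.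
    + intros b t Hb. destruct (Hball b Hb) as [Hbr Hbt]. specialize (Hbt t). specialize (Hat t).
      assert (n1 := circle_point_sub_neq r t a Ha). assert (n2 := circle_point_sub_neq r t b Hbr).
      set (z := circle_point r t) in *.
      replace ((/ (z - b)) ^ 1 - (/ (z - a)) ^ 1 - (b - a) * (/ (z - a)) ^ 2)%C with
        ((/ (z - a)) ^ 2 * (/ (z - b)) * (b - a) ^ 2)%C by (simpl; field; auto).
      rewrite !Cmod_mult, !Cmod_pow. apply Rmult_le_compat_r; [apply pow2_ge_0|].
      replace ((/ s) ^ 3) with ((/ s) ^ 2 * / s) by ring.
      apply Rmult_le_compat; auto using Cmod_ge_0, pow_le, pow_incr.
  - apply (cdiff_cmean phi (fun t => 2 * (/ (circle_point r t - a)) ^ 3)%C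
     (fun t b => (/ (circle_point r t - b)) ^ 2)%C a s (3 * (/ s) ^ 4)); auto.
    + apply ccontinuous_mult; [intro; apply ccurve_const|now apply ccontinuous_kernel].
    + apply Rmult_lt_0_compat; [lra|]. now apply pow_lt.
    + intros b Hb. apply ccontinuous_kernel. now apply Hball.
    + intros b t Hb. destruct (Hball b Hb) as [Hbr Hbt]. specialize (Hbt t). specialize (Hat t).
      assert (n1 := circle_point_sub_neq r t a Ha). assert (n2 := circle_point_sub_neq r t b Hbr).
      set (z := circle_point r t) in *.
      replace ((/ (z - b)) ^ 2 - (/ (z - a)) ^ 2 - (b - a) * (2 * (/ (z - a)) ^ 3))%C with
        (((/ (z - a)) ^ 2 * (/ (z - b)) ^ 2 + 2 * ((/ (z - a)) ^ 3 * (/ (z - b)))) * (b - a) ^ 2)%C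
        by (simpl; field; auto).
      rewrite Cmod_mult, Cmod_pow. apply Rmult_le_compat_r; [apply pow2_ge_0|].
      eapply Rle_trans; [apply Cmod_triangle|].
      rewrite !Cmod_mult, !Cmod_pow, Cmod_RtoC by lra.
      replace (3 * (/ s) ^ 4) with ((/ s) ^ 2 * (/ s) ^ 2 + 2 * ((/ s) ^ 3 * / s)) by ring.
      apply Rplus_le_compat; [|apply Rmult_le_compat_l; [lra|]];
      apply Rmult_le_compat; auto using Cmod_ge_0, pow_le, pow_incr.
Qed.

Lemma hol_cauchy_transform f r a : hol f -> 0 < r < 1 -> Cmod a < r ->
  f a = cauchy_transform 1 (fun t => f (circle_point r t) * circle_point r t)%C r a.
Proof.
  intros Hf Hr Ha. rewrite <- (cauchy_formula f r a Hf Hr Ha).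
  apply cmean_ext. intros t. simpl. unfold Cdiv. ring.
Qed.

Lemma hol_circle_mult_point f r : hol f -> 0 <= r < 1 ->
  ccontinuous (fun t => f (circle_point r t) * circle_point r t)%C.
Proof.
  intros Hf Hr. apply ccontinuous_mult; [now apply hol_circle|apply ccontinuous_circle_point].
Qed.

Lemma ball_in_disc a b r : Cmod (b - a) < r - Cmod a -> Cmod b < r.
Proof. intros H. assert (h := Cmod_sub_ge b a). lra. Qed.

Lemma C_derive_cauchy f r a : hol f -> 0 < r < 1 -> Cmod a < r ->
  C_derive f a = cauchy_transform 2 (fun t => f (circle_point r t) * circle_point r t)%C r a.
Proof.
  intros Hf Hr Ha. apply cdiff_C_derive.
  apply (cdiff_ext_loc
    (cauchy_transform 1 (fun t => f (circle_point r t) * circle_point r t)%C r) _ _ _ (r - Cmod a)).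
  - lra.
  - intros w Hw. symmetry. apply hol_cauchy_transform; auto. now apply (ball_in_disc a).
  - apply cdiff_cauchy_transform; auto. apply hol_circle_mult_point; auto; lra.
Qed.

Lemma hol_C_derive f : hol f -> hol (C_derive f).
Proof.
  intros Hf a Ha. assert (h := Cmod_ge_0 a).
  set (r := (1 + Cmod a) / 2).
  assert (Hr : 0 < r < 1) by (unfold r; lra). assert (Har : Cmod a < r) by (unfold r; lra).
  destruct (cdiff_cauchy_transform (fun t => f (circle_point r t) * circle_point r t)%C r a)
    as [_ [l Hl]]; auto.
  { apply hol_circle_mult_point; auto; lra. }
  exists l. eapply cdiff_ext_loc; [|intros w Hw|exact Hl].
  - instantiate (1 := r - Cmod a). lra.
  - symmetry. apply C_derive_cauchy; auto. now apply (ball_in_disc a).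
Qed.

Lemma hol_cdiff f z : hol f -> Cmod z < 1 -> cdiff f z (C_derive f z).
Proof.
  intros Hf Hz. destruct (Hf z Hz) as [l Hl]. now rewrite (cdiff_C_derive f z l Hl).
Qed.

(** From [z / (z - b) - 1 = b / (z - b)], the transform of the plain values of [h] is
    [(h b - h 0) / b] for [b <> 0], and at 0 it is the Cauchy formula for the derivative. Being a
    transform, it is differentiable everywhere in the disc. *)
Lemma hol_removable h : hol h -> h (RtoC 0) = RtoC 0 ->
  hol (fun z => if Ceq_dec z 0 then C_derive h 0 else (h z / z)%C).
Proof.
  intros Hh H0 a Ha. assert (hh := Cmod_ge_0 a).
  set (r := (1 + Cmod a) / 2).
  assert (Hr : 0 < r < 1) by (unfold r; lra). assert (Har : Cmod a < r) by (unfold r; lra).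
  assert (Hc : ccontinuous (fun t => h (circle_point r t))) by (apply hol_circle; auto; lra).
  exists (cauchy_transform 2 (fun t => h (circle_point r t)) r a).
  apply (cdiff_ext_loc (cauchy_transform 1 (fun t => h (circle_point r t)) r) _ _ _ (r - Cmod a)).
  - lra.
  - intros b Hb. apply ball_in_disc in Hb.
    assert (Hz : forall t, circle_point r t <> 0).
    { intros t. apply Cmod_pos_neq. rewrite Cmod_circle_point; lra. }
    destruct (Ceq_dec b 0) as [->|Hb0].
    + rewrite (C_derive_cauchy h r 0) by (auto; rewrite Cmod_0; lra).
      apply cmean_ext. intros t. specialize (Hz t). simpl. 
      replace (circle_point r t - 0)%C with (circle_point r t) by ring. field; auto.
    + assert (M0 := cauchy_formula h r 0 Hh Hr ltac:(rewrite Cmod_0; lra)).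
      assert (Mb := cauchy_formula h r b Hh Hr Hb). unfold circle_mean in M0, Mb.
      rewrite H0 in M0. rewrite <- Mb.
      assert (Cz : forall c, Cmod c < r -> ccontinuous (fun t => h (circle_point r t) *
         (circle_point r t / (circle_point r t - c)))%C).
      { intros c Hcr. apply ccontinuous_mult; auto. now apply ccontinuous_cauchy_kernel. }
      transitivity (/ b * (cmean (fun t => h (circle_point r t) *
         (circle_point r t / (circle_point r t - b))) - cmean (fun t => h (circle_point r t) *
         (circle_point r t / (circle_point r t - 0)))))%C.
      * rewrite <- cmean_minus, <- cmean_scal.
        -- apply cmean_ext. intros t. simpl.
           assert (n := circle_point_sub_neq r t b Hb). specialize (Hz t).
           replace (circle_point r t - 0)%C with (circle_point r t) by ring. field; auto.
        -- intro t. apply ccurve_minus; apply Cz; auto. rewrite Cmod_0; lra.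
        -- now apply Cz.
        -- apply Cz. rewrite Cmod_0; lra.
      * rewrite M0. field; auto.
  - now apply cdiff_cauchy_transform.
Qed.

(** * The Poisson formula and pointwise estimates *)

Lemma cmean_RtoC u : cmean (fun t => RtoC (u t)) = RtoC (rmean u).
Proof.
  unfold cmean, rmean, Cint. rewrite RtoC_mult. f_equal.
  unfold RtoC. simpl. rewrite RInt_const_R. f_equal. ring.
Qed.

Definition poisson (r : R) (a : C) (t : R) : R :=
  (r ^ 2 - Cmod a ^ 2) / Cmod (circle_point r t - a) ^ 2.

Lemma poisson_pos r a t : Cmod a < r -> 0 < poisson r a t.
Proof.
  intros Ha. assert (h := Cmod_ge_0 a). apply Rdiv_lt_0_compat; [nra|].
  apply pow_lt, Cmod_gt_0. now apply circle_point_sub_neq.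
Qed.

Lemma poisson_le r a t : Cmod a < r -> poisson r a t <= (r + Cmod a) / (r - Cmod a).
Proof.
  intros Ha. assert (h := Cmod_ge_0 a).
  assert (h2 := circle_point_sub_ge r t a ltac:(lra)).
  unfold poisson. set (x := Cmod (circle_point r t - a)) in *.
  assert (Hx : 0 < x) by lra.
  apply Rmult_le_reg_r with (x ^ 2 * (r - Cmod a)).
  { apply Rmult_lt_0_compat; [now apply pow_lt|lra]. }
  replace ((r ^ 2 - Cmod a ^ 2) / x ^ 2 * (x ^ 2 * (r - Cmod a))) with
    ((r + Cmod a) * ((r - Cmod a) * (r - Cmod a))) by (field; lra).
  replace ((r + Cmod a) / (r - Cmod a) * (x ^ 2 * (r - Cmod a))) with
    ((r + Cmod a) * (x * x)) by (field; lra).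
  apply Rmult_le_compat_l; [lra|]. apply Rmult_le_compat; lra.
Qed.

Lemma rcontinuous_poisson r a : Cmod a < r -> rcontinuous (poisson r a).
Proof.
  intros Ha t. unfold poisson, Rdiv. apply rcont_mult; [apply rcont_const|].
  apply (rcont_inv (fun s => Cmod (circle_point r s - a) ^ 2)).
  - simpl. assert (H : rcont (fun s => Cmod (circle_point r s - a)) t)
      by (apply rcont_Cmod, ccontinuous_circle_sub).
    exact (rcont_mult _ _ t H (rcont_mult _ _ t H (rcont_const 1 t))).
  - apply pow_nonzero. apply Rgt_not_eq, Cmod_gt_0. now apply circle_point_sub_neq.
Qed.

(** The Poisson kernel is the Cauchy kernel plus [Cconj a * z / (r^2 - Cconj a * z)]. Times [f], the
    added term is holomorphic up to the circle and zero at the centre, so it does not change the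
    mean. *)
Theorem poisson_formula f r a : hol f -> 0 < r < 1 -> Cmod a < r ->
  f a = cmean (fun t => RtoC (poisson r a t) * f (circle_point r t))%C.
Proof.
  intros Hf Hr Ha.
  assert (Hk : forall z, Cmod z <= r -> (RtoC (r * r) - Cconj a * z)%C <> 0)
    by (intros z Hz; apply reflected_neq; lra).
  set (k := fun z => (f z * (Cconj a * z / (RtoC (r * r) - Cconj a * z)))%C).
  assert (Hd : forall z, Cmod z <= r -> exists l, cdiff k z l).
  { intros z Hz. destruct (Hf z ltac:(lra)) as [l Hl]. eexists.
    apply cdiff_mult; [exact Hl|].
    apply cdiff_div; [apply cdiff_scal, cdiff_id| |now apply Hk].
    apply cdiff_minus; [apply cdiff_const|]. apply cdiff_scal, cdiff_id. }
  assert (E : circle_mean r k = k 0).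
  { apply (circle_mean_center k r 0); try lra.
    - intros z Hz. destruct (Hd z Hz) as [l Hl]. eapply cdiff_ccont; eauto.
    - intros z Hz _. apply Hd; lra. }
  assert (E0 : k 0 = 0) by (unfold k, Cdiv; rewrite !Cmult_0_r, !Cmult_0_l; apply Cmult_0_r).
  rewrite E0 in E.
  rewrite <- (cauchy_formula f r a Hf Hr Ha) at 1.
  rewrite <- (Cplus_0_r (circle_mean r _)), <- E. unfold circle_mean.
  rewrite <- cmean_plus.
  - apply cmean_ext. intros t. unfold k.
    assert (Hz := circle_point_conj r t). assert (n := circle_point_sub_neq r t a Ha).
    unfold poisson.
    assert (Hm : Cmod (circle_point r t - a) ^ 2 <> 0).
    { apply pow_nonzero. apply Rgt_not_eq, Cmod_gt_0; auto. }
    rewrite RtoC_div, Cmod2_conj by auto. rewrite RtoC_minus, Cmod2_conj.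
    replace (RtoC (r ^ 2)) with (circle_point r t * Cconj (circle_point r t))%C
      by (rewrite Hz; f_equal; ring).
    rewrite <- Hz, Cminus_conj.
    set (z := circle_point r t) in *.
    assert (n' : (Cconj z - Cconj a)%C <> 0).
    { rewrite <- Cminus_conj. apply Cmod_pos_neq. rewrite Cmod_conj. now apply Cmod_gt_0. }
    assert (Hz0 : z <> 0).
    { apply Cmod_pos_neq. unfold z. rewrite Cmod_circle_point; lra. }
    replace (z * Cconj z - Cconj a * z)%C with (z * (Cconj z - Cconj a))%C by ring.
    field. auto.
  - apply ccontinuous_mult; [apply hol_circle; auto; lra|]. now apply ccontinuous_cauchy_kernel.
  - apply circle_cont_ccontinuous; [lra|]. intros z Hz.
    destruct (Hd z ltac:(lra)) as [l Hl]. eapply cdiff_ccont; eauto.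
Qed.

Lemma rmean_poisson r a : 0 < r < 1 -> Cmod a < r -> rmean (poisson r a) = 1.
Proof.
  intros Hr Ha. apply RtoC_inj. rewrite <- cmean_RtoC.
  assert (H : hol (fun _ => RtoC 1)) by (intros z _; eexists; apply cdiff_const).
  rewrite (poisson_formula _ r a H Hr Ha). apply cmean_ext. intros; ring.
Qed.

Lemma hol_growth f r a : hol f -> 0 < r < 1 -> Cmod a < r ->
  Cmod (f a) <= (r + Cmod a) / (r - Cmod a) * rmean (fun t => Cmod (f (circle_point r t))).
Proof.
  intros Hf Hr Ha.
  assert (Hc : ccontinuous (fun t => f (circle_point r t))) by (apply hol_circle; auto; lra).
  assert (Hp := rcontinuous_poisson r a Ha).
  rewrite (poisson_formula f r a Hf Hr Ha).
  assert (Hcm : rcontinuous (fun t => Cmod (f (circle_point r t)))).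
  { intro t. apply rcont_Cmod, Hc. }
  rewrite <- rmean_scal by auto.
  apply cmean_Cmod_le.
  - apply ccontinuous_mult; auto. intro; now apply ccurve_RtoC.
  - intro t. apply rcont_mult; [apply rcont_const|apply Hcm].
  - intros t. rewrite Cmod_mult, Cmod_RtoC by (apply Rlt_le, poisson_pos; auto).
    apply Rmult_le_compat_r; [apply Cmod_ge_0|now apply poisson_le].
Qed.

(** In the difference of two Cauchy formulas the kernels combine to
    [(a - b) / ((z - a) (z - b))]. *)
Lemma hol_lipschitz f r s M a b : hol f -> 0 < r < 1 -> s < r -> Cmod a <= s -> Cmod b <= s ->
  (forall z, Cmod z = r -> Cmod (f z) <= M) ->
  Cmod (f a - f b) <= M * r / (r - s) ^ 2 * Cmod (a - b).
Proof.
  intros Hf Hr Hs Ha Hb HM. assert (h0 := Cmod_ge_0 a).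
  rewrite (hol_cauchy_transform f r a), (hol_cauchy_transform f r b) by (auto; lra).
  assert (Hc := hol_circle_mult_point f r Hf ltac:(lra)).
  unfold cauchy_transform. rewrite <- cmean_minus.
  2, 3: apply ccontinuous_mult; auto; apply ccontinuous_kernel; lra.
  apply cmean_bound.
  - intro t. apply ccurve_minus; apply ccontinuous_mult; auto; apply ccontinuous_kernel; lra.
  - intros t. assert (n1 := circle_point_sub_neq r t a ltac:(lra)).
    assert (n2 := circle_point_sub_neq r t b ltac:(lra)).
    assert (g1 := circle_point_sub_ge r t a ltac:(lra)).
    assert (g2 := circle_point_sub_ge r t b ltac:(lra)).
    assert (Hz := Cmod_circle_point r t ltac:(lra)).
    set (z := circle_point r t) in *.
    replace (f z * z * (/ (z - a)) ^ 1 - f z * z * (/ (z - b)) ^ 1)%C with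
      (f z * z * (/ (z - a)) * (/ (z - b)) * (a - b))%C by (simpl; field; auto).
    rewrite !Cmod_mult. apply Rmult_le_compat_r; [apply Cmod_ge_0|].
    assert (A1 : Cmod (/ (z - a)) <= / (r - s)) by (apply Cmod_inv_le; lra).
    assert (A2 : Cmod (/ (z - b)) <= / (r - s)) by (apply Cmod_inv_le; lra).
    replace (M * r / (r - s) ^ 2) with (M * r * / (r - s) * / (r - s)) by (field; lra).
    assert (B := HM z Hz). rewrite Hz.
    assert (p1 := Cmod_ge_0 (/ (z - a))). assert (p2 := Cmod_ge_0 (/ (z - b))).
    assert (p3 := Cmod_ge_0 (f z)).
    repeat apply Rmult_le_compat; auto; try lra;
      repeat apply Rmult_le_pos; auto; lra.
Qed.

(** * Locally uniform limits *)

Definition locally_uniform (u : nat -> C -> C) (f : C -> C) : Prop :=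
  forall r e, r < 1 -> 0 < e -> exists N, forall n z, (N <= n)%nat -> Cmod z <= r ->
    Cmod (u n z - f z) <= e.

(** The limit is continuous and inherits Cauchy's formula, and a Cauchy transform of any continuous
    density is differentiable. *)
Lemma hol_limit u f : (forall n, hol (u n)) -> locally_uniform u f -> hol f.
Proof.
  intros Hu HL.
  assert (Hcont : forall z, Cmod z < 1 -> ccont f z).
  { intros z Hz e He. assert (hz := Cmod_ge_0 z).
    destruct (HL ((1 + Cmod z) / 2) (e/4) ltac:(lra) ltac:(lra)) as [N HN].
    destruct (hol_ccont (u N) z (Hu N) Hz (e/4) ltac:(lra)) as [d [Hd K]].
    exists (Rmin d ((1 - Cmod z) / 2)). split; [apply Rmin_pos; lra|].
    intros w Hw. destruct (Rlt_Rmin _ _ _ Hw) as [h1 h2].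
    assert (h3 := Cmod_sub_ge w z).
    assert (q1 := HN N w (Nat.le_refl N) ltac:(lra)).
    assert (q2 := HN N z (Nat.le_refl N) ltac:(lra)).
    specialize (K w h1).
    replace (f w - f z)%C with ((u N w - u N z) - (u N w - f w) + (u N z - f z))%C by ring.
    eapply Rle_lt_trans; [apply Cmod_triangle|].
    assert (q3 := Cmod_sub_le (u N w - u N z) (u N w - f w)). lra. }
  intros a Ha. assert (ha := Cmod_ge_0 a).
  set (r := (1 + Cmod a) / 2).
  assert (Hr : 0 < r < 1) by (unfold r; lra). assert (Har : Cmod a < r) by (unfold r; lra).
  assert (Hfc : ccontinuous (fun t => f (circle_point r t))).
  { apply circle_cont_ccontinuous; [lra|]. intros z Hz. apply Hcont; lra. }
  assert (Hpc : ccontinuous (fun t => f (circle_point r t) * circle_point r t)%C).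
  { apply ccontinuous_mult; auto. apply ccontinuous_circle_point. }
  exists (cauchy_transform 2 (fun t => f (circle_point r t) * circle_point r t)%C r a).
  eapply cdiff_ext_loc; [| |apply cdiff_cauchy_transform; auto].
  - instantiate (1 := r - Cmod a). lra.
  - intros b Hb. apply ball_in_disc in Hb. symmetry. apply Ceps_eq. intros e He.
    (* Closeness [e / M] is used twice, once at [b] and once under the kernel of size
       [r / (r - Cmod b)]; the total is [e]. *)
    set (M := r / (r - Cmod b) + 1).
    assert (HM : 0 < r / (r - Cmod b)) by (apply Rdiv_lt_0_compat; lra).
    destruct (HL r (e / M) ltac:(lra)) as [N HN].
    { apply Rdiv_lt_0_compat; unfold M; lra. }
    specialize (HN N). 
    assert (F := hol_cauchy_transform (u N) r b (Hu N) Hr Hb).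
    apply Rle_trans with (Cmod (u N b - f b) +
      Cmod (u N b - cauchy_transform 1 (fun t => f (circle_point r t) * circle_point r t)%C r b)).
    { rewrite (Cmod_minus_sym (u N b) (f b)). apply Cmod_triangle_minus. }
    assert (T1 := HN b (Nat.le_refl N) ltac:(lra)).
    assert (T2 : Cmod (u N b - cauchy_transform 1 (fun t => f (circle_point r t) *
       circle_point r t)%C r b) <= e / M * (r / (r - Cmod b))).
    { rewrite F. unfold cauchy_transform.
      assert (Huc := hol_circle_mult_point (u N) r (Hu N) ltac:(lra)).
      rewrite <- cmean_minus.
      2, 3: apply ccontinuous_mult; auto; now apply ccontinuous_kernel.
      apply cmean_bound.
      - intro t. apply ccurve_minus; apply ccontinuous_mult; auto; now apply ccontinuous_kernel.
      - intros t.
        assert (n2 := circle_point_sub_neq r t b Hb).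
        assert (g2 := circle_point_sub_ge r t b ltac:(lra)).
        assert (Hz := Cmod_circle_point r t ltac:(lra)).
        set (z := circle_point r t) in *.
        replace (u N z * z * (/ (z - b)) ^ 1 - f z * z * (/ (z - b)) ^ 1)%C with
          ((u N z - f z) * (z * / (z - b)))%C by (simpl; field; auto).
        rewrite !Cmod_mult, Hz.
        assert (A2 : Cmod (/ (z - b)) <= / (r - Cmod b)) by (apply Cmod_inv_le; lra).
        apply Rmult_le_compat; try apply Cmod_ge_0.
        + apply Rmult_le_pos; [lra|apply Cmod_ge_0].
        + apply HN; auto; lra.
        + apply Rmult_le_compat_l; lra. }
    apply Rle_trans with (e / M + e / M * (r / (r - Cmod b))); [lra|].
    replace (e / M + e / M * (r / (r - Cmod b))) with e; [lra|].
    unfold M. field. split; lra.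
Qed.

(** * Powers and power means *)

Lemma rpow_0 p : rpow 0 p = 0.
Proof. unfold rpow. destruct (Req_EM_T 0 0); congruence. Qed.

Lemma rpow_Rpower x p : 0 < x -> rpow x p = Rpower x p.
Proof. intros H. unfold rpow. destruct (Req_EM_T x 0); auto. lra. Qed.

Lemma rpow_pos x p : 0 < x -> 0 < rpow x p.
Proof. intros H. rewrite rpow_Rpower by auto. apply exp_pos. Qed.

Lemma rpow_ge_0 x p : 0 <= rpow x p.
Proof.
  unfold rpow. destruct (Req_EM_T x 0); [lra|]. apply Rlt_le, exp_pos.
Qed.

Lemma rpow_1 p : rpow 1 p = 1.
Proof. rewrite rpow_Rpower by lra. unfold Rpower. now rewrite ln_1, Rmult_0_r, exp_0. Qed.

Lemma rpow_mult x y p : 0 <= x -> 0 <= y -> rpow (x * y) p = rpow x p * rpow y p.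
Proof.
  intros Hx Hy.
  destruct (Req_dec x 0) as [->|nx]; [rewrite Rmult_0_l, rpow_0; ring|].
  destruct (Req_dec y 0) as [->|ny]; [rewrite Rmult_0_r, rpow_0; ring|].
  rewrite !rpow_Rpower; try lra.
  - symmetry. apply Rpower_mult_distr; lra.
  - apply Rmult_lt_0_compat; lra.
Qed.

Lemma rpow_lt x y p : 0 < p -> 0 <= x < y -> rpow x p < rpow y p.
Proof.
  intros Hp [Hx Hxy]. destruct (Req_dec x 0) as [->|nx].
  - rewrite rpow_0. now apply rpow_pos.
  - rewrite !rpow_Rpower by lra. apply exp_increasing.
    apply Rmult_lt_compat_l; auto. apply ln_increasing; lra.
Qed.

Lemma rpow_le x y p : 0 < p -> 0 <= x <= y -> rpow x p <= rpow y p.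
Proof.
  intros Hp [Hx [Hxy|<-]]; [|lra]. apply Rlt_le, rpow_lt; auto.
Qed.

Lemma rpow_le_inv x y p : 0 < p -> 0 <= y -> rpow x p <= rpow y p -> x <= y.
Proof.
  intros Hp Hy H. apply Rnot_lt_le. intros h.
  assert (h' := rpow_lt y x p Hp ltac:(lra)). lra.
Qed.

Lemma rpow_rpow_inv x p : 0 < p -> 0 <= x -> rpow (rpow x p) (/ p) = x.
Proof.
  intros Hp Hx. destruct (Req_dec x 0) as [->|nx]; [now rewrite !rpow_0|].
  rewrite (rpow_Rpower x) by lra. rewrite rpow_Rpower by apply exp_pos.
  rewrite Rpower_mult, Rinv_r by lra. apply Rpower_1; lra.
Qed.

Lemma rpow_inv_rpow x p : 0 < p -> 0 <= x -> rpow (rpow x (/ p)) p = x.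
Proof.
  intros Hp Hx. rewrite <- (Rinv_inv p) at 2. apply rpow_rpow_inv; auto.
  now apply Rinv_0_lt_compat.
Qed.

Lemma rpow_inv_le x t p : 0 < p -> 0 <= x -> 0 <= t -> rpow x (/ p) <= t <-> x <= rpow t p.
Proof.
  intros Hp Hx Ht. split; intros H.
  - rewrite <- (rpow_inv_rpow x p) by auto. apply rpow_le; auto. split; auto. apply rpow_ge_0.
  - rewrite <- (rpow_rpow_inv t p) by auto. apply rpow_le; auto. now apply Rinv_0_lt_compat.
Qed.

Lemma le_rpow_eps x t p : 0 < p -> 0 <= x -> 0 <= t ->
  (forall e, 0 < e -> x <= rpow (t + e) p) -> x <= rpow t p.
Proof.
  intros Hp Hx Ht H. apply rpow_inv_le; auto. apply le_eps. intros e He.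
  apply rpow_inv_le; auto; lra.
Qed.

Lemma rcont_rpow u p t : 0 < p -> rcont u t -> (forall s, 0 <= u s) ->
  rcont (fun s => rpow (u s) p) t.
Proof.
  intros Hp Hu H0. destruct (Req_dec (u t) 0) as [h|h].
  - apply rcont_eps. intros e He.
    destruct (proj1 (rcont_eps u t) Hu (rpow e (/ p))) as [d [Hd K]].
    { now apply rpow_pos. }
    exists d. split; auto. intros s Hs. specialize (K s Hs).
    rewrite h, Rminus_0_r, Rabs_pos_eq in K by auto.
    rewrite h, rpow_0, Rminus_0_r, Rabs_pos_eq by apply rpow_ge_0.
    rewrite <- (rpow_inv_rpow e p) by lra. apply rpow_lt; auto.
  - specialize (H0 t).
    assert (C : rcont (fun s => Rpower (u s) p) t).
    { apply (rcont_comp (fun x => exp (p * ln x)) u); auto.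
      apply (rcont_comp exp (fun x => p * ln x)).
      - apply rcont_mult; [apply rcont_const|].
        apply continuity_pt_filterlim, derivable_continuous_pt.
        exists (/ u t). apply derivable_pt_lim_ln. lra.
      - apply continuity_pt_filterlim, derivable_continuous_pt, derivable_pt_exp. }
    rewrite rcont_eps in C |- *. intros e He. destruct (C e He) as [d [Hd K]].
    destruct (proj1 (rcont_eps u t) Hu (u t) ltac:(lra)) as [d' [Hd' K']].
    exists (Rmin d d'). split; [now apply Rmin_pos|]. intros s Hs.
    specialize (K s (Rlt_le_trans _ _ _ Hs (Rmin_l _ _))).
    specialize (K' s (Rlt_le_trans _ _ _ Hs (Rmin_r _ _))).
    apply Rabs_lt_between in K'. rewrite !rpow_Rpower by lra. exact K.
Qed.

(* Weighted AM-GM between [x ^ p] and 1, both compared with the tangent of exp at [ln x]. *)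
Lemma bernoulli x p : 1 <= p -> 0 <= x -> 1 + p * (x - 1) <= rpow x p.
Proof.
  intros Hp Hx. destruct (Req_dec x 0) as [->|nx]; [rewrite rpow_0; lra|].
  rewrite rpow_Rpower by lra. unfold Rpower. set (b := ln x).
  assert (Ex : exp b = x) by (apply exp_ln; lra).
  assert (H1 := exp_ineq1_le (p * b - b)). assert (H2 := exp_ineq1_le (- b)).
  replace (exp (p * b)) with (exp b * exp (p * b - b)) by (rewrite <- exp_plus; f_equal; ring).
  assert (H3 : exp b * exp (- b) = 1) by (rewrite <- exp_plus, Rplus_opp_r; apply exp_0).
  rewrite Ex in *.
  assert (0 <= x * (exp (- b) - (1 + - b))) by (apply Rmult_le_pos; lra).
  assert (0 <= x * (exp (p * b - b) - (1 + (p * b - b)))) by (apply Rmult_le_pos; lra).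
  assert (0 <= (p - 1) * (x * b - (x - 1))) by (apply Rmult_le_pos; lra).
  lra.
Qed.

(** The tangent inequality of exp is strict at [- ln x], which is nonzero because [x <> 1]. *)
Lemma bernoulli_strict x p : 1 < p -> 0 <= x -> x <> 1 -> 1 + p * (x - 1) < rpow x p.
Proof.
  intros Hp Hx H1. destruct (Req_dec x 0) as [->|nx]; [rewrite rpow_0; lra|].
  rewrite rpow_Rpower by lra. unfold Rpower. set (b := ln x).
  assert (Ex : exp b = x) by (apply exp_ln; lra).
  assert (Hb : b <> 0). { intros h. rewrite h, exp_0 in Ex. congruence. }
  assert (I1 := exp_ineq1_le (p * b - b)). assert (I2 := exp_ineq1 (- b) ltac:(lra)).
  replace (exp (p * b)) with (exp b * exp (p * b - b)) by (rewrite <- exp_plus; f_equal; ring).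
  assert (H3 : exp b * exp (- b) = 1) by (rewrite <- exp_plus, Rplus_opp_r; apply exp_0).
  rewrite Ex in *.
  assert (0 < x * (exp (- b) - (1 + - b))) by (apply Rmult_lt_0_compat; lra).
  assert (0 <= x * (exp (p * b - b) - (1 + (p * b - b)))) by (apply Rmult_le_pos; lra).
  assert (0 < (p - 1) * (x * b - (x - 1))) by (apply Rmult_lt_0_compat; lra).
  lra.
Qed.

(** Bernoulli's inequality for [x / y], scaled by [y ^ p]. This supporting line is the source of
    convexity and of Jensen's inequality. *)
Lemma rpow_tangent x y p : 1 <= p -> 0 <= x -> 0 < y ->
  rpow y p + p * rpow y p / y * (x - y) <= rpow x p.
Proof.
  intros Hp Hx Hy. assert (Hpy := rpow_pos y p Hy).
  assert (Hq : 0 <= x / y) by (apply Rdiv_le_0_compat; lra).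
  replace x with (y * (x / y)) at 2 by (field; lra). rewrite rpow_mult by lra.
  assert (B := bernoulli (x / y) p Hp Hq).
  replace (rpow y p + p * rpow y p / y * (x - y)) with (rpow y p * (1 + p * (x / y - 1)))
    by (field; lra).
  apply Rmult_le_compat_l; lra.
Qed.

(** Average the supporting lines at the combination [m]: their slopes cancel. *)
Lemma rpow_convex x y l p : 1 <= p -> 0 <= x -> 0 <= y -> 0 <= l <= 1 ->
  rpow (l * x + (1 - l) * y) p <= l * rpow x p + (1 - l) * rpow y p.
Proof.
  intros Hp Hx Hy Hl. set (m := l * x + (1 - l) * y).
  assert (Hm : 0 <= m) by (unfold m; nra).
  assert (h1 := rpow_ge_0 x p). assert (h2 := rpow_ge_0 y p).
  destruct Hm as [Hm|<-]; [|rewrite rpow_0; nra].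
  assert (T1 := rpow_tangent x m p Hp Hx Hm). assert (T2 := rpow_tangent y m p Hp Hy Hm).
  set (c := p * rpow m p / m) in *.
  assert (E : l * (x - m) + (1 - l) * (y - m) = 0) by (unfold m; ring).
  assert (l * (rpow m p + c * (x - m)) <= l * rpow x p) by (apply Rmult_le_compat_l; lra).
  assert ((1 - l) * (rpow m p + c * (y - m)) <= (1 - l) * rpow y p) by (apply Rmult_le_compat_l; lra).
  assert (c * (l * (x - m) + (1 - l) * (y - m)) = 0) by (rewrite E; ring).
  lra.
Qed.

Lemma rpow_midpoint x y p : 1 <= p -> 0 <= x -> 0 <= y ->
  rpow ((x + y) / 2) p <= (rpow x p + rpow y p) / 2.
Proof.
  intros Hp Hx Hy. assert (H := rpow_convex x y (/ 2) p Hp Hx Hy ltac:(lra)).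
  replace (/ 2 * x + (1 - / 2) * y) with ((x + y) / 2) in H by field. lra.
Qed.

Lemma rpow_midpoint_strict x p : 1 < p -> 0 <= x < 1 ->
  rpow ((1 + x) / 2) p < (1 + rpow x p) / 2.
Proof.
  intros Hp Hx. set (m := (1 + x) / 2). assert (Hm : 0 < m) by (unfold m; lra).
  assert (Hpm := rpow_pos m p Hm).
  assert (T1 : rpow m p * (1 + p * (1 / m - 1)) < 1).
  { assert (0 < 1 / m) by (apply Rdiv_lt_0_compat; lra).
    assert (E1 : rpow m p * rpow (1 / m) p = 1).
    { rewrite <- rpow_mult by lra. replace (m * (1 / m)) with 1 by (field; lra). apply rpow_1. }
    apply Rlt_le_trans with (rpow m p * rpow (1 / m) p); [|lra]. apply Rmult_lt_compat_l; auto.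
    apply bernoulli_strict; try lra. intros h.
    assert (m = 1) by (apply (f_equal (Rmult m)) in h; field_simplify in h; lra).
    unfold m in *; lra. }
  assert (T2 := rpow_tangent x m p ltac:(lra) ltac:(lra) Hm).
  replace (rpow m p + p * rpow m p / m * (x - m)) with (rpow m p * (1 + p * (x / m - 1))) in T2
    by (field; lra).
  assert (E : 1 / m - 1 + (x / m - 1) = 0) by (unfold m; field; lra).
  replace (x / m - 1) with (- (1 / m - 1)) in T2 by lra. lra.
Qed.

(** Convexity between 0 and 1 gives [s ^ p <= s] on the unit interval; apply this to the shares of
    [x] and [y] in the sum. *)
Lemma rpow_superadd x y p : 1 <= p -> 0 <= x -> 0 <= y -> rpow x p + rpow y p <= rpow (x + y) p.
Proof.
  intros Hp Hx Hy.
  destruct (Req_dec (x + y) 0) as [h|h].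
  { replace x with 0 by lra. replace y with 0 by lra. rewrite Rplus_0_l, rpow_0. lra. }
  assert (Hs : 0 < x + y) by lra.
  assert (K : forall z, 0 <= z <= x + y -> rpow z p <= z / (x + y) * rpow (x + y) p).
  { intros z Hz. replace z with ((x + y) * (z / (x + y))) at 1 by (field; lra).
    assert (Hq0 : 0 <= z / (x + y)) by (apply Rdiv_le_0_compat; lra).
    rewrite rpow_mult by lra. rewrite Rmult_comm. apply Rmult_le_compat_r; [apply rpow_ge_0|].
    assert (Hq1 : z / (x + y) <= 1).
    { apply Rle_div_l; lra. }
    assert (C := rpow_convex 1 0 (z / (x + y)) p Hp ltac:(lra) ltac:(lra) ltac:(lra)).
    rewrite rpow_0, rpow_1 in C. replace (z / (x + y) * 1 + (1 - z / (x + y)) * 0) with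
      (z / (x + y)) in C by ring. lra. }
  assert (K1 := K x ltac:(lra)). assert (K2 := K y ltac:(lra)).
  replace (rpow (x + y) p) with (x / (x + y) * rpow (x + y) p + y / (x + y) * rpow (x + y) p)
    by (field; lra). lra.
Qed.

(** * The pointwise inequality behind uniform convexity *)

Lemma parallelogram (a b : C) :
  Cmod (a + b) ^ 2 + Cmod (a - b) ^ 2 = 2 * Cmod a ^ 2 + 2 * Cmod b ^ 2.
Proof. rewrite !Cmod2_alt. destruct a, b; simpl; ring. Qed.

(** The strict midpoint inequality attains its minimal gap on the compact interval. *)
Lemma rpow_gap p e : 1 < p -> 0 < e <= 1 -> exists d, 0 < d /\ forall x, 0 <= x <= 1 - e ->
  d <= (1 + rpow x p) / 2 - rpow ((1 + x) / 2) p.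
Proof.
  intros Hp He.
  (* The absolute values extend the function continuously to the whole line, where [rcont_rpow]
     wants a nonnegative base everywhere. *)
  set (phi := fun x => (1 + rpow (Rabs x) p) / 2 - rpow ((1 + Rabs x) / 2) p).
  destruct (continuity_ab_min phi 0 (1 - e)) as [m [Hm1 Hm2]]; [lra| |].
  - intros c _. apply continuity_pt_filterlim.
    assert (HA : rcont Rabs c) by (apply continuity_pt_filterlim, Rcontinuity_abs).
    change (rcont phi c). unfold phi, Rdiv. apply rcont_minus.
    + apply rcont_mult; [|apply rcont_const]. apply rcont_plus; [apply rcont_const|].
      apply rcont_rpow; auto; [lra|]. intros; apply Rabs_pos.
    + apply (rcont_rpow (fun x => (1 + Rabs x) * / 2)); [lra| |].
      * apply rcont_mult; [|apply rcont_const]. apply rcont_plus; auto. apply rcont_const.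
      * intros s. assert (h := Rabs_pos s). lra.
  - exists (phi m). split.
    + unfold phi. rewrite Rabs_pos_eq by lra.
      assert (h := rpow_midpoint_strict m p Hp ltac:(lra)). lra.
    + intros x Hx. specialize (Hm1 x Hx). unfold phi at 2 in Hm1.
      now rewrite Rabs_pos_eq in Hm1 by lra.
Qed.

(** If [|1 - c|^p] exceeds [e], there are two reasons for a gap: either [|c|] is well below 1 and
    strict convexity of the power gives it, or [|c|] is near 1 and the parallelogram law makes
    [|1 + c|] clearly smaller than [1 + |c|]. *)
Lemma uniform_convexity_normalized p e : 1 < p -> 0 < e -> exists K, 0 < K /\
  forall c : C, Cmod c <= 1 ->
    rpow (Cmod (1 - c)) p <= e * (1 + rpow (Cmod c) p)
      + K * ((1 + rpow (Cmod c) p) / 2 - rpow (Cmod ((1 + c) / 2)) p).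
Proof.
  intros Hp He.
  (* Failure of the easy case [|1 - c|^p <= e] means [|1 - c| > k]; the cap at 1 keeps [k / 2]
     admissible in [rpow_gap]. *)
  set (k := Rmin 1 (rpow e (/ p))).
  assert (Hk0 : 0 < k) by (apply Rmin_pos; [lra|now apply rpow_pos]).
  assert (Hk1 : k <= 1) by apply Rmin_l. assert (Hk2 : k <= rpow e (/ p)) by apply Rmin_r.
  destruct (rpow_gap p (k / 2) Hp ltac:(lra)) as [d1 [Hd1 G]].
  (* With [s = |1 + c| / 2] and [s0 = (1 + |c|) / 2], the parallelogram law gives [s0^2 - s^2 = (|1
     - c|^2 - (1 - |c|)^2) / 4 >= (k^2 - k^2 / 4) / 4 = 2 * q]. As [s0 + s <= 2], this yields
     [s0 - s >= q]. *)
  set (q := 3 * k ^ 2 / 32). assert (Hq : 0 < q) by (unfold q; nra).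
  assert (Hd2 := rpow_pos q p Hq).
  set (d := Rmin d1 (rpow q p)). assert (Hd : 0 < d) by (apply Rmin_pos; auto).
  assert (Hp2 := rpow_pos 2 p ltac:(lra)).
  (* The left side never exceeds [2 ^ p], and the gap is at least [d] when it is needed. *)
  exists (rpow 2 p / d). split; [now apply Rdiv_lt_0_compat|].
  intros c Hc.
  assert (hc := Cmod_ge_0 c). assert (hpc := rpow_ge_0 (Cmod c) p).
  assert (Hhalf : Cmod ((1 + c) / 2) = Cmod (1 + c) / 2).
  { rewrite Cmod_div, Cmod_RtoC by (try lra; apply RtoC_neq; lra). reflexivity. }
  assert (H1 := Cmod_triangle 1 c). rewrite Cmod_1 in H1.
  assert (h1 := Cmod_ge_0 (1 + c)).
  assert (Hmid := rpow_midpoint 1 (Cmod c) p ltac:(lra) ltac:(lra) hc). rewrite rpow_1 in Hmid.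
  assert (Hmono : rpow (Cmod ((1 + c) / 2)) p <= rpow ((1 + Cmod c) / 2) p).
  { rewrite Hhalf. apply rpow_le; lra. }
  set (D := (1 + rpow (Cmod c) p) / 2 - rpow (Cmod ((1 + c) / 2)) p).
  assert (HD0 : 0 <= D) by (unfold D; lra).
  assert (HK : 0 < rpow 2 p / d) by now apply Rdiv_lt_0_compat.
  destruct (Rle_dec (rpow (Cmod (1 - c)) p) e) as [h|h]; [nra|].
  apply Rnot_le_lt in h.
  assert (hs := Cmod_sub_le 1 c). rewrite Cmod_1 in hs.
  assert (Hkc : k < Cmod (1 - c)).
  { apply Rnot_le_lt. intros h'. apply (Rlt_irrefl e). eapply Rlt_le_trans; [exact h|].
    rewrite <- (rpow_inv_rpow e p) by lra. apply rpow_le; [lra|]. split; [apply Cmod_ge_0|lra]. }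
  assert (HD : d <= D).
  { destruct (Rle_dec (Cmod c) (1 - k / 2)) as [h2|h2].
    - apply Rle_trans with d1; [apply Rmin_l|]. specialize (G (Cmod c) ltac:(lra)).
      unfold D. lra.
    - apply Rnot_le_lt in h2. apply Rle_trans with (rpow q p); [apply Rmin_r|].
      assert (P := parallelogram 1 c). rewrite Cmod_1 in P.
      set (s := Cmod ((1 + c) / 2)) in *. set (s0 := (1 + Cmod c) / 2) in *.
      assert (Hs0 : s0 <= 1) by (unfold s0; lra).
      assert (Hs : 0 <= s) by apply Cmod_ge_0.
      assert (Hss : s + q <= s0).
      { assert (s <= s0) by (unfold s0; lra).
        assert (s ^ 2 + 2 * q <= s0 ^ 2).
        { rewrite Hhalf. unfold q, s0. 
          assert (k ^ 2 <= Cmod (1 - c) ^ 2) by (apply pow_incr; lra).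
          assert ((1 - Cmod c) ^ 2 <= (k / 2) ^ 2) by (apply pow_incr; lra). nra. }
        nra. }
      assert (A := rpow_superadd s q p ltac:(lra) Hs ltac:(lra)).
      assert (B := rpow_le (s + q) s0 p ltac:(lra) ltac:(lra)).
      unfold D. fold s. fold s0 in Hmid. lra. }
  assert (T : rpow (Cmod (1 - c)) p <= rpow 2 p).
  { apply rpow_le; [lra|]. split; [apply Cmod_ge_0|lra]. }
  assert (rpow 2 p <= rpow 2 p / d * D).
  { replace (rpow 2 p) with (rpow 2 p / d * d) at 1 by (field; lra).
    apply Rmult_le_compat_l; lra. }
  assert (0 <= e * (1 + rpow (Cmod c) p)) by (apply Rmult_le_pos; lra). lra.
Qed.

(* Pointwise form of uniform convexity: being additive, it integrates without any
   splitting of the domain. *)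
Lemma uniform_convexity_pointwise p e : 1 < p -> 0 < e -> exists K, 0 < K /\
  forall a b : C,
    rpow (Cmod (a - b)) p <= e * (rpow (Cmod a) p + rpow (Cmod b) p)
      + K * ((rpow (Cmod a) p + rpow (Cmod b) p) / 2 - rpow (Cmod ((a + b) / 2)) p).
Proof.
  intros Hp He. destruct (uniform_convexity_normalized p e Hp He) as [K [HK H]].
  exists K. split; auto.
  (* Both sides are homogeneous of degree [p], so dividing by the entry of larger modulus reduces to
     the normalized case. *)
  assert (W : forall a b : C, Cmod b <= Cmod a ->
    rpow (Cmod (a - b)) p <= e * (rpow (Cmod a) p + rpow (Cmod b) p)
      + K * ((rpow (Cmod a) p + rpow (Cmod b) p) / 2 - rpow (Cmod ((a + b) / 2)) p)).
  { intros a b Hab. assert (ha := Cmod_ge_0 a). assert (hb := Cmod_ge_0 b).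
    destruct (Ceq_dec a 0) as [->|n].
    - rewrite Cmod_0 in Hab. assert (b = 0) by (apply Cmod_eq_0; lra). subst b.
      replace (0 - 0)%C with (RtoC 0) by ring. replace ((0 + 0) / 2)%C with (RtoC 0)
        by (unfold Cdiv; ring). rewrite Cmod_0, rpow_0. lra.
    - assert (Ha : 0 < Cmod a) by now apply Cmod_gt_0.
      set (c := (b / a)%C).
      assert (Hb : b = (a * c)%C) by (unfold c; field; auto).
      assert (Hc : Cmod c <= 1).
      { unfold c. rewrite Cmod_div by auto. apply Rle_div_l; lra. }
      specialize (H c Hc).
      replace (a - b)%C with (a * (1 - c))%C by (rewrite Hb; ring).
      replace ((a + b) / 2)%C with (a * ((1 + c) / 2))%C by (rewrite Hb; unfold Cdiv; ring).
      rewrite Hb, !Cmod_mult, !rpow_mult by auto using Cmod_ge_0.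
      assert (hpa := rpow_ge_0 (Cmod a) p).
      apply (Rmult_le_compat_l (rpow (Cmod a) p)) in H; auto. lra. }
  intros a b. destruct (Rle_dec (Cmod b) (Cmod a)) as [h|h]; auto.
  rewrite Cmod_minus_sym, (Cplus_comm a b). specialize (W b a ltac:(lra)). lra.
Qed.

(** * Power means: Jensen and Minkowski *)

Definition rpow_mean (p : R) (u : R -> R) : R := rmean (fun t => rpow (u t) p).

Lemma rcontinuous_rpow u p : 0 < p -> rcontinuous u -> (forall t, 0 <= u t) ->
  rcontinuous (fun t => rpow (u t) p).
Proof. intros Hp Hu H t. apply rcont_rpow; auto. Qed.

Lemma rpow_mean_ge_0 p u : 0 < p -> rcontinuous u -> (forall t, 0 <= u t) -> 0 <= rpow_mean p u.
Proof.
  intros Hp Hu H. apply rmean_ge_0; [now apply rcontinuous_rpow|]. intros; apply rpow_ge_0.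
Qed.

Lemma rpow_mean_le p u v : 0 < p -> rcontinuous u -> rcontinuous v -> (forall t, 0 <= u t <= v t) ->
  rpow_mean p u <= rpow_mean p v.
Proof.
  intros Hp Hu Hv H. apply rmean_le.
  - apply rcontinuous_rpow; auto. intros; apply H.
  - apply rcontinuous_rpow; auto. intros t. specialize (H t). lra.
  - intros t. now apply rpow_le.
Qed.

Lemma rpow_mean_scal p u c : 0 < p -> rcontinuous u -> (forall t, 0 <= u t) -> 0 <= c ->
  rpow_mean p (fun t => c * u t) = rpow c p * rpow_mean p u.
Proof.
  intros Hp Hu H Hc. unfold rpow_mean. rewrite <- rmean_scal by now apply rcontinuous_rpow.
  apply rmean_ext. intros. now apply rpow_mult.
Qed.

Lemma rcontinuous_mult u v : rcontinuous u -> rcontinuous v -> rcontinuous (fun t => u t * v t).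
Proof. intros Hu Hv t. apply rcont_mult; auto. Qed.

Lemma rcontinuous_const c : rcontinuous (fun _ => c).
Proof. intros t. apply rcont_const. Qed.

(** Integrate the supporting line at the weighted mean [y]; the linear term drops out since the
    weight has mean 1. The case [y = 0] has no supporting line and is trivial. *)
Lemma jensen p w u : 1 <= p -> rcontinuous w -> rcontinuous u -> (forall t, 0 <= w t) ->
  (forall t, 0 <= u t) -> rmean w = 1 ->
  rpow (rmean (fun t => w t * u t)) p <= rmean (fun t => w t * rpow (u t) p).
Proof.
  intros Hp Hw Hu Hw0 Hu0 H1.
  assert (Cwu := rcontinuous_mult _ _ Hw Hu).
  assert (Cup := rcontinuous_rpow u p ltac:(lra) Hu Hu0).
  assert (Cwup := rcontinuous_mult _ _ Hw Cup).
  set (y := rmean (fun t => w t * u t)).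
  assert (Hy : 0 <= y). { apply rmean_ge_0; auto. intros; now apply Rmult_le_pos. }
  destruct Hy as [Hy|<-].
  - set (c := p * rpow y p / y).
    assert (E : rmean (fun t => (rpow y p - c * y) * w t + c * (w t * u t)) = rpow y p).
    { rewrite rmean_lin by auto. rewrite H1. fold y. ring. }
    rewrite <- E. apply rmean_le; auto.
    + intro t. apply rcont_plus; apply rcont_mult; auto; apply rcont_const.
    + intros t. assert (T := rpow_tangent (u t) y p Hp (Hu0 t) Hy). fold c in T.
      apply (Rmult_le_compat_l (w t)) in T; auto. lra.
  - rewrite rpow_0. apply rmean_ge_0; auto. intros. apply Rmult_le_pos; auto. apply rpow_ge_0.
Qed.

Lemma rmean_le_rpow_mean p u t : 1 <= p -> rcontinuous u -> (forall s, 0 <= u s) -> 0 <= t ->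
  rpow_mean p u <= rpow t p -> rmean u <= t.
Proof.
  intros Hp Hu Hu0 Ht H. apply rpow_le_inv with p; [lra|auto|].
  eapply Rle_trans; [|exact H].
  assert (J := jensen p (fun _ => 1) u Hp (rcontinuous_const 1) Hu ltac:(intros; lra) Hu0
    (rmean_const 1)). simpl in J.
  rewrite (rmean_ext (fun s => 1 * u s) u) in J by (intros; ring).
  rewrite (rmean_ext (fun s => 1 * rpow (u s) p) (fun s => rpow (u s) p)) in J by (intros; ring). exact J.
Qed.

(** Convexity of the power at [u / s'] and [v / t'] with weight [s' / (s' + t')]. The bounds [s] and
    [t] may vanish, so they are first enlarged to the positive [s'] and [t']. *)
Lemma minkowski p u v w s t : 1 <= p ->
  rcontinuous u -> rcontinuous v -> rcontinuous w ->
  (forall x, 0 <= u x) -> (forall x, 0 <= v x) -> (forall x, 0 <= w x <= u x + v x) ->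
  0 <= s -> 0 <= t -> rpow_mean p u <= rpow s p -> rpow_mean p v <= rpow t p ->
  rpow_mean p w <= rpow (s + t) p.
Proof.
  intros Hp Hu Hv Hw Hu0 Hv0 Hw0 Hs Ht Bu Bv.
  apply le_rpow_eps; try lra.
  { apply rpow_mean_ge_0; auto; [lra|]. intros; apply Hw0. }
  intros e He. set (s' := s + e / 2). set (t' := t + e / 2).
  assert (Hs' : 0 < s') by (unfold s'; lra). assert (Ht' : 0 < t') by (unfold t'; lra).
  replace (s + t + e) with (s' + t') by (unfold s', t'; lra).
  assert (Bu' : rpow_mean p u <= rpow s' p).
  { eapply Rle_trans; [exact Bu|]. apply rpow_le; unfold s'; lra. }
  assert (Bv' : rpow_mean p v <= rpow t' p).
  { eapply Rle_trans; [exact Bv|]. apply rpow_le; unfold t'; lra. }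
  set (l := s' / (s' + t')).
  assert (Hl : 0 <= l <= 1).
  { split; [apply Rdiv_le_0_compat; lra|]. apply Rle_div_l; lra. }
  set (A := rpow (s' + t') p). assert (HA : 0 < A) by (apply rpow_pos; lra).
  assert (P1 := rpow_pos s' p Hs'). assert (P2 := rpow_pos t' p Ht').
  apply Rle_trans with (rmean (fun x => (A * l / rpow s' p) * rpow (u x) p
     + (A * (1 - l) / rpow t' p) * rpow (v x) p)).
  - apply rmean_le.
    + apply rcontinuous_rpow; auto; [lra|]. intros; apply Hw0.
    + intro x. apply rcont_plus; apply rcont_mult; try apply rcont_const;
      apply rcont_rpow; auto; lra.
    + intros x. apply Rle_trans with (rpow (u x + v x) p).
      { apply rpow_le; [lra|apply Hw0]. }
      replace (u x + v x) with ((s' + t') * (l * (u x / s') + (1 - l) * (v x / t'))).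
      2: { unfold l. field. lra. }
      assert (Q1 : 0 <= u x / s') by (apply Rdiv_le_0_compat; auto).
      assert (Q2 : 0 <= v x / t') by (apply Rdiv_le_0_compat; auto).
      rewrite rpow_mult; [|lra|nra]. fold A.
      assert (Cv := rpow_convex _ _ l p Hp Q1 Q2 Hl).
      assert (E1 : rpow (u x) p = rpow s' p * rpow (u x / s') p).
      { rewrite <- rpow_mult by lra. f_equal. field. lra. }
      assert (E2 : rpow (v x) p = rpow t' p * rpow (v x / t') p).
      { rewrite <- rpow_mult by lra. f_equal. field. lra. }
      rewrite E1, E2.
      replace (A * l / rpow s' p * (rpow s' p * rpow (u x / s') p) +
        A * (1 - l) / rpow t' p * (rpow t' p * rpow (v x / t') p)) with
        (A * (l * rpow (u x / s') p + (1 - l) * rpow (v x / t') p)) by (field; lra).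
      apply Rmult_le_compat_l; lra.
  - rewrite rmean_lin by (apply rcontinuous_rpow; auto; lra).
    fold (rpow_mean p u). fold (rpow_mean p v).
    assert (I1 : A * l / rpow s' p * rpow_mean p u <= A * l).
    { apply Rle_trans with (A * l / rpow s' p * rpow s' p).
      - apply Rmult_le_compat_l; auto. apply Rdiv_le_0_compat; auto. apply Rmult_le_pos; lra.
      - right. field. lra. }
    assert (I2 : A * (1 - l) / rpow t' p * rpow_mean p v <= A * (1 - l)).
    { apply Rle_trans with (A * (1 - l) / rpow t' p * rpow t' p).
      - apply Rmult_le_compat_l; auto. apply Rdiv_le_0_compat; auto. apply Rmult_le_pos; lra.
      - right. field. lra. }
    lra.
Qed.

(** * Monotonicity of the integral means *)

Lemma fst_cmean f : fst (cmean f) = rmean (fun t => fst (f t)).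
Proof. unfold cmean, rmean, Cint. simpl. ring. Qed.

(* The Poisson integral of [v] is the real part of the Herglotz integral of [v], which is
   holomorphic. *)
Definition herglotz (v : R -> R) (r : R) (a : C) : C :=
  (2 * cauchy_transform 1 (fun t => RtoC (v t) * circle_point r t) r a - RtoC (rmean v))%C.

Lemma ccontinuous_RtoC u : rcontinuous u -> ccontinuous (fun t => RtoC (u t)).
Proof. intros H t. now apply ccurve_RtoC. Qed.

(** The Poisson kernel is the real part of [(z + a) / (z - a) = 2 z / (z - a) - 1]. *)
Lemma fst_herglotz v r a : rcontinuous v -> Cmod a < r ->
  rmean (fun t => poisson r a t * v t) = fst (herglotz v r a).
Proof.
  intros Hv Ha. assert (h0 := Cmod_ge_0 a).
  assert (C1 := ccontinuous_mult _ _ (ccontinuous_RtoC v Hv) (ccontinuous_circle_point r)).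
  assert (C2 := ccontinuous_mult _ _ C1 (ccontinuous_kernel 1 r a Ha)).
  unfold herglotz, cauchy_transform. rewrite <- (cmean_scal _ _ C2), <- cmean_RtoC.
  rewrite <- cmean_minus.
  - rewrite fst_cmean. apply rmean_ext. intros t.
    assert (n := circle_point_sub_neq r t a Ha).
    assert (Hm : 0 < Cmod (circle_point r t - a)) by now apply Cmod_gt_0.
    transitivity (fst (RtoC (v t) * ((circle_point r t + a) * Cconj (circle_point r t - a)
       * RtoC (/ Cmod (circle_point r t - a) ^ 2)))%C).
    + unfold poisson. assert (Hc := Cmod2_alt (circle_point r t)).
      rewrite Cmod_circle_point in Hc by lra. rewrite Hc, Cmod2_alt.
      set (z := circle_point r t) in *. destruct z as [x y]. destruct a as [a1 a2]. simpl.
      unfold Rdiv. ring.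
    + f_equal.
      replace (RtoC (/ Cmod (circle_point r t - a) ^ 2)) with
        (/ ((circle_point r t - a) * Cconj (circle_point r t - a)))%C.
      * set (z := circle_point r t) in *.
        assert (n' : Cconj (z - a) <> 0).
        { apply Cmod_pos_neq. rewrite Cmod_conj. exact Hm. }
        simpl. field. auto.
      * rewrite <- Cmod2_conj, RtoC_inv; auto. apply pow_nonzero. lra.
  - exact (ccontinuous_mult _ _ (ccontinuous_const 2) C2).
  - now apply ccontinuous_RtoC.
Qed.

Lemma herglotz_0 v r : rcontinuous v -> 0 < r -> herglotz v r 0 = RtoC (rmean v).
Proof.
  intros Hv Hr. unfold herglotz, cauchy_transform.
  rewrite (cmean_ext _ (fun t => RtoC (v t))).
  - rewrite cmean_RtoC. ring.
  - intros t. assert (n := circle_point_sub_neq r t 0 ltac:(rewrite Cmod_0; lra)).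
    replace (circle_point r t - 0)%C with (circle_point r t) in * by ring.
    simpl. field. exact n.
Qed.

Lemma cdiff_herglotz v r a : rcontinuous v -> Cmod a < r -> exists l, cdiff (herglotz v r) a l.
Proof.
  intros Hv Ha. eexists. unfold herglotz. apply cdiff_minus; [|apply cdiff_const].
  apply cdiff_scal. apply cdiff_cauchy_transform; auto.
  apply ccontinuous_mult; [now apply ccontinuous_RtoC|apply ccontinuous_circle_point].
Qed.

Lemma rmean_herglotz v r s : rcontinuous v -> 0 <= s < r ->
  rmean (fun t => fst (herglotz v r (circle_point s t))) = rmean v.
Proof.
  intros Hv Hs.
  rewrite <- (fst_cmean (fun t => herglotz v r (circle_point s t))).
  change (rmean v) with (fst (RtoC (rmean v))). f_equal.
  rewrite <- (herglotz_0 v r) by (auto; lra).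
  destruct (proj1 Hs) as [h|<-].
  - apply (circle_mean_center (herglotz v r) s 0); try lra.
    + intros z Hz. destruct (cdiff_herglotz v r z) as [l Hl]; auto; [lra|].
      eapply cdiff_ccont; eauto.
    + intros z Hz _. apply cdiff_herglotz; auto; lra.
  - rewrite <- (cmean_const (herglotz v r 0)). apply cmean_ext. intros t. f_equal.
    apply injective_projections; simpl; ring.
Qed.

Definition circle_abs (f : C -> C) (r t : R) : R := Cmod (f (circle_point r t)).

Lemma rcontinuous_circle_abs f r : hol f -> 0 <= r < 1 -> rcontinuous (circle_abs f r).
Proof. intros Hf Hr t. apply rcont_Cmod. now apply hol_circle. Qed.

Lemma circle_abs_ge_0 f r t : 0 <= circle_abs f r t.
Proof. apply Cmod_ge_0. Qed.

(** Let [v] be [|f|^p] on the larger circle. Its harmonic extension has the same mean on the smaller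
    circle, and there it dominates [|f|^p]. *)
Theorem rpow_mean_mono p f r s : 1 <= p -> hol f -> 0 <= r <= s -> s < 1 ->
  rpow_mean p (circle_abs f r) <= rpow_mean p (circle_abs f s).
Proof.
  intros Hp Hf [Hr [Hrs|<-]] Hs; [|lra].
  assert (Cs := rcontinuous_circle_abs f s Hf ltac:(lra)).
  assert (Cr := rcontinuous_circle_abs f r Hf ltac:(lra)).
  set (v := fun t => rpow (circle_abs f s t) p).
  assert (Hv : rcontinuous v).
  { apply rcontinuous_rpow; [lra|auto|]. intros; apply circle_abs_ge_0. }
  change (rpow_mean p (circle_abs f s)) with (rmean v).
  rewrite <- (rmean_herglotz v s r) by (auto; lra).
  apply rmean_le.
  - apply rcontinuous_rpow; [lra|auto|]. intros; apply circle_abs_ge_0.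
  - assert (CH : ccontinuous (fun t => herglotz v s (circle_point r t))).
    { apply circle_cont_ccontinuous; [lra|]. intros z Hz.
      destruct (cdiff_herglotz v s z Hv ltac:(lra)) as [l Hl]. eapply cdiff_ccont; eauto. }
    intro t. exact (proj1 (CH t)).
  - intros t. set (a := circle_point r t).
    assert (Ha : Cmod a = r) by (apply Cmod_circle_point; lra).
    rewrite <- fst_herglotz by (auto; lra).
    assert (Hw := rcontinuous_poisson s a ltac:(lra)).
    eapply Rle_trans; [|apply jensen; auto].
    + apply rpow_le; [lra|]. split; [apply Cmod_ge_0|].
      change (circle_abs f r t) with (Cmod (f a)).
      rewrite (poisson_formula f s a Hf ltac:(lra) ltac:(lra)).
      apply cmean_Cmod_le.
      * apply ccontinuous_mult; [now apply ccontinuous_RtoC|]. apply hol_circle; auto; lra.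
      * now apply rcontinuous_mult.
      * intros u. rewrite Cmod_mult, Cmod_RtoC by (apply Rlt_le, poisson_pos; lra).
        apply Rle_refl.
    + intros u. apply Rlt_le, poisson_pos; lra.
    + intros; apply circle_abs_ge_0.
    + apply rmean_poisson; lra.
Qed.

(** * Hardy norms *)

(** Bounds by [t] replace the supremum and are kept in [p]-th powers, so that norm statements become
    integral inequalities. [Hardy_carrier] and [Hardy_nrm_le] translate back. *)
Definition hardy_le (p : Rbar) (f : C -> C) (t : R) : Prop :=
  match p with
  | Finite q => forall r, 0 <= r < 1 -> rpow_mean q (circle_abs f r) <= rpow t q
  | _ => forall z, unit_disc z -> Cmod (f z) <= t
  end.

(** A member is required because the empty set has the infinite bound [m_infty]; its sign makes the
    bound [t] nonnegative. *)
Lemma lub_finite_iff (S : R -> Prop) (x0 : R) : S x0 -> 0 <= x0 ->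
  is_finite (Lub_Rbar S) <-> exists t, 0 <= t /\ forall x, S x -> x <= t.
Proof.
  intros H0 Hx0. assert (L := Lub_Rbar_correct S). split.
  - intros F. destruct (Lub_Rbar S) as [l| |]; try discriminate.
    exists l. split; [|exact (proj1 L)]. eapply Rle_trans; [exact Hx0|]. exact (proj1 L x0 H0).
  - intros [t [Ht K]]. destruct (Lub_Rbar S) as [l| |]; [reflexivity| |].
    + exfalso. apply (proj2 L (Finite t)). exact K.
    + exfalso. exact (proj1 L x0 H0).
Qed.

Lemma lub_le_iff (S : R -> Prop) t : is_finite (Lub_Rbar S) ->
  real (Lub_Rbar S) <= t <-> forall x, S x -> x <= t.
Proof.
  intros F. assert (L := Lub_Rbar_correct S). destruct (Lub_Rbar S) as [l| |]; try discriminate.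
  split.
  - intros H x Hx. eapply Rle_trans; [exact (proj1 L x Hx)|exact H].
  - intros H. exact (proj2 L (Finite t) H).
Qed.

Definition exponent (p : Rbar) : Prop := p = p_infty \/ exists q, p = Finite q /\ 1 <= q.

Lemma exponent_of_le p : Rbar_le 1 p -> exponent p.
Proof.
  destruct p as [q| |]; simpl; intros H; [right; now exists q|now left|easy].
Qed.

Definition hardy_set (p : Rbar) (f : C -> C) (t : R) : Prop :=
  match p with
  | Finite q => exists r, 0 <= r < 1 /\ t = integral_mean q f r
  | _ => exists z, unit_disc z /\ t = Cmod (f z)
  end.

Lemma hardy_norm_set p f : hardy_norm p f = Lub_Rbar (hardy_set p f).
Proof. now destruct p. Qed.

Lemma hardy_le_set p f t : exponent p -> hol f -> 0 <= t ->
  hardy_le p f t <-> forall x, hardy_set p f x -> x <= t.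
Proof.
  intros [->|[q [-> Hq]]] Hf Ht; simpl.
  - split.
    + intros H x [z [Hz ->]]. auto.
    + intros H z Hz. apply H. now exists z.
  - assert (A : forall r, 0 <= r < 1 -> 0 <= rpow_mean q (circle_abs f r)).
    { intros r Hr. apply rpow_mean_ge_0; [lra| |].
      - now apply rcontinuous_circle_abs.
      - intros; apply circle_abs_ge_0. }
    split.
    + intros H x [r [Hr ->]]. apply (rpow_inv_le (rpow_mean q (circle_abs f r))); auto. lra.
    + intros H r Hr. apply rpow_inv_le; auto; [lra|]. apply H. now exists r.
Qed.

Lemma hardy_set_inhabited p f : exists x, hardy_set p f x /\ 0 <= x.
Proof.
  assert (H0 : unit_disc 0) by (unfold unit_disc; rewrite Cmod_0; lra).
  destruct p as [q| |]; simpl.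
  - exists (integral_mean q f 0). split; [exists 0; split; [lra|auto]|]. apply rpow_ge_0.
  - exists (Cmod (f 0)). split; [now exists 0|apply Cmod_ge_0].
  - exists (Cmod (f 0)). split; [now exists 0|apply Cmod_ge_0].
Qed.

Lemma holomorphic_disc_hol f : holomorphic_disc f -> hol f.
Proof.
  intros [H _] z Hz. exists (C_derive f z). apply ex_derive_cdiff. now apply H.
Qed.

Lemma hol_holomorphic_disc f : hol f -> (forall z, 1 <= Cmod z -> f z = RtoC 0) ->
  holomorphic_disc f.
Proof.
  intros H K. split.
  - intros z Hz. destruct (H z Hz) as [l Hl]. eapply cdiff_ex_derive; eauto.
  - intros z Hz. apply K. now apply Rnot_lt_le.
Qed.

Lemma holomorphic_disc_out f z : holomorphic_disc f -> 1 <= Cmod z -> f z = RtoC 0.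
Proof. intros [_ H] Hz. apply H. unfold unit_disc. lra. Qed.

Lemma Hardy_carrier p f : exponent p ->
  carrier (Hardy p) f <-> holomorphic_disc f /\ exists t, 0 <= t /\ hardy_le p f t.
Proof.
  intros Hp. simpl. rewrite hardy_norm_set. destruct (hardy_set_inhabited p f) as [x0 [Hx Hx0]].
  split; intros [H K]; split; auto; assert (Hf := holomorphic_disc_hol f H).
  - apply (lub_finite_iff _ x0 Hx Hx0) in K. destruct K as [t [Ht K]].
    exists t. split; auto. now apply hardy_le_set.
  - apply (lub_finite_iff _ x0 Hx Hx0). destruct K as [t [Ht K]]. exists t. split; auto.
    now apply hardy_le_set.
Qed.

Lemma Hardy_nrm_le p f t : exponent p -> carrier (Hardy p) f -> 0 <= t ->
  nrm (Hardy p) f <= t <-> hardy_le p f t.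
Proof.
  intros Hp [H F] Ht. assert (Hf := holomorphic_disc_hol f H).
  rewrite hardy_le_set by auto. simpl in *. rewrite hardy_norm_set in *. now apply lub_le_iff.
Qed.

Lemma Hardy_nrm_ge_0 p f : exponent p -> carrier (Hardy p) f -> 0 <= nrm (Hardy p) f.
Proof.
  intros Hp [H F]. destruct (hardy_set_inhabited p f) as [x0 [Hx Hx0]].
  simpl in *. rewrite hardy_norm_set in *. eapply Rle_trans; [exact Hx0|].
  exact (proj1 (lub_le_iff _ _ F) (Rle_refl _) x0 Hx).
Qed.

Lemma Hardy_nrm_hardy_le p f : exponent p -> carrier (Hardy p) f ->
  hardy_le p f (nrm (Hardy p) f).
Proof. intros Hp H. apply Hardy_nrm_le; auto; [now apply Hardy_nrm_ge_0|lra]. Qed.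

Lemma hardy_le_Hardy p f t : exponent p -> holomorphic_disc f -> 0 <= t -> hardy_le p f t ->
  carrier (Hardy p) f /\ nrm (Hardy p) f <= t.
Proof.
  intros Hp H Ht K. assert (Cf : carrier (Hardy p) f) by (apply Hardy_carrier; eauto).
  split; auto. now apply Hardy_nrm_le.
Qed.

Lemma hardy_le_plus p f h s t : exponent p -> hol f -> hol h -> 0 <= s -> 0 <= t ->
  hardy_le p f s -> hardy_le p h t -> hardy_le p (fun z => f z + h z)%C (s + t).
Proof.
  intros Hp Hf Hh Hs Ht Bf Bh.
  assert (Hfh : hol (fun z => f z + h z)%C).
  { intros z Hz. destruct (Hf z Hz) as [l Hl]. destruct (Hh z Hz) as [m Hm].
    eexists. apply cdiff_plus; eauto. }
  destruct Hp as [->|[q [-> Hq]]]; simpl in *.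
  - intros z Hz. eapply Rle_trans; [apply Cmod_triangle|].
    apply Rplus_le_compat; auto.
  - intros r Hr. apply (minkowski q (circle_abs f r) (circle_abs h r));
      auto using rcontinuous_circle_abs, circle_abs_ge_0.
    intros x. split; [apply Cmod_ge_0|apply Cmod_triangle].
Qed.

Lemma hardy_le_scal p f c t : exponent p -> hol f -> 0 <= t ->
  hardy_le p f t -> hardy_le p (fun z => c * f z)%C (Cmod c * t).
Proof.
  intros Hp Hf Ht B. destruct Hp as [->|[q [-> Hq]]]; simpl in *.
  - intros z Hz. rewrite Cmod_mult. apply Rmult_le_compat_l; auto using Cmod_ge_0.
  - intros r Hr.
    replace (circle_abs (fun z => c * f z)%C r) with (fun t => Cmod c * circle_abs f r t).
    + rewrite rpow_mean_scal; auto using rcontinuous_circle_abs, circle_abs_ge_0, Cmod_ge_0; [|lra].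
      rewrite rpow_mult by auto using Cmod_ge_0.
      apply Rmult_le_compat_l; auto. apply rpow_ge_0.
    + apply functional_extensionality. intros u. unfold circle_abs. now rewrite Cmod_mult.
Qed.

Lemma hardy_le_bounded p f t : exponent p -> hol f -> 0 <= t ->
  (forall z, Cmod z < 1 -> Cmod (f z) <= t) -> hardy_le p f t.
Proof.
  intros Hp Hf Ht B. destruct Hp as [->|[q [-> Hq]]]; simpl; auto.
  intros r Hr. rewrite <- (rmean_const (rpow t q)). apply rmean_le.
  - apply rcontinuous_rpow; [lra| |].
    + now apply rcontinuous_circle_abs.
    + intros; apply circle_abs_ge_0.
  - apply rcontinuous_const.
  - intros u. apply rpow_le; [lra|]. split; [apply Cmod_ge_0|].
    apply B. rewrite Cmod_circle_point; lra.
Qed.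

(** For [r = (1 + |a|) / 2] the Poisson kernel is at most [(r + |a|) / (r - |a|) <= 4 / (1 - |a|)].
    Hence norm convergence implies locally uniform convergence. *)
Lemma hardy_le_growth p f t a : exponent p -> hol f -> 0 <= t -> hardy_le p f t ->
  Cmod a < 1 -> Cmod (f a) <= 4 / (1 - Cmod a) * t.
Proof.
  intros Hp Hf Ht B Ha. assert (h := Cmod_ge_0 a).
  assert (Hi : 0 < / (1 - Cmod a)) by (apply Rinv_0_lt_compat; lra).
  destruct Hp as [->|[q [-> Hq]]]; simpl in B.
  - eapply Rle_trans; [apply B, Ha|].
    assert (1 <= / (1 - Cmod a)).
    { rewrite <- Rinv_1. apply Rinv_le_contravar; lra. }
    unfold Rdiv. nra.
  - set (r := (1 + Cmod a) / 2).
    assert (Hr : 0 < r < 1) by (unfold r; lra).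
    eapply Rle_trans; [apply (hol_growth f r a Hf Hr); unfold r; lra|].
    assert (Hm : rmean (circle_abs f r) <= t).
    { apply (rmean_le_rpow_mean q); auto using circle_abs_ge_0.
      - apply rcontinuous_circle_abs; auto; lra.
      - apply B; lra. }
    assert (Hm0 : 0 <= rmean (circle_abs f r)).
    { apply rmean_ge_0; auto using circle_abs_ge_0. apply rcontinuous_circle_abs; auto; lra. }
    apply Rmult_le_compat; auto.
    + apply Rdiv_le_0_compat; unfold r; lra.
    + apply Rmult_le_reg_r with (r - Cmod a); [unfold r; lra|].
      unfold Rdiv at 1. rewrite Rmult_assoc, Rinv_l by (unfold r; lra).
      replace (4 / (1 - Cmod a) * (r - Cmod a)) with 2 by (unfold r; field; lra). lra.
Qed.

(** Balls of the norm are closed under locally uniform convergence: on one fixed circle the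
    approximant costs only [e] in Minkowski's inequality. *)
Lemma hardy_le_approx p f t : exponent p -> hol f -> 0 <= t ->
  (forall r e, r < 1 -> 0 < e -> exists h, hol h /\ hardy_le p h t /\
     forall z, Cmod z <= r -> Cmod (f z - h z) <= e) -> hardy_le p f t.
Proof.
  intros Hp Hf Ht H. destruct Hp as [->|[q [-> Hq]]]; simpl in *.
  - intros z Hz. apply le_eps. intros e He.
    destruct (H (Cmod z) e Hz He) as [h [_ [B K]]].
    specialize (B z Hz). specialize (K z (Rle_refl _)).
    assert (q := Cmod_sub_ge (f z) (h z)). lra.
  - intros r Hr. apply le_rpow_eps; [lra| |auto|].
    { apply rpow_mean_ge_0; auto using rcontinuous_circle_abs, circle_abs_ge_0; lra. }
    intros e He. destruct (H r e ltac:(lra) He) as [h [Hh [B K]]].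
    apply (minkowski q (circle_abs h r) (fun _ => e));
      auto using rcontinuous_circle_abs, circle_abs_ge_0, rcontinuous_const; try lra.
    + intros x. lra.
    + intros x. split; [apply Cmod_ge_0|]. unfold circle_abs.
      specialize (K (circle_point r x)). rewrite Cmod_circle_point in K by lra.
      assert (q1 := Cmod_sub_ge (f (circle_point r x)) (h (circle_point r x))). lra.
    + unfold rpow_mean. rewrite rmean_const. lra.
Qed.

Lemma hol_mul_id f : hol f -> hol (fun z => z * f z)%C.
Proof.
  intros Hf z Hz. destruct (Hf z Hz) as [l Hl]. eexists.
  apply (cdiff_mult (fun z => z)); [apply cdiff_id|exact Hl].
Qed.

(** Stands in for the limit of the radius to 1: dividing by [s] costs at most [e]. *)
Lemma exists_radius r t e : r < 1 -> 0 <= r -> 0 <= t -> 0 < e ->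
  exists s, r < s < 1 /\ t <= s * (t + e).
Proof.
  intros Hr Hr0 Ht He. exists (Rmax ((1 + r) / 2) (t / (t + e))).
  assert (q1 := Rmax_l ((1 + r) / 2) (t / (t + e))).
  assert (q2 := Rmax_r ((1 + r) / 2) (t / (t + e))).
  split; [split; [lra|]|].
  - apply Rmax_lub_lt; [lra|]. apply Rlt_div_l; lra.
  - apply Rle_div_l; [lra|exact q2].
Qed.

(** On the circle of radius [s] the factor [z] has modulus exactly [s], so [f] is bounded there by
    [t / s]. Smaller radii follow from monotonicity of the means, and for [p = oo] from the Poisson
    formula. *)
Lemma hardy_le_mul_id p f t : exponent p -> hol f -> 0 <= t ->
  hardy_le p (fun z => z * f z)%C t <-> hardy_le p f t.
Proof.
  intros Hp Hf Ht. assert (Hzf := hol_mul_id f Hf).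
  destruct Hp as [->|[q [-> Hq]]]; simpl; split; intros B.
  - intros a Ha. apply le_eps. intros e He. unfold unit_disc in *.
    assert (h := Cmod_ge_0 a).
    destruct (exists_radius (Cmod a) t e Ha h Ht He) as [r [q1 q2]].
    assert (Hb : t / r <= t + e) by (apply Rle_div_l; lra).
    eapply Rle_trans; [|exact Hb].
    rewrite (poisson_formula f r a Hf ltac:(lra) ltac:(lra)).
    assert (Hpc := rcontinuous_poisson r a ltac:(lra)).
    replace (t / r) with (rmean (fun s => t / r * poisson r a s)).
    2: { rewrite rmean_scal, rmean_poisson by (auto; lra). ring. }
    apply cmean_Cmod_le.
    + apply ccontinuous_mult; [now apply ccontinuous_RtoC|]. apply hol_circle; auto; lra.
    + apply rcontinuous_mult; auto. apply rcontinuous_const.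
    + intros s. assert (P := poisson_pos r a s ltac:(lra)).
      rewrite Cmod_mult, Cmod_RtoC, Rmult_comm by lra. apply Rmult_le_compat_r; [lra|].
      specialize (B (circle_point r s)). rewrite Cmod_mult, Cmod_circle_point in B by lra.
      specialize (B (proj2 q1)). apply Rmult_le_reg_l with r; [lra|].
      replace (r * (t / r)) with t by (field; lra). exact B.
  - intros z Hz. rewrite Cmod_mult. unfold unit_disc in *.
    specialize (B z Hz). assert (h := Cmod_ge_0 z). assert (h' := Cmod_ge_0 (f z)). nra.
  - intros r Hr.
    assert (Crf := rcontinuous_circle_abs f r Hf Hr).
    apply le_rpow_eps; [lra| |auto|].
    { apply rpow_mean_ge_0; auto using circle_abs_ge_0; lra. }
    intros e He.
    destruct (exists_radius r t e (proj2 Hr) (proj1 Hr) Ht He) as [s [q1 Hb]].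
    eapply Rle_trans; [apply (rpow_mean_mono q f r s); auto; lra|].
    specialize (B s ltac:(lra)).
    replace (circle_abs (fun z => z * f z)%C s) with (fun u => s * circle_abs f s u) in B.
    2: { apply functional_extensionality. intros u. unfold circle_abs.
         now rewrite Cmod_mult, Cmod_circle_point by lra. }
    assert (Csf := rcontinuous_circle_abs f s Hf ltac:(lra)).
    rewrite rpow_mean_scal in B; auto using circle_abs_ge_0; try lra.
    assert (B2 := rpow_le _ _ q ltac:(lra) (conj Ht Hb)).
    rewrite rpow_mult in B2 by lra.
    apply Rmult_le_reg_l with (rpow s q); [apply rpow_pos; lra|]. lra.
  - intros r Hr. eapply Rle_trans; [|apply B, Hr].
    apply rpow_mean_le; auto using rcontinuous_circle_abs; [lra|].
    intros u. unfold circle_abs. rewrite Cmod_mult, Cmod_circle_point by lra.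
    assert (h := Cmod_ge_0 (f (circle_point r u))). nra.
Qed.

Ltac eq_in_C := match goal with |- @eq _ ?a ?b => change (@eq C a b) end.

(** * Uniformly convex Banach spaces are reflexive *)

Section Normed.

Context {E : ModuleSpace C_Ring} (X : nspace E) (HX : is_normed_space X).

Lemma ns_zero : carrier X zero.
Proof. apply HX. Qed.
Lemma ns_plus x y : carrier X x -> carrier X y -> carrier X (plus x y).
Proof. apply HX. Qed.
Lemma ns_scal a x : carrier X x -> carrier X (scal a x).
Proof. apply HX. Qed.
Lemma ns_ge_0 x : carrier X x -> 0 <= nrm X x.
Proof. apply HX. Qed.
Lemma ns_eq_0 x : carrier X x -> nrm X x = 0 -> x = zero.
Proof. apply HX. Qed.
Lemma ns_nrm_scal a x : carrier X x -> nrm X (scal a x) = Cmod a * nrm X x.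
Proof. apply HX. Qed.
Lemma ns_triangle x y : carrier X x -> carrier X y -> nrm X (plus x y) <= nrm X x + nrm X y.
Proof. apply HX. Qed.

Lemma opp_scal (x : E) : opp x = scal (RtoC (-1)) x.
Proof.
  rewrite <- (scal_opp_one x). f_equal. apply injective_projections; simpl; ring.
Qed.

Lemma ns_opp x : carrier X x -> carrier X (opp x).
Proof. intros H. rewrite opp_scal. now apply ns_scal. Qed.
Lemma ns_minus x y : carrier X x -> carrier X y -> carrier X (minus x y).
Proof. intros H K. apply ns_plus; auto. now apply ns_opp. Qed.

Lemma ns_nrm_zero : nrm X zero = 0.
Proof.
  rewrite <- (scal_zero_r (K := C_Ring) (RtoC 0)), ns_nrm_scal by apply ns_zero.
  rewrite Cmod_0. ring.
Qed.

Lemma ns_nrm_opp x : carrier X x -> nrm X (opp x) = nrm X x.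
Proof.
  intros H. rewrite opp_scal, ns_nrm_scal by auto.
  rewrite Cmod_R, Rabs_left by lra. ring.
Qed.

Lemma ns_minus_sym x y : carrier X x -> carrier X y -> nrm X (minus x y) = nrm X (minus y x).
Proof. intros H K. rewrite <- opp_minus. apply ns_nrm_opp. now apply ns_minus. Qed.

Lemma dual_linear_plus phi x y : carrier (dual X) phi -> carrier X x -> carrier X y ->
  phi (plus x y) = (phi x + phi y)%C.
Proof. intros [[H _] _]. apply H. Qed.

Lemma dual_linear_scal phi a x : carrier (dual X) phi -> carrier X x ->
  phi (scal a x) = (a * phi x)%C.
Proof. intros [[_ H] _]. apply H. Qed.

Lemma dual_linear_minus phi x y : carrier (dual X) phi -> carrier X x -> carrier X y ->
  phi (minus x y) = (phi x - phi y)%C.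
Proof.
  intros H Hx Hy. unfold minus. rewrite dual_linear_plus, opp_scal, dual_linear_scal; auto.
  - eq_in_C; ring.
  - now apply ns_opp.
Qed.

Lemma dual_linear_zero phi : carrier (dual X) phi -> phi zero = RtoC 0.
Proof.
  intros H. rewrite <- (scal_zero_r (K := C_Ring) (RtoC 0)), dual_linear_scal; auto.
  - eq_in_C; ring.
  - apply ns_zero.
Qed.

(** Boundedness and the presence of 0 in the unit ball make the supremum finite, so [real] returns
    it and not its default value. *)
Lemma dual_lub phi : carrier (dual X) phi ->
  is_lub_Rbar (fun t : R => exists x, carrier X x /\ nrm X x <= 1 /\ t = Cmod (phi x))
    (nrm (dual X) phi).
Proof.
  intros H. set (A := fun t : R => _).
  assert (L := Lub_Rbar_correct A). change (nrm (dual X) phi) with (real (Lub_Rbar A)).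
  destruct H as [Hl [[M HM] _]].
  assert (A0 : A (Cmod (phi zero))).
  { exists zero. repeat split; auto using ns_zero. rewrite ns_nrm_zero; lra. }
  destruct (Lub_Rbar A) as [l| |]; auto; destruct L as [L1 L2].
  (* In a trivial space the constant [M] may be negative, hence the absolute value. *)
  - exfalso. specialize (L2 (Rabs M)). apply L2. intros t [x [Hx [Hx1 ->]]]. simpl.
    eapply Rle_trans; [apply HM; auto|].
    apply Rle_trans with (Rabs M * nrm X x).
    + apply Rmult_le_compat_r; [now apply ns_ge_0|apply Rle_abs].
    + rewrite <- (Rmult_1_r (Rabs M)) at 2. apply Rmult_le_compat_l; auto. apply Rabs_pos.
  - exfalso. exact (L1 _ A0).
Qed.

Lemma dual_nrm_le phi c : carrier (dual X) phi ->
  (forall x, carrier X x -> nrm X x <= 1 -> Cmod (phi x) <= c) -> nrm (dual X) phi <= c.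
Proof.
  intros H K. apply (proj2 (dual_lub phi H) c). intros t [x [Hx [Hx1 ->]]]. now apply K.
Qed.

Lemma dual_unit_le phi x : carrier (dual X) phi -> carrier X x -> nrm X x <= 1 ->
  Cmod (phi x) <= nrm (dual X) phi.
Proof. intros H Hx H1. apply (proj1 (dual_lub phi H)). now exists x. Qed.

Lemma dual_nrm_ge_0 phi : carrier (dual X) phi -> 0 <= nrm (dual X) phi.
Proof.
  intros H. eapply Rle_trans; [|apply (dual_unit_le phi zero)]; auto using ns_zero.
  - apply Cmod_ge_0.
  - rewrite ns_nrm_zero; lra.
Qed.

Lemma dual_apply_le phi x : carrier (dual X) phi -> carrier X x ->
  Cmod (phi x) <= nrm (dual X) phi * nrm X x.
Proof.
  intros H Hx. assert (h := ns_ge_0 x Hx).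
  destruct h as [h|h].
  - assert (U := dual_unit_le phi (scal (RtoC (/ nrm X x)) x) H (ns_scal _ _ Hx)).
    assert (Hi := Rinv_0_lt_compat _ h).
    rewrite ns_nrm_scal, Cmod_RtoC, Rinv_l in U by (auto; lra).
    specialize (U (Rle_refl 1)). rewrite dual_linear_scal, Cmod_mult, Cmod_RtoC in U by (auto; lra).
    apply (Rmult_le_compat_r (nrm X x)) in U; [|lra].
    rewrite (Rmult_comm (/ _)), Rmult_assoc, Rinv_l in U by lra. lra.
  - assert (x = zero) by (apply ns_eq_0; auto). subst x.
    rewrite dual_linear_zero, Cmod_0 by auto. rewrite <- h. lra.
Qed.

Lemma dual_approx phi e : carrier (dual X) phi -> 0 < e ->
  exists x, carrier X x /\ nrm X x <= 1 /\ nrm (dual X) phi - e < fst (phi x).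
Proof.
  intros H He. apply NNPP. intros N.
  assert (B : nrm (dual X) phi <= nrm (dual X) phi - e); [|lra].
  apply dual_nrm_le; auto. intros x Hx Hx1. apply Rnot_lt_le. intros h. apply N.
  destruct (exists_rotation (phi x)) as [c [Hc E0]].
  exists (scal c x). split; [now apply ns_scal|]. split.
  - rewrite ns_nrm_scal, Hc by auto. lra.
  - rewrite dual_linear_scal, E0 by auto. exact h.
Qed.

Lemma dual_carrier_plus phi psi : carrier (dual X) phi -> carrier (dual X) psi ->
  carrier (dual X) (fun x => phi x + psi x)%C.
Proof.
  intros H K. split; [split|split].
  - intros x y Hx Hy. rewrite !dual_linear_plus by auto.
    change ((phi x + phi y + (psi x + psi y))%C = ((phi x + psi x) + (phi y + psi y))%C). ring.
  - intros a x Hx. rewrite !dual_linear_scal by auto.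
    change ((a * phi x + a * psi x)%C = (a * (phi x + psi x))%C). ring.
  - exists (nrm (dual X) phi + nrm (dual X) psi). intros x Hx.
    eapply Rle_trans; [apply Cmod_triangle|].
    assert (h1 := dual_apply_le phi x H Hx). assert (h2 := dual_apply_le psi x K Hx). lra.
  - intros x Hx. destruct H as [_ [_ H]]. destruct K as [_ [_ K]].
    rewrite H, K by auto. apply Cplus_0_r.
Qed.

Lemma dual_carrier_scal a phi : carrier (dual X) phi -> carrier (dual X) (fun x => a * phi x)%C.
Proof.
  intros H. split; [split|split].
  - intros x y Hx Hy. rewrite !dual_linear_plus by auto.
    change ((a * (phi x + phi y))%C = ((a * phi x) + (a * phi y))%C). ring.
  - intros b x Hx. rewrite !dual_linear_scal by auto.
    change ((a * (b * phi x))%C = (b * (a * phi x))%C). ring.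
  - exists (Cmod a * nrm (dual X) phi). intros x Hx.
    rewrite Cmod_mult, Rmult_assoc. apply Rmult_le_compat_l; [apply Cmod_ge_0|].
    now apply dual_apply_le.
  - intros x Hx. destruct H as [_ [_ H]]. rewrite H by auto. apply Cmult_0_r.
Qed.

Lemma dual_nrm_scal_le a phi : carrier (dual X) phi ->
  nrm (dual X) (fun x => a * phi x)%C <= Cmod a * nrm (dual X) phi.
Proof.
  intros H. apply dual_nrm_le; [now apply dual_carrier_scal|]. intros x Hx H1.
  rewrite Cmod_mult. apply Rmult_le_compat_l; [apply Cmod_ge_0|]. now apply dual_unit_le.
Qed.

Lemma dual_normed : is_normed_space (dual X).
Proof.
  refine (conj _ (conj _ (conj _ (conj _ (conj _ (conj _ _)))))).
  - split; [split|split].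
    + intros x y _ _. change (RtoC 0 = (0 + 0)%C). ring.
    + intros a x _. change (RtoC 0 = (a * 0)%C). ring.
    + exists 0. intros x _. change (Cmod 0 <= 0 * nrm X x). rewrite Cmod_0. lra.
    + reflexivity.
  - intros phi psi. apply dual_carrier_plus.
  - intros a phi. apply dual_carrier_scal.
  - apply dual_nrm_ge_0.
  - intros phi H H0. apply functional_extensionality. intros x. change (phi x = RtoC 0).
    destruct (classic (carrier X x)) as [Hx|Hx].
    + apply Cmod_eq_0. assert (h := dual_apply_le phi x H Hx). assert (h' := Cmod_ge_0 (phi x)).
      rewrite H0 in h. lra.
    + now apply H.
  - intros a phi H. apply Rle_antisym; [now apply dual_nrm_scal_le|].
    destruct (Ceq_dec a 0) as [->|n].
    + rewrite Cmod_0, Rmult_0_l. apply dual_nrm_ge_0. now apply dual_carrier_scal.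
    + assert (Ha : 0 < Cmod a) by now apply Cmod_gt_0.
      (* The reverse inequality is the same estimate for the scalar [/ a] and the functional
         [a * phi]. *)
      assert (K := dual_nrm_scal_le (/ a)%C _ (dual_carrier_scal a phi H)).
      assert (Q : (fun x : E => (/ a * (a * phi x))%C) = phi).
      { apply functional_extensionality; intros x.
        rewrite Cmult_assoc, Cinv_l, Cmult_1_l by auto. reflexivity. }
      assert (K' : nrm (dual X) phi <= Cmod (/ a) * nrm (dual X) (scal a phi)).
      { eapply Rle_trans; [|exact K]. right. symmetry. exact (f_equal (nrm (dual X)) Q). }
      clear K. rename K' into K.
      rewrite Cmod_inv in K by auto.
      apply (Rmult_le_compat_l (Cmod a)) in K; [|lra].
      rewrite <- Rmult_assoc, Rinv_r, Rmult_1_l in K by lra. exact K.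
  - intros phi psi H K. apply dual_nrm_le; [now apply dual_carrier_plus|].
    intros x Hx H1. eapply Rle_trans; [apply Cmod_triangle|].
    apply Rplus_le_compat; now apply dual_unit_le.
Qed.

End Normed.

(** The contrapositive of uniform convexity on the whole closed ball. In this form near-norming
    points, which need not have norm 1, can be compared directly. *)
Definition uniformly_convex_ball {E : ModuleSpace C_Ring} (X : nspace E) : Prop :=
  forall e, 0 < e -> exists d, 0 < d /\ forall x y, carrier X x -> carrier X y ->
    nrm X x <= 1 -> nrm X y <= 1 -> 1 - d < nrm X (scal (RtoC (/ 2)) (plus x y)) ->
    nrm X (minus x y) < e.

Lemma uniformly_convex_of_ball {E : ModuleSpace C_Ring} (X : nspace E) :
  uniformly_convex_ball X -> uniformly_convex X.
Proof.
  intros H e He. destruct (H e ltac:(lra)) as [d [Hd K]]. exists d. split; auto.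
  intros x y Hx Hy H1 H2 H3. apply Rnot_lt_le. intros h.
  specialize (K x y Hx Hy ltac:(lra) ltac:(lra) h). lra.
Qed.

Lemma inv_INR_small e : 0 < e -> exists N, forall n, (N <= n)%nat -> / INR (S n) <= e.
Proof.
  intros He. destruct (archimed_cor1 e He) as [N [HN HN0]]. exists N. intros n Hn.
  apply Rle_trans with (/ INR N); [|lra].
  apply Rinv_le_contravar; [apply lt_0_INR; lia|]. apply le_INR. lia.
Qed.

Section Reflexive.

Context {E : ModuleSpace C_Ring} (X : nspace E) (HX : is_banach X)
  (UC : uniformly_convex_ball X).
Context (L : (E -> C) -> C) (HL : carrier (dual (dual X)) L).
Context (HN : 0 < nrm (dual (dual X)) L).

Let N := nrm (dual (dual X)) L.
Let HXn : is_normed_space X := proj1 HX.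
Let HYn : is_normed_space (dual X) := dual_normed X HXn.

Lemma fst_le_Cmod (z : C) : fst z <= Cmod z.
Proof. eapply Rle_trans; [apply Rle_abs|apply Cmod_fst_le]. Qed.

(* [phi] nearly norms [L], and [x] nearly norms [phi]. *)
Definition norming (eta : R) (phi : E -> C) (x : E) : Prop :=
  carrier (dual X) phi /\ nrm (dual X) phi <= 1 /\ N * (1 - eta) < fst (L phi) /\
  carrier X x /\ nrm X x <= 1 /\ 1 - 2 * eta < fst (phi x).

Lemma norming_exists eta : 0 < eta -> exists phi x, norming eta phi x.
Proof.
  intros He.
  assert (HNe : 0 < N * eta) by now apply Rmult_lt_0_compat.
  destruct (dual_approx (dual X) HYn L (N * eta) HL HNe) as [phi [H1 [H2 H3]]].
  assert (H4 := dual_apply_le (dual X) HYn L phi HL H1).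
  assert (H5 := fst_le_Cmod (L phi)). fold N in H3, H4.
  assert (H6 : 1 - eta < nrm (dual X) phi).
  { apply Rmult_lt_reg_l with N; [exact HN|]. lra. }
  destruct (dual_approx X HXn phi eta H1 He) as [x [K1 [K2 K3]]].
  exists phi, x. repeat split; try apply H1; auto; lra.
Qed.

(** A functional of norm at most 1 with large values at [x] and [y] is large at the midpoint, which
    bounds the norm of the midpoint from below. *)
Lemma convex_norming d e phi x y : carrier (dual X) phi -> nrm (dual X) phi <= 1 ->
  carrier X x -> carrier X y -> nrm X x <= 1 -> nrm X y <= 1 ->
  (forall x y, carrier X x -> carrier X y ->
    nrm X x <= 1 -> nrm X y <= 1 -> 1 - d < nrm X (scal (RtoC (/ 2)) (plus x y)) ->
    nrm X (minus x y) < e) ->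
  2 - 2 * d < fst (phi x) + fst (phi y) -> nrm X (minus x y) < e.
Proof.
  intros H H1 Hx Hy Hx1 Hy1 K Hs. apply K; auto.
  set (m := scal (RtoC (/ 2)) (plus x y)).
  assert (Hm : carrier X m) by (apply ns_scal, ns_plus; auto).
  assert (B := dual_apply_le X HXn phi m H Hm). assert (B0 := ns_ge_0 X HXn m Hm).
  assert (B1 := fst_le_Cmod (phi m)).
  assert (Em : fst (phi m) = / 2 * (fst (phi x) + fst (phi y))).
  { unfold m. rewrite (dual_linear_scal X phi), (dual_linear_plus X phi) by (auto; apply ns_plus; auto).
    simpl. ring. }
  assert (nrm (dual X) phi * nrm X m <= nrm X m) by nra. lra.
Qed.

(** Perturb [phi] to [psi = phi + t h] and let [y] nearly norm [psi]. Both [x] and [y] nearly norm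
    [phi], so they are close, and the norm of [psi] is at most [1 + t Re h(x)] up to a small error.
    Comparing with [Re L psi >= N (1 - eta) + t Re L h] and dividing by [t] bounds
    [Re (L h - N h(x))]. *)
Lemma norming_approx e : 0 < e -> exists eta0, 0 < eta0 /\ forall eta phi x,
  0 < eta <= eta0 -> norming eta phi x ->
  forall h, carrier (dual X) h -> nrm (dual X) h <= 1 -> Cmod (L h - N * h x) <= N * e.
Proof.
  intros He. destruct (UC (e / 2) ltac:(lra)) as [d [Hd K]].
  set (t := d / 4). assert (Ht : 0 < t) by (unfold t; lra).
  (* The first bound makes the values of [phi] at [x] and [y] add up to more than [2 - 5 eta - 2 t],
     hence more than [2 - 2 d]. The second gives [2 eta <= t e / 2], so that division by [t] leaves
     at most [e]. *)
  exists (Rmin (d / 4) (t * e / 4)). split; [apply Rmin_pos; nra|].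
  intros eta phi x [Heta Heta1] [P1 [P2 [P3 [P4 [P5 P6]]]]].
  assert (q1 := Rle_trans _ _ _ Heta1 (Rmin_l _ _)).
  assert (q2 := Rle_trans _ _ _ Heta1 (Rmin_r _ _)).
  (* It suffices to bound the real part, as [h] may be multiplied by a unimodular number. *)
  assert (R1 : forall h, carrier (dual X) h -> nrm (dual X) h <= 1 ->
    fst (L h) - N * fst (h x) <= N * e).
  { intros h Hh Hh1.
    set (psi := (fun z => phi z + RtoC t * h z)%C).
    assert (Hpsi : carrier (dual X) psi).
    { apply dual_carrier_plus; auto. now apply dual_carrier_scal. }
    destruct (dual_approx X HXn psi eta Hpsi Heta) as [y [Y1 [Y2 Y3]]].
    assert (Lpsi : L psi = (L phi + RtoC t * L h)%C).
    { change psi with (plus (phi : fct_ModuleSpace E C_ModuleSpace)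
        (scal (RtoC t) (h : fct_ModuleSpace E C_ModuleSpace))).
      rewrite (dual_linear_plus (dual X) L), (dual_linear_scal (dual X) L); auto.
      now apply dual_carrier_scal. }
    assert (B1 := dual_apply_le (dual X) HYn L psi HL Hpsi).
    assert (B2 := fst_le_Cmod (L psi)). fold N in B1.
    assert (Y4 := dual_unit_le X HXn h y Hh Y1 Y2). assert (Y5 := fst_le_Cmod (h y)).
    assert (Y6 := dual_unit_le X HXn phi y P1 Y1 Y2). assert (Y7 := fst_le_Cmod (phi y)).
    assert (Epsi : fst (psi y) = fst (phi y) + t * fst (h y)) by (unfold psi; simpl; ring).
    assert (ELpsi : fst (L psi) = fst (L phi) + t * fst (L h)) by (rewrite Lpsi; simpl; ring).
    assert (Z1 := dual_unit_le X HXn psi x Hpsi P4 P5). assert (Z2 := fst_le_Cmod (psi x)).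
    assert (Z3 : fst (psi x) = fst (phi x) + t * fst (h x)) by (unfold psi; simpl; ring).
    assert (Z4 := dual_unit_le X HXn h x Hh P4 P5).
    assert (Z5 := Cmod_fst_le (h x)). apply Rabs_le_between in Z5.
    assert (Hyx : nrm X (minus x y) < e / 2).
    { apply (convex_norming d (e / 2) phi); auto.
      assert (t * fst (h y) <= t * 1) by (apply Rmult_le_compat_l; lra).
      assert (t * (-1) <= t * fst (h x)) by (apply Rmult_le_compat_l; lra).
      unfold t in *; lra. }
    assert (W := dual_apply_le X HXn h (minus y x) Hh (ns_minus X HXn _ _ Y1 P4)).
    rewrite (ns_minus_sym X HXn y x Y1 P4) in W.
    assert (W1 := fst_le_Cmod (h (minus y x))).
    rewrite (dual_linear_minus X HXn h y x Hh Y1 P4) in W, W1.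
    change (fst (h y) - fst (h x) <= Cmod (h y - h x)) in W1.
    assert (W0 := ns_ge_0 X HXn _ (ns_minus X HXn _ _ P4 Y1)).
    assert (W2 : fst (h y) <= fst (h x) + e / 2).
    { assert (nrm (dual X) h * nrm X (minus x y) <= 1 * nrm X (minus x y))
        by (apply Rmult_le_compat_r; auto). lra. }
    assert (F1 : nrm (dual X) psi <= eta + 1 + t * fst (h x) + t * (e / 2)).
    { assert (t * fst (h y) <= t * (fst (h x) + e / 2)) by (apply Rmult_le_compat_l; lra). lra. }
    assert (F2 : N * nrm (dual X) psi <= N * (eta + 1 + t * fst (h x) + t * (e / 2))).
    { apply Rmult_le_compat_l; auto. apply Rlt_le, HN. }
    assert (F3 : t * (fst (L h) - N * fst (h x)) <= N * (2 * eta + t * (e / 2))) by lra.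
    assert (F4 : N * (2 * eta + t * (e / 2)) <= N * (t * e)).
    { apply Rmult_le_compat_l; [apply Rlt_le, HN|]. lra. }
    apply Rmult_le_reg_l with t; auto. lra. }
  intros h Hh Hh1.
  set (w := (L h - N * h x)%C).
  destruct (exists_rotation w) as [c [Hc Ec]].
  specialize (R1 (fun z => c * h z)%C (dual_carrier_scal X HXn c h Hh)).
  assert (B := dual_nrm_scal_le X HXn c h Hh). rewrite Hc in B.
  specialize (R1 ltac:(lra)).
  assert (EL : L (fun z => c * h z)%C = (c * L h)%C)
    by exact (dual_linear_scal (dual X) L c h HL Hh).
  rewrite EL in R1.
  replace (Cmod w) with (fst (c * L h)%C - N * fst (c * h x)%C); auto.
  apply (f_equal fst) in Ec. simpl fst at 2 in Ec. rewrite <- Ec. unfold w. simpl. ring.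
Qed.

(** The points [x n] approximate [L / N] uniformly on the dual ball; once they converge, [N] times
    the limit represents [L]. *)
Lemma norming_representation : exists x, carrier X x /\
  forall phi, carrier (dual X) phi -> L phi = phi x.
Proof.
  assert (HI : forall n, 0 < / INR (S n)) by (intros n; apply Rinv_0_lt_compat, lt_0_INR; lia).
  destruct (choice (fun n (q : (E -> C) * E) => norming (/ INR (S n)) (fst q) (snd q)))
    as [q Hq].
  { intros n. destruct (norming_exists (/ INR (S n)) (HI n)) as [phi [x H]].
    now exists (phi, x). }
  set (x := fun n => snd (q n)). set (f := fun n => fst (q n)).
  assert (HQ : forall n, norming (/ INR (S n)) (f n) (x n)) by exact Hq.
  assert (Approx : forall e, 0 < e -> exists M, forall n h, (M <= n)%nat ->
     carrier (dual X) h -> nrm (dual X) h <= 1 -> Cmod (L h - N * h (x n)) <= N * e).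
  { intros e He. destruct (norming_approx e He) as [eta0 [H0 K]].
    destruct (inv_INR_small eta0 H0) as [M HM]. exists M. intros n h Hn Hh Hh1.
    apply (K (/ INR (S n)) (f n)); auto. }
  destruct (proj2 HX x) as [l [Hl Hlim]].
  { intros n. apply (HQ n). }
  (* [L (f n)] is close to [N], so the approximation forces [f n (x m)] close to 1 for all large
     [m]. Thus [x m] and [x n] nearly norm the same functional [f n]. *)
  { intros e He. destruct (UC e He) as [d [Hd K]].
    destruct (Approx (d / 2) ltac:(lra)) as [M1 HM1].
    destruct (inv_INR_small (d / 8) ltac:(lra)) as [M2 HM2].
    exists (M1 + M2)%nat. intros m n Hm Hn.
    destruct (HQ n) as [P1 [P2 [P3 [P4 [P5 P6]]]]].
    destruct (HQ m) as [_ [_ [_ [Q4 [Q5 _]]]]].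
    apply (convex_norming d e (f n)); auto.
    assert (A := HM1 m (f n) ltac:(lia) P1 P2).
    assert (A1 := Cmod_fst_le (L (f n) - N * f n (x m))%C). simpl in A1.
    apply Rabs_le_between in A1.
    assert (B := HM2 n ltac:(lia)).
    assert (A3 : N * (1 - / INR (S n)) - N * fst (f n (x m)) < N * (d / 2)) by lra.
    assert (A4 : 1 - / INR (S n) - fst (f n (x m)) < d / 2).
    { apply Rmult_lt_reg_l with N; [exact HN|]. lra. }
    lra. }
  exists (scal (RtoC N) l). split; [now apply ns_scal|].
  intros phi Hphi. rewrite (dual_linear_scal X phi) by auto.
  (* The approximation is known on the dual unit ball only; adding 1 allows the rescaling even for
     [phi = 0]. *)
  set (c := nrm (dual X) phi + 1).
  assert (Hc : 1 <= c) by (assert (h := dual_nrm_ge_0 X HXn phi Hphi); unfold c; lra).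
  assert (Hci : 0 < / c) by (apply Rinv_0_lt_compat; lra).
  set (h := (fun z => RtoC (/ c) * phi z)%C).
  assert (Hh : carrier (dual X) h) by now apply dual_carrier_scal.
  assert (Hh1 : nrm (dual X) h <= 1).
  { eapply Rle_trans; [now apply dual_nrm_scal_le|]. rewrite Cmod_RtoC by lra.
    apply Rmult_le_reg_l with c; [lra|]. rewrite <- Rmult_assoc, Rinv_r, Rmult_1_l by lra.
    unfold c; lra. }
  assert (Eq : L h = (N * h l)%C).
  { apply Ceps_eq. intros e He.
    assert (HNN : 0 < N) by exact HN.
    set (e' := e / (2 * N)).
    assert (He' : 0 < e') by (apply Rdiv_lt_0_compat; lra).
    destruct (Approx e' He') as [M1 HM1]. destruct (Hlim e' He') as [M2 HM2].
    set (n := (M1 + M2)%nat).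
    assert (A := HM1 n h ltac:(lia) Hh Hh1). specialize (HM2 n ltac:(lia)).
    assert (Hxn : carrier X (x n)) by apply (HQ n).
    assert (B := dual_apply_le X HXn h (minus (x n) l) Hh (ns_minus X HXn _ _ Hxn Hl)).
    rewrite (dual_linear_minus X HXn) in B by auto.
    assert (B0 := ns_ge_0 X HXn _ (ns_minus X HXn _ _ Hxn Hl)).
    assert (B1 : Cmod (h (x n) - h l) <= e') by nra.
    eapply Rle_trans; [apply (Cmod_triangle_minus _ (N * h (x n))%C)|].
    replace (N * h (x n) - N * h l)%C with (RtoC N * (h (x n) - h l))%C by ring.
    rewrite Cmod_mult, Cmod_RtoC by lra.
    assert (N * Cmod (h (x n) - h l) <= N * e') by (apply Rmult_le_compat_l; lra).
    assert (EE : N * e' + N * e' = e) by (unfold e'; field; lra). lra. }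
  assert (EL : L h = (RtoC (/ c) * L phi)%C)
    by exact (dual_linear_scal (dual X) L (RtoC (/ c)) phi HL Hphi).
  rewrite EL in Eq. unfold h in Eq.
  assert (Hcc : (RtoC c * RtoC (/ c) = 1)%C).
  { rewrite <- RtoC_mult. f_equal. field. lra. }
  apply (f_equal (Cmult (RtoC c))) in Eq.
  rewrite Cmult_assoc, Hcc in Eq.
  replace (RtoC c * (N * (RtoC (/ c) * phi l)))%C with (RtoC c * RtoC (/ c) * (N * phi l))%C in Eq by ring.
  rewrite Hcc, !Cmult_1_l in Eq. exact Eq.
Qed.

End Reflexive.

Theorem milman_pettis {E : ModuleSpace C_Ring} (X : nspace E) :
  is_banach X -> uniformly_convex_ball X -> reflexive_space X.
Proof.
  intros HX UC L HL.
  assert (HXn := proj1 HX). assert (HYn := dual_normed X HXn).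
  destruct (dual_nrm_ge_0 (dual X) HYn L HL) as [h|h].
  - now apply (norming_representation X).
  - exists zero. split; [now apply ns_zero|]. intros phi Hphi.
    rewrite (dual_linear_zero X HXn) by auto. apply Cmod_eq_0.
    assert (B := dual_apply_le (dual X) HYn L phi HL Hphi). rewrite <- h in B.
    assert (B0 := Cmod_ge_0 (L phi)). lra.
Qed.

(** * Transfer along an isometry *)

Section Transfer.

Context {E F : ModuleSpace C_Ring} (X : nspace E) (Y : nspace F) (U : E -> F).
Context (HY : is_normed_space Y).
Context (X0 : carrier X zero).
Context (Xplus : forall x y, carrier X x -> carrier X y -> carrier X (plus x y)).
Context (Xscal : forall (a : C) x, carrier X x -> carrier X (scal a x)).
Context (Ulin : linear_on X U).
Context (Uinto : maps_into X Y U).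
Context (Uonto : maps_onto X Y U).
Context (Uinj : forall x y, carrier X x -> carrier X y -> U x = U y -> x = y).
Context (Uiso : forall x, carrier X x -> nrm Y (U x) = nrm X x).

Lemma transfer_minus x y : carrier X x -> carrier X y ->
  carrier X (minus x y) /\ U (minus x y) = minus (U x) (U y).
Proof.
  intros Hx Hy. unfold minus. rewrite opp_scal. split; [now apply Xplus, Xscal|].
  rewrite (proj1 Ulin) by auto. rewrite (proj2 Ulin) by auto. now rewrite <- opp_scal.
Qed.

Lemma transfer_nrm_minus x y : carrier X x -> carrier X y ->
  nrm X (minus x y) = nrm Y (minus (U x) (U y)).
Proof.
  intros Hx Hy. destruct (transfer_minus x y Hx Hy) as [H <-]. symmetry; auto.
Qed.

Lemma transfer_zero : U zero = zero.
Proof.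
  assert (H := proj2 Ulin (@zero C_Ring) zero X0).
  now rewrite (scal_zero_l (V := E)), (scal_zero_l (V := F)) in H.
Qed.

(** On [X] the norm is a priori a seminorm pulled back along [U]; injectivity of [U] makes it
    definite. *)
Lemma transfer_normed : is_normed_space X.
Proof.
  repeat apply conj; auto.
  - intros x Hx. rewrite <- Uiso by auto. apply ns_ge_0; auto.
  - intros x Hx H. apply Uinj; auto. rewrite transfer_zero. apply (ns_eq_0 Y HY); auto.
    now rewrite Uiso.
  - intros a x Hx. rewrite <- !Uiso, (proj2 Ulin) by auto. apply ns_nrm_scal; auto.
  - intros x y Hx Hy. rewrite <- !Uiso, (proj1 Ulin) by auto. apply ns_triangle; auto.
Qed.

Lemma transfer_complete : is_complete Y -> is_complete X.
Proof.
  intros C u Hu HC. destruct (C (fun n => U (u n))) as [l [Hl HL]].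
  - intros n. now apply Uinto.
  - intros e He. destruct (HC e He) as [N HN]. exists N. intros m n Hm Hn.
    rewrite <- transfer_nrm_minus by auto. now apply HN.
  - destruct (Uonto l Hl) as [x [Hx <-]]. exists x. split; auto.
    intros e He. destruct (HL e He) as [N HN]. exists N. intros n Hn.
    rewrite transfer_nrm_minus by auto. now apply HN.
Qed.

Lemma transfer_separable : separable Y -> separable X.
Proof.
  intros [v [Hv HV]].
  destruct (choice (fun n x => carrier X x /\ U x = v n)) as [u Hu].
  { intros n. apply Uonto, Hv. }
  exists u. split; [intros n; apply Hu|]. intros x Hx e He.
  destruct (HV (U x) (Uinto x Hx) e He) as [n Hn]. exists n.
  rewrite transfer_nrm_minus by (auto; apply Hu). now rewrite (proj2 (Hu n)).
Qed.

Lemma transfer_uniformly_convex_ball : uniformly_convex_ball Y -> uniformly_convex_ball X.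
Proof.
  intros H e He. destruct (H e He) as [d [Hd K]]. exists d. split; auto.
  intros x y Hx Hy Hx1 Hy1 Hs. rewrite transfer_nrm_minus by auto.
  rewrite <- Uiso in Hx1, Hy1, Hs by auto.
  rewrite (proj2 Ulin), (proj1 Ulin) in Hs by auto. apply K; auto.
Qed.

End Transfer.

(** * Hardy spaces *)

Lemma hol_plus f h : hol f -> hol h -> hol (fun z => f z + h z)%C.
Proof.
  intros Hf Hh z Hz. destruct (Hf z Hz) as [l Hl]. destruct (Hh z Hz) as [m Hm].
  eexists. apply cdiff_plus; eauto.
Qed.

Lemma hol_minus f h : hol f -> hol h -> hol (fun z => f z - h z)%C.
Proof.
  intros Hf Hh z Hz. destruct (Hf z Hz) as [l Hl]. destruct (Hh z Hz) as [m Hm].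
  eexists. apply cdiff_minus; eauto.
Qed.

Lemma hol_scal c f : hol f -> hol (fun z => c * f z)%C.
Proof. intros Hf z Hz. destruct (Hf z Hz) as [l Hl]. eexists. apply cdiff_scal; eauto. Qed.

Lemma holomorphic_disc_plus f h : holomorphic_disc f -> holomorphic_disc h ->
  holomorphic_disc (fun z => f z + h z)%C.
Proof.
  intros Hf Hh. apply hol_holomorphic_disc.
  - apply hol_plus; now apply holomorphic_disc_hol.
  - intros z Hz. rewrite (holomorphic_disc_out f), (holomorphic_disc_out h) by auto. ring.
Qed.

Lemma holomorphic_disc_scal c f : holomorphic_disc f -> holomorphic_disc (fun z => c * f z)%C.
Proof.
  intros Hf. apply hol_holomorphic_disc.
  - apply hol_scal; now apply holomorphic_disc_hol.
  - intros z Hz. rewrite (holomorphic_disc_out f) by auto. ring.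
Qed.

Lemma holomorphic_disc_zero : holomorphic_disc (fun _ => RtoC 0).
Proof.
  apply hol_holomorphic_disc; auto. intros z _. eexists. apply cdiff_const.
Qed.

Lemma Hardy_hol p f : carrier (Hardy p) f -> hol f.
Proof. intros [H _]. now apply holomorphic_disc_hol. Qed.

Lemma Hardy_growth p f a : exponent p -> carrier (Hardy p) f -> Cmod a < 1 ->
  Cmod (f a) <= 4 / (1 - Cmod a) * nrm (Hardy p) f.
Proof.
  intros Hp H Ha. apply (hardy_le_growth p); auto.
  - eapply Hardy_hol; eauto.
  - now apply Hardy_nrm_ge_0.
  - now apply Hardy_nrm_hardy_le.
Qed.

Lemma Hardy_plus_le p f h s t : exponent p -> carrier (Hardy p) f -> carrier (Hardy p) h ->
  0 <= s -> 0 <= t -> hardy_le p f s -> hardy_le p h t ->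
  carrier (Hardy p) (fun z => f z + h z)%C /\ nrm (Hardy p) (fun z => f z + h z)%C <= s + t.
Proof.
  intros Hp Cf Ch Hs Ht Bf Bh. apply hardy_le_Hardy; auto; [|lra|].
  - apply holomorphic_disc_plus; [apply Cf|apply Ch].
  - apply hardy_le_plus; auto; eapply Hardy_hol; eauto.
Qed.

Lemma Hardy_scal_le p f c : exponent p -> carrier (Hardy p) f ->
  carrier (Hardy p) (fun z => c * f z)%C /\
  nrm (Hardy p) (fun z => c * f z)%C <= Cmod c * nrm (Hardy p) f.
Proof.
  intros Hp Cf. assert (h := Hardy_nrm_ge_0 p f Hp Cf). assert (hc := Cmod_ge_0 c).
  apply hardy_le_Hardy; auto.
  - apply holomorphic_disc_scal, Cf.
  - now apply Rmult_le_pos.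
  - apply hardy_le_scal; auto; [eapply Hardy_hol; eauto|]. now apply Hardy_nrm_hardy_le.
Qed.

Lemma Hardy_normed p : exponent p -> is_normed_space (Hardy p).
Proof.
  intros Hp. refine (conj _ (conj _ (conj _ (conj _ (conj _ (conj _ _)))))).
  - apply (hardy_le_Hardy p (fun _ => RtoC 0) 0); auto using holomorphic_disc_zero; [lra|].
    apply hardy_le_bounded; auto; [|lra|].
    + apply holomorphic_disc_hol, holomorphic_disc_zero.
    + intros z _. rewrite Cmod_0. lra.
  - intros f h Cf Ch.
    apply (Hardy_plus_le p f h (nrm (Hardy p) f) (nrm (Hardy p) h));
      auto using Hardy_nrm_ge_0, Hardy_nrm_hardy_le.
  - intros c f Cf. now apply Hardy_scal_le.
  - intros f. now apply Hardy_nrm_ge_0.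
  - intros f Cf H0. apply functional_extensionality. intros z. change (f z = RtoC 0).
    destruct (Rlt_dec (Cmod z) 1) as [h|h].
    + apply Cmod_eq_0. assert (G := Hardy_growth p f z Hp Cf h).
      assert (G0 := Cmod_ge_0 (f z)). rewrite H0 in G. lra.
    + apply Cf. exact h.
  - intros c f Cf. apply Rle_antisym; [now apply Hardy_scal_le|].
    destruct (Ceq_dec c 0) as [->|n].
    + rewrite Cmod_0, Rmult_0_l. apply Hardy_nrm_ge_0; auto.
      apply (Hardy_scal_le p f 0); auto.
    + assert (Hc : 0 < Cmod c) by now apply Cmod_gt_0.
      assert (K := proj2 (Hardy_scal_le p _ (/ c)%C Hp (proj1 (Hardy_scal_le p f c Hp Cf)))).
      assert (Q : (fun z => (/ c * (c * f z))%C) = f).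
      { apply functional_extensionality; intros z.
        now rewrite Cmult_assoc, Cinv_l, Cmult_1_l by auto. }
      assert (K' : nrm (Hardy p) f <= Cmod (/ c) * nrm (Hardy p) (scal c f)).
      { eapply Rle_trans; [|exact K]. right. symmetry. exact (f_equal (nrm (Hardy p)) Q). }
      clear K. rename K' into K. rewrite Cmod_inv in K by auto.
      apply (Rmult_le_compat_l (Cmod c)) in K; [|lra].
      rewrite <- Rmult_assoc, Rinv_r, Rmult_1_l in K by lra. exact K.
  - intros f h Cf Ch.
    apply (Hardy_plus_le p f h (nrm (Hardy p) f) (nrm (Hardy p) h));
      auto using Hardy_nrm_ge_0, Hardy_nrm_hardy_le.
Qed.

(** * Completeness of the Hardy spaces *)

Lemma complex_cauchy (v : nat -> C) :
  (forall e, 0 < e -> exists N, forall m n, (N <= m)%nat -> (N <= n)%nat -> Cmod (v m - v n) < e) ->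
  exists l, forall e, 0 < e -> exists N, forall n, (N <= n)%nat -> Cmod (v n - l) <= e.
Proof.
  intros H.
  destruct (Rcomplete.R_complete (fun n => fst (v n))) as [x Hx].
  { intros e He. destruct (H e He) as [N HN]. exists N. intros m n Hm Hn.
    eapply Rle_lt_trans; [|apply (HN m n); auto]. apply (Cmod_fst_le (v m - v n)%C). }
  destruct (Rcomplete.R_complete (fun n => snd (v n))) as [y Hy].
  { intros e He. destruct (H e He) as [N HN]. exists N. intros m n Hm Hn.
    eapply Rle_lt_trans; [|apply (HN m n); auto]. apply (Cmod_snd_le (v m - v n)%C). }
  exists (x, y). intros e He.
  destruct (Hx (e / 2) ltac:(lra)) as [N1 H1]. destruct (Hy (e / 2) ltac:(lra)) as [N2 H2].
  exists (N1 + N2)%nat. intros n Hn.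
  specialize (H1 n ltac:(lia)). specialize (H2 n ltac:(lia)).
  unfold Rdist in *. eapply Rle_trans; [apply Cmod_le_add|]. simpl. unfold Rminus in *. lra.
Qed.

(** The growth estimate makes a Cauchy sequence locally uniformly Cauchy, so it has a holomorphic
    limit [f]. The bound on [u m - u n] passes to [f - u n] by [hardy_le_approx]. *)
Lemma Hardy_complete p : exponent p -> is_complete (Hardy p).
Proof.
  intros Hp u Hu HC.
  assert (HN := Hardy_normed p Hp).
  assert (Hdiff : forall m n, carrier (Hardy p) (fun z => u m z - u n z)%C).
  { intros m n. exact (ns_minus (Hardy p) HN (u m) (u n) (Hu m) (Hu n)). }
  assert (HG : forall m n z, Cmod z < 1 ->
    Cmod (u m z - u n z) <= 4 / (1 - Cmod z) * nrm (Hardy p) (minus (u m) (u n))).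
  { intros m n z Hz. exact (Hardy_growth p _ z Hp (Hdiff m n) Hz). }
  assert (HU : forall r e, r < 1 -> 0 < e -> exists N, forall m n z, (N <= m)%nat -> (N <= n)%nat ->
     Cmod z <= r -> Cmod (u m z - u n z) < e).
  { intros r e Hr He. destruct (HC (e * (1 - r) / 4)) as [N K].
    { apply Rdiv_lt_0_compat; [apply Rmult_lt_0_compat; lra|lra]. }
    exists N. intros m n z Hm Hn Hz. specialize (K m n Hm Hn).
    eapply Rle_lt_trans; [apply HG; lra|].
    apply Rmult_lt_reg_l with (1 - Cmod z); [lra|].
    replace ((1 - Cmod z) * (4 / (1 - Cmod z) * nrm (Hardy p) (minus (u m) (u n)))) with
      (4 * nrm (Hardy p) (minus (u m) (u n))) by (field; lra).
    assert (e * (1 - r) <= (1 - Cmod z) * e) by nra. lra. }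
  destruct (choice (fun z l => forall e, 0 < e -> exists N, forall n, (N <= n)%nat ->
    Cmod (u n z - l) <= e)) as [f Hf].
  { intros z. destruct (Rlt_dec (Cmod z) 1) as [h|h].
    - apply complex_cauchy. intros e He. destruct (HU (Cmod z) e h He) as [N K].
      exists N. intros m n Hm Hn. apply K; auto. lra.
    (* Off the disc all terms are 0, so the limit respects the convention for H(D). *)
    - exists 0. intros e He. exists O. intros n _.
      rewrite (holomorphic_disc_out (u n)) by (try apply Hu; lra).
      replace (0 - 0)%C with (RtoC 0) by ring. rewrite Cmod_0. lra. }
  assert (HLU : locally_uniform u f).
  { intros r e Hr He. destruct (HU r (e / 2) Hr ltac:(lra)) as [N K].
    exists N. intros n z Hn Hz. destruct (Hf z (e / 2) ltac:(lra)) as [N' K'].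
    specialize (K n (N + N')%nat z Hn ltac:(lia) Hz). specialize (K' (N + N')%nat ltac:(lia)).
    eapply Rle_trans; [apply (Cmod_triangle_minus _ (u (N + N')%nat z))|]. lra. }
  assert (Hhol : hol f).
  { apply (hol_limit u); auto. intros n. eapply Hardy_hol; eauto. }
  assert (Hdisc : holomorphic_disc f).
  { apply hol_holomorphic_disc; auto. intros z Hz. apply Ceps_eq. intros e He.
    destruct (Hf z e He) as [N K]. specialize (K N (Nat.le_refl N)).
    rewrite (holomorphic_disc_out (u N)) in K by (try apply Hu; lra). now rewrite Cmod_minus_sym. }
  assert (Hlim : forall e, 0 < e -> exists N, forall n, (N <= n)%nat ->
    hardy_le p (fun z => f z - u n z)%C e).
  { intros e He. destruct (HC e He) as [N K]. exists N. intros n Hn.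
    apply hardy_le_approx; auto; [|lra|].
    - apply hol_minus; auto. eapply Hardy_hol; eauto.
    - intros r e' Hr He'. destruct (HLU r e' Hr He') as [N' K'].
      exists (fun z => u (N + N')%nat z - u n z)%C. repeat split.
      + apply hol_minus; eapply Hardy_hol; eauto.
      + apply Hardy_nrm_le; auto; [lra|]. apply Rlt_le, (K (N + N')%nat n); auto. lia.
      + intros z Hz.
        replace (f z - u n z - (u (N + N')%nat z - u n z))%C with (f z - u (N + N')%nat z)%C by ring.
        rewrite Cmod_minus_sym. apply K'; auto. lia. }
  assert (Cf : carrier (Hardy p) f).
  { destruct (Hlim 1 Rlt_0_1) as [N K]. specialize (K N (Nat.le_refl N)).
    apply Hardy_carrier; auto. split; auto.
    assert (h := Hardy_nrm_ge_0 p (u N) Hp (Hu N)).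
    exists (1 + nrm (Hardy p) (u N)). split; [lra|].
    replace f with (fun z => (f z - u N z) + u N z)%C.
    2: { apply functional_extensionality; intros z. ring. }
    apply hardy_le_plus; auto; try lra.
    - apply hol_minus; auto. eapply Hardy_hol; eauto.
    - eapply Hardy_hol; eauto.
    - now apply Hardy_nrm_hardy_le. }
  exists f. split; auto. intros e He.
  destruct (Hlim (e / 2) ltac:(lra)) as [N K]. exists N. intros n Hn.
  rewrite (ns_minus_sym (Hardy p) HN) by auto.
  apply Rle_lt_trans with (e / 2); [|lra].
  apply Hardy_nrm_le; auto; [|lra|].
  - now apply ns_minus.
  - exact (K n Hn).
Qed.

Lemma Hardy_banach p : exponent p -> is_banach (Hardy p).
Proof. intros Hp. split; [now apply Hardy_normed|now apply Hardy_complete]. Qed.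

(** * Uniform convexity of the Hardy spaces *)

Lemma half_sum (a b : C) : (RtoC (/ 2) * (a + b))%C = ((a + b) / 2)%C.
Proof. rewrite RtoC_inv by lra. unfold Cdiv. ring. Qed.

Lemma rpow_mean_uniform_convexity q e : 1 < q -> 0 < e -> exists K, 0 < K /\
  forall f h r, hol f -> hol h -> 0 <= r < 1 ->
    rpow_mean q (circle_abs (fun z => f z - h z)%C r) <=
      e * (rpow_mean q (circle_abs f r) + rpow_mean q (circle_abs h r))
      + K * ((rpow_mean q (circle_abs f r) + rpow_mean q (circle_abs h r)) / 2
             - rpow_mean q (circle_abs (fun z => RtoC (/ 2) * (f z + h z))%C r)).
Proof.
  intros Hq He. destruct (uniform_convexity_pointwise q e Hq He) as [K [HK P]].
  exists K. split; auto. intros f h r Hf Hh Hr.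
  set (w := (fun z => RtoC (/ 2) * (f z + h z))%C).
  assert (Hw : hol w) by (apply hol_scal, hol_plus; auto).
  assert (Cp : forall k, hol k -> rcontinuous (fun t => rpow (circle_abs k r t) q)).
  { intros k Hk. apply rcontinuous_rpow; [lra| |].
    - now apply rcontinuous_circle_abs.
    - intros; apply circle_abs_ge_0. }
  apply Rle_trans with (rmean (fun t =>
    1 * ((e + K / 2) * rpow (circle_abs f r t) q + (e + K / 2) * rpow (circle_abs h r t) q)
    + (- K) * rpow (circle_abs w r t) q)).
  - apply rmean_le.
    + apply Cp. now apply hol_minus.
    + exact (rcontinuous_lin _ _ 1 (- K)
        (rcontinuous_lin _ _ (e + K / 2) (e + K / 2) (Cp f Hf) (Cp h Hh)) (Cp w Hw)).
    + intros t. specialize (P (f (circle_point r t)) (h (circle_point r t))).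
      rewrite <- half_sum in P. unfold circle_abs, w. lra.
  - assert (C1 := rcontinuous_lin _ _ (e + K / 2) (e + K / 2) (Cp f Hf) (Cp h Hh)).
    rewrite (rmean_lin _ _ 1 (- K) C1 (Cp w Hw)).
    rewrite (rmean_lin _ _ _ _ (Cp f Hf) (Cp h Hh)).
    fold (rpow_mean q (circle_abs f r)). fold (rpow_mean q (circle_abs h r)).
    fold (rpow_mean q (circle_abs w r)). lra.
Qed.

Lemma rpow_one_minus_ge q d : 1 <= q -> 0 <= d <= 1 -> 1 - q * d <= rpow (1 - d) q.
Proof. intros Hq Hd. assert (B := bernoulli (1 - d) q Hq ltac:(lra)). lra. Qed.

Lemma not_hardy_le q f t : ~ hardy_le (Finite q) f t ->
  exists r, 0 <= r < 1 /\ rpow t q < rpow_mean q (circle_abs f r).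
Proof.
  intros H. apply NNPP. intros N. apply H. intros r Hr. apply Rnot_lt_le. intros h.
  apply N. now exists r.
Qed.

Lemma exponent_finite q : 1 <= q -> exponent (Finite q).
Proof. intros H. right. now exists q. Qed.

(** The means increase with the radius, so circles near the boundary decide. *)
Lemma hardy_le_of_large q f t r0 : 1 <= q -> hol f -> 0 <= r0 < 1 ->
  (forall r, r0 <= r < 1 -> rpow_mean q (circle_abs f r) <= rpow t q) ->
  hardy_le (Finite q) f t.
Proof.
  intros Hq Hf Hr0 H r Hr. destruct (Rle_dec r0 r) as [h|h].
  - apply H. lra.
  - eapply Rle_trans; [apply (rpow_mean_mono q f r r0); auto; lra|]. apply H; lra.
Qed.

(** A midpoint of norm above [1 - d] has a large mean on some circle [r0], hence on all larger ones.
    There the integrated inequality bounds the mean of the difference. *)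
Lemma Hardy_uniformly_convex_ball q : 1 < q -> uniformly_convex_ball (Hardy (Finite q)).
Proof.
  intros Hq e He. assert (Hp := exponent_finite q ltac:(lra)).
  assert (HN := Hardy_normed _ Hp).
  set (A := rpow (e / 2) q). assert (HA : 0 < A) by (apply rpow_pos; lra).
  destruct (rpow_mean_uniform_convexity q (A / 4) Hq ltac:(lra)) as [K [HK P]].
  (* By Bernoulli [(1 - d)^q >= 1 - q d], so the gap term is at most [K q d <= A / 2]. The other
     half of [A] pays for the term with coefficient [A / 4], whose two means are at most 1. *)
  set (d := Rmin (/ 2) (A / (2 * K * q))).
  assert (Hd0 : 0 < d).
  { apply Rmin_pos; [lra|]. apply Rdiv_lt_0_compat; auto. repeat apply Rmult_lt_0_compat; lra. }
  assert (Hd1 : d <= / 2) by apply Rmin_l. assert (Hd2 : d <= A / (2 * K * q)) by apply Rmin_r.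
  exists d. split; auto. intros x y Hx Hy Hx1 Hy1 Hs.
  assert (Hhx := Hardy_hol _ _ Hx). assert (Hhy := Hardy_hol _ _ Hy).
  set (w := (fun z => RtoC (/ 2) * (x z + y z))%C).
  assert (Hw : hol w) by (apply hol_scal, hol_plus; auto).
  assert (Cw : carrier (Hardy (Finite q)) w).
  { exact (ns_scal _ HN (RtoC (/ 2)) (plus x y) (ns_plus _ HN x y Hx Hy)). }
  destruct (not_hardy_le q w (1 - d)) as [r0 [Hr0 Hbig]].
  { intros B. apply (Hardy_nrm_le _ w (1 - d) Hp Cw) in B; [|lra].
    change (1 - d < nrm (Hardy (Finite q)) w) in Hs. lra. }
  apply Rle_lt_trans with (e / 2); [|lra].
  apply Hardy_nrm_le; auto; [now apply ns_minus|lra|].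
  change (hardy_le (Finite q) (fun z => x z - y z)%C (e / 2)).
  apply (hardy_le_of_large q _ _ r0); auto; [lra|now apply hol_minus|].
  intros r Hr. fold A.
  specialize (P x y r Hhx Hhy ltac:(lra)). fold w in P.
  assert (Bx := Hardy_nrm_hardy_le _ x Hp Hx r ltac:(lra)). cbv beta in Bx.
  assert (By := Hardy_nrm_hardy_le _ y Hp Hy r ltac:(lra)). cbv beta in By.
  assert (h1 := Hardy_nrm_ge_0 _ x Hp Hx). assert (h2 := Hardy_nrm_ge_0 _ y Hp Hy).
  assert (R1 := rpow_le _ 1 q ltac:(lra) (conj h1 Hx1)).
  assert (R2 := rpow_le _ 1 q ltac:(lra) (conj h2 Hy1)). rewrite rpow_1 in R1, R2.
  assert (Bw := rpow_mean_mono q w r0 r ltac:(lra) Hw ltac:(lra) ltac:(lra)).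
  assert (Bd := rpow_one_minus_ge q d ltac:(lra) ltac:(lra)).
  assert (Bqd : K * (q * d) <= A / 2).
  { apply (Rmult_le_compat_l (K * q)) in Hd2; [|apply Rmult_le_pos; lra].
    replace (K * q * (A / (2 * K * q))) with (A / 2) in Hd2 by (field; lra). lra. }
  set (mx := rpow_mean q (circle_abs x r)) in *. set (my := rpow_mean q (circle_abs y r)) in *.
  set (mw := rpow_mean q (circle_abs w r)) in *.
  assert (T1 : A / 4 * (mx + my) <= A / 4 * 2) by (apply Rmult_le_compat_l; lra).
  assert (T2 : K * ((mx + my) / 2 - mw) <= K * (q * d)) by (apply Rmult_le_compat_l; lra).
  lra.
Qed.

(** * Approximation by dilations *)

Definition dilation (s : R) (f : C -> C) : C -> C := fun z =>
  if Rlt_dec (Cmod z) 1 then f (RtoC s * z)%C else RtoC 0.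

Lemma Cmod_dilate s z : 0 <= s -> Cmod (RtoC s * z) = s * Cmod z.
Proof. intros Hs. now rewrite Cmod_mult, Cmod_RtoC. Qed.

Lemma holomorphic_disc_dilation s f : 0 <= s <= 1 -> hol f -> holomorphic_disc (dilation s f).
Proof.
  intros Hs Hf. apply hol_holomorphic_disc.
  - intros z Hz. assert (h := Cmod_ge_0 z).
    destruct (Hf (RtoC s * z)%C) as [l Hl]; [rewrite Cmod_dilate by lra; nra|].
    exists (l * (s * 1))%C.
    apply (cdiff_ext_loc (fun z => f (RtoC s * z))%C _ _ _ (1 - Cmod z)); [lra| |].
    + intros w Hw. apply ball_in_disc in Hw. unfold dilation.
      destruct (Rlt_dec (Cmod w) 1); [auto|lra].
    + apply (cdiff_comp f (fun z => RtoC s * z)%C); auto. apply cdiff_scal, cdiff_id.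
  - intros z Hz. unfold dilation. destruct (Rlt_dec (Cmod z) 1); auto. lra.
Qed.

Lemma circle_abs_dilation s f r : 0 <= r < 1 -> circle_abs (dilation s f) r = circle_abs f (s * r).
Proof.
  intros Hr. apply functional_extensionality. intros t. unfold circle_abs, dilation.
  rewrite Cmod_circle_point by lra. destruct (Rlt_dec r 1); [|lra].
  f_equal. f_equal. apply injective_projections; simpl; ring.
Qed.

Lemma hardy_le_dilation q f s t : 0 <= s <= 1 -> hardy_le (Finite q) f t ->
  hardy_le (Finite q) (dilation s f) t.
Proof.
  intros Hs H r Hr. rewrite circle_abs_dilation by auto. apply H. nra.
Qed.

(** On the disc of radius [r] the function is Lipschitz with constant [L], and [z] and [s z] differ
    by at most [1 - s]. *)
Lemma hol_dilation_close f p t r e : exponent p -> hol f -> 0 <= t -> hardy_le p f t ->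
  0 <= r < 1 -> 0 < e ->
  exists s, 0 < s < 1 /\ forall z, Cmod z <= r -> Cmod (f z - dilation s f z) <= e.
Proof.
  intros Hp Hf Ht B Hr He.
  set (r1 := (1 + r) / 2). assert (Hr1 : 0 < r1 < 1) by (unfold r1; lra).
  set (M := 4 / (1 - r1) * t).
  assert (HM : 0 <= M). { apply Rmult_le_pos; auto. apply Rdiv_le_0_compat; lra. }
  set (L := M * r1 / (r1 - r) ^ 2).
  assert (Hr1r : r < r1) by (unfold r1; lra).
  assert (HL : 0 <= L).
  { apply Rdiv_le_0_compat; [apply Rmult_le_pos; lra|]. apply pow_lt; lra. }
  set (s := 1 - Rmin (/ 2) (e / (L + 1))).
  assert (q0 : 0 < Rmin (/ 2) (e / (L + 1))).
  { apply Rmin_pos; [lra|]. apply Rdiv_lt_0_compat; lra. }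
  assert (q1 := Rmin_l (/ 2) (e / (L + 1))). assert (q2 := Rmin_r (/ 2) (e / (L + 1))).
  exists s. assert (Hs : 0 < s < 1) by (unfold s; lra). split; auto.
  intros z Hz. assert (hz := Cmod_ge_0 z). unfold dilation.
  destruct (Rlt_dec (Cmod z) 1); [|lra].
  eapply Rle_trans.
  - apply (hol_lipschitz f r1 r M); auto.
    + rewrite Cmod_dilate by lra. nra.
    + intros w Hw. unfold M. rewrite <- Hw. apply (hardy_le_growth p); auto. lra.
  - fold L.
    replace (z - RtoC s * z)%C with (RtoC (1 - s) * z)%C by (rewrite RtoC_minus; ring).
    rewrite Cmod_dilate by lra.
    assert ((1 - s) * (L + 1) <= e).
    { replace e with (e / (L + 1) * (L + 1)) by (field; lra).
      apply Rmult_le_compat_r; unfold s; lra. }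
    assert ((1 - s) * Cmod z <= 1 - s) by nra. nra.
Qed.

(* On a large circle the midpoint of [f] and its dilation has almost the norm of [f], so uniform
   convexity forces the two to be close. *)
Lemma dilation_dense q f e : 1 < q -> carrier (Hardy (Finite q)) f -> 0 < e ->
  exists s, 0 < s < 1 /\ hardy_le (Finite q) (fun z => f z - dilation s f z)%C e.
Proof.
  intros Hq Cf He. assert (Hp := exponent_finite q ltac:(lra)).
  assert (Hf := Hardy_hol _ _ Cf).
  set (N := nrm (Hardy (Finite q)) f).
  assert (HN0 : 0 <= N) by now apply Hardy_nrm_ge_0.
  assert (BN : hardy_le (Finite q) f N) by now apply Hardy_nrm_hardy_le.
  set (P := rpow N q). assert (HP : 0 <= P) by apply rpow_ge_0.
  set (A := rpow e q). assert (HA : 0 < A) by now apply rpow_pos.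
  (* Both means will be at most [P], so this coefficient contributes at most [A / 2]; the added 1
     covers [P = 0]. *)
  destruct (rpow_mean_uniform_convexity q (A / (4 * (P + 1))) Hq) as [K [HK U]].
  { apply Rdiv_lt_0_compat; lra. }
  assert (Main : exists r0 s, 0 <= r0 < 1 /\ 0 < s < 1 /\
    K * (P - rpow_mean q (circle_abs (fun z => RtoC (/ 2) * (f z + dilation s f z))%C r0)) <= A / 2).
  { destruct HN0 as [HNp|HN0].
    - set (d := Rmin (/ 2) (A / (2 * K * q * (P + 1)))).
      assert (Hden : 0 < 2 * K * q * (P + 1)) by (repeat apply Rmult_lt_0_compat; lra).
      assert (Hd0 : 0 < d).
      { apply Rmin_pos; [lra|]. now apply Rdiv_lt_0_compat. }
      assert (Hd1 : d <= / 2) by apply Rmin_l.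
      assert (Hd2 : d <= A / (2 * K * q * (P + 1))) by apply Rmin_r.
      (* Some circle shows a mean of [f] above level [s2]. The dilation is within [N d] of [f]
         there, so the midpoint is within [N d / 2 = s2 - s1] and its mean is at least at level
         [s1]. *)
      set (s1 := N * (1 - d)). set (s2 := N * (1 - d / 2)).
      assert (Hs1 : 0 <= s1) by (apply Rmult_le_pos; lra).
      assert (Hs12 : s2 - s1 = N * d / 2) by (unfold s1, s2; field).
      assert (HNd : 0 < N * d) by now apply Rmult_lt_0_compat.
      assert (Hs2 : s2 < N) by (unfold s2; nra).
      destruct (not_hardy_le q f s2) as [r0 [Hr0 Hbig]].
      { intros B. apply (Hardy_nrm_le _ f s2 Hp Cf) in B; [|lra]. fold N in B. lra. }
      destruct (hol_dilation_close f _ N r0 (N * d) Hp Hf ltac:(lra) BN Hr0 HNd) as [s [Hs Hc]].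
      exists r0, s. repeat split; auto; try lra.
      set (g := dilation s f) in *.
      assert (Hg : hol g).
      { apply holomorphic_disc_hol, holomorphic_disc_dilation; auto. lra. }
      set (w := (fun z => RtoC (/ 2) * (f z + g z))%C).
      assert (Hw : hol w) by (apply hol_scal, hol_plus; auto).
      assert (B1 : rpow s1 q <= rpow_mean q (circle_abs w r0)).
      { apply Rnot_lt_le. intros h. apply (Rlt_irrefl (rpow s2 q)).
        eapply Rlt_le_trans; [exact Hbig|].
        replace s2 with (s1 + N * d / 2) by lra.
        apply (minkowski q (circle_abs w r0) (fun _ => N * d / 2));
          auto using rcontinuous_circle_abs, circle_abs_ge_0, rcontinuous_const; try lra.
        - intros x. lra.
        - intros x. split; [apply Cmod_ge_0|]. unfold circle_abs.
          set (z := circle_point r0 x).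
          replace (f z) with (w z + RtoC (/ 2) * (f z - g z))%C.
          2: { unfold w. rewrite RtoC_inv by lra. field. }
          eapply Rle_trans; [apply Cmod_triangle|]. apply Rplus_le_compat_l.
          rewrite Cmod_dilate by lra.
          assert (h1 := Hc z ltac:(unfold z; rewrite Cmod_circle_point; lra)). lra.
        - unfold rpow_mean. rewrite rmean_const. lra. }
      unfold s1 in B1. rewrite rpow_mult in B1 by lra. fold P in B1.
      assert (Bd := rpow_one_minus_ge q d ltac:(lra) ltac:(lra)).
      assert (B2 : P * (1 - q * d) <= P * rpow (1 - d) q) by (apply Rmult_le_compat_l; lra).
      assert (B3 : K * (P * (q * d)) <= A / 2).
      { apply Rle_trans with (K * q * (P + 1) * d).
        - assert (0 <= K * q * d) by (repeat apply Rmult_le_pos; lra). lra.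
        - apply (Rmult_le_compat_l (K * q * (P + 1))) in Hd2;
            [|repeat apply Rmult_le_pos; lra].
          replace (K * q * (P + 1) * (A / (2 * K * q * (P + 1)))) with (A / 2) in Hd2
            by (field; lra). exact Hd2. }
      apply Rle_trans with (K * (P * (q * d))); auto. apply Rmult_le_compat_l; lra.
    (* For [N = 0] also [P = 0], and any radius and dilation will do. *)
    - exists 0, (/ 2). repeat split; try lra.
      assert (EP : P = 0) by (unfold P; rewrite <- HN0; apply rpow_0).
      assert (h := rpow_mean_ge_0 q (circle_abs (fun z => RtoC (/ 2) * (f z + dilation (/ 2) f z))%C 0)
        ltac:(lra)).
      assert (0 <= rpow_mean q (circle_abs (fun z => RtoC (/ 2) * (f z + dilation (/ 2) f z))%C 0)).
      { apply h.
        - apply rcontinuous_circle_abs; [|lra]. apply hol_scal, hol_plus; auto.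
          apply holomorphic_disc_hol, holomorphic_disc_dilation; auto. lra.
        - intros; apply circle_abs_ge_0. }
      rewrite EP. nra. }
  destruct Main as [r0 [s [Hr0 [Hs HM]]]]. exists s. split; auto.
  assert (Hg : hol (dilation s f)).
  { apply holomorphic_disc_hol, holomorphic_disc_dilation; auto. lra. }
  assert (Bg : hardy_le (Finite q) (dilation s f) N) by (apply hardy_le_dilation; auto; lra).
  set (g := dilation s f) in *.
  apply (hardy_le_of_large q _ _ r0); auto; [lra|now apply hol_minus|].
  intros r Hr. fold A.
  specialize (U f g r Hf Hg ltac:(lra)).
  set (w := (fun z => RtoC (/ 2) * (f z + g z))%C) in *.
  assert (Hw : hol w) by (apply hol_scal, hol_plus; auto).
  assert (Bw := rpow_mean_mono q w r0 r ltac:(lra) Hw ltac:(lra) ltac:(lra)).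
  specialize (BN r ltac:(lra)). specialize (Bg r ltac:(lra)). fold P in BN, Bg. cbv beta in BN, Bg.
  set (mf := rpow_mean q (circle_abs f r)) in *. set (mg := rpow_mean q (circle_abs g r)) in *.
  set (mw := rpow_mean q (circle_abs w r)) in *. set (m0 := rpow_mean q (circle_abs w r0)) in *.
  assert (T1 : A / (4 * (P + 1)) * (mf + mg) <= A / 2).
  { apply Rle_trans with (A / (4 * (P + 1)) * (2 * (P + 1))).
    - apply Rmult_le_compat_l; [apply Rdiv_le_0_compat; lra|lra].
    - right. field. lra. }
  assert (T2 : K * ((mf + mg) / 2 - mw) <= K * (P - m0)) by (apply Rmult_le_compat_l; lra).
  lra.
Qed.

(** * Polynomials and separability *)

Fixpoint cpoly (c : nat -> C) (n : nat) (a : C) : C :=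
  match n with
  | O => 0
  | S n => (cpoly c n a + c n * a ^ n)%C
  end.

Lemma cdiff_pow n a : exists l, cdiff (fun z => z ^ n)%C a l.
Proof.
  induction n as [|n [l IH]].
  - eexists. apply (cdiff_const 1).
  - eexists. apply (cdiff_mult (fun z => z) (fun z => z ^ n)%C); [apply cdiff_id|exact IH].
Qed.

Lemma hol_cpoly c n : hol (cpoly c n).
Proof.
  intros z Hz. induction n as [|n [l IH]]; simpl.
  - eexists. apply (cdiff_const 0).
  - destruct (cdiff_pow n z) as [m Hm]. eexists.
    exact (cdiff_plus _ _ _ _ _ IH (cdiff_scal (c n) _ _ _ Hm)).
Qed.

Lemma cpoly_diff_le c d n e a : 0 <= e -> Cmod a <= 1 ->
  (forall k, (k < n)%nat -> Cmod (c k - d k) <= e) ->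
  Cmod (cpoly c n a - cpoly d n a) <= INR n * e.
Proof.
  intros He Ha. induction n as [|n IH]; intros H; simpl cpoly.
  - replace (0 - 0)%C with (RtoC 0) by ring. rewrite Cmod_0. simpl. lra.
  - rewrite S_INR.
    replace (cpoly c n a + c n * a ^ n - (cpoly d n a + d n * a ^ n))%C with
      ((cpoly c n a - cpoly d n a) + (c n - d n) * a ^ n)%C by ring.
    eapply Rle_trans; [apply Cmod_triangle|]. rewrite Cmod_mult, Cmod_pow.
    assert (I := IH ltac:(intros; apply H; lia)). assert (J := H n ltac:(lia)).
    assert (p0 := Cmod_ge_0 a).
    assert (p1 : Cmod a ^ n <= 1) by (rewrite <- (pow1 n); apply pow_incr; lra).
    assert (p2 : 0 <= Cmod a ^ n) by now apply pow_le.
    assert (p3 := Cmod_ge_0 (c n - d n)). nra.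
Qed.

(** Expand the Cauchy kernel as a finite geometric sum: the remainder after [n] terms is the mean of
    [f(z) (a / z)^n z / (z - a)]. The coefficients depend neither on [n] nor on [a]. *)
Lemma hol_taylor f r M : hol f -> 0 < r < 1 -> (forall z, Cmod z = r -> Cmod (f z) <= M) ->
  exists c, forall n a, Cmod a < r ->
    Cmod (f a - cpoly c n a) <= M * ((Cmod a / r) ^ n * (r / (r - Cmod a))).
Proof.
  intros Hf Hr HM.
  assert (Hc := hol_circle f r Hf ltac:(lra)).
  assert (Hz : forall t, circle_point r t <> 0).
  { intros t. apply Cmod_pos_neq. rewrite Cmod_circle_point; lra. }
  assert (Hi : ccontinuous (fun t => / circle_point r t)%C).
  { apply ccontinuous_inv; auto. apply ccontinuous_circle_point. }
  set (c := fun n => cmean (fun t => f (circle_point r t) * (/ circle_point r t) ^ n)%C).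
  exists c.
  assert (Key : forall n a, Cmod a < r -> ccontinuous (fun t => f (circle_point r t) *
      ((a * / circle_point r t) ^ n * (circle_point r t * / (circle_point r t - a))))%C).
  { intros n a Ha. apply (ccontinuous_mult (fun t => f (circle_point r t))); [exact Hc|].
    apply (ccontinuous_mult (fun t => (a * / circle_point r t) ^ n)%C
      (fun t => circle_point r t * / (circle_point r t - a))%C).
    - apply (ccontinuous_pow (fun t => a * / circle_point r t)%C).
      exact (ccontinuous_mult _ _ (ccontinuous_const a) Hi).
    - apply (ccontinuous_mult (circle_point r)); [apply ccontinuous_circle_point|].
      apply ccontinuous_inv; [apply ccontinuous_circle_sub|].
      intros t. now apply circle_point_sub_neq. }
  assert (Rem : forall n a, Cmod a < r -> (f a - cpoly c n a)%C =
    cmean (fun t => f (circle_point r t) *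
      ((a * / circle_point r t) ^ n * (circle_point r t * / (circle_point r t - a))))%C).
  { intros n a Ha. induction n as [|n IH].
    - transitivity (f a); [simpl; ring|].
      rewrite <- (cauchy_formula f r a Hf Hr Ha) at 1. unfold circle_mean.
      apply cmean_ext. intros t. simpl. unfold Cdiv. ring.
    - simpl cpoly.
      replace (f a - (cpoly c n a + c n * a ^ n))%C with ((f a - cpoly c n a) - a ^ n * c n)%C by ring.
      rewrite IH. unfold c.
      assert (Cn : ccontinuous (fun t => f (circle_point r t) * (/ circle_point r t) ^ n)%C).
      { apply ccontinuous_mult; auto. now apply ccontinuous_pow. }
      rewrite <- (cmean_scal _ _ Cn).
      rewrite <- (cmean_minus _ _ (Key n a Ha) (ccontinuous_mult _ _ (ccontinuous_const (a ^ n)%C) Cn)).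
      apply cmean_ext. intros t. assert (n2 := circle_point_sub_neq r t a Ha).
      specialize (Hz t). set (z := circle_point r t) in *.
      rewrite Cpow_S, !Cpow_mult_l. field. auto. }
  intros n a Ha. rewrite Rem by auto. apply cmean_bound; [now apply Key|].
  intros t. assert (h0 := Cmod_ge_0 a).
  assert (g2 := circle_point_sub_ge r t a ltac:(lra)).
  rewrite !Cmod_mult, Cmod_pow, Cmod_mult, Cmod_inv, Cmod_circle_point by (auto; lra).
  assert (A2 : Cmod (/ (circle_point r t - a)) <= / (r - Cmod a)) by (apply Cmod_inv_le; lra).
  assert (Hp0 : 0 <= (Cmod a * / r) ^ n).
  { apply pow_le, Rmult_le_pos; auto. apply Rlt_le, Rinv_0_lt_compat; lra. }
  assert (Hq0 := Cmod_ge_0 (/ (circle_point r t - a))).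
  apply Rmult_le_compat; [apply Cmod_ge_0| |apply HM, Cmod_circle_point; lra|].
  - apply Rmult_le_pos; auto. apply Rmult_le_pos; lra.
  - apply Rmult_le_compat_l; auto. apply Rmult_le_compat_l; lra.
Qed.

(* Every [n] codes an infinite sequence, of which only a finite prefix can be prescribed. *)
Fixpoint decode (k n : nat) : nat :=
  match k with
  | O => fst (Cantor.of_nat n)
  | S k => decode k (snd (Cantor.of_nat n))
  end.

Lemma decode_surjective K : forall s : nat -> nat,
  exists n, forall k, (k < K)%nat -> decode k n = s k.
Proof.
  induction K as [|K IH]; intros s.
  - exists O. intros k Hk. lia.
  - destruct (IH (fun k => s (S k))) as [n Hn].
    exists (Cantor.to_nat (s O, n)). intros [|k] Hk; cbn [decode];
      rewrite Cantor.cancel_of_to; cbn [fst snd]; auto.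
    apply Hn. lia.
Qed.

(** Two naturals give a signed numerator, and [S M] a denominator that is never 0; for fixed [M] the
    values form a grid of mesh [/ INR (S M)]. *)
Definition rational (M x y : nat) : R := (INR x - INR y) / INR (S M).

Lemma rational_approx M t : exists x y, Rabs (t - rational M x y) <= / INR (S M).
Proof.
  assert (HM : 0 < INR (S M)) by (apply lt_0_INR; lia).
  set (u := t * INR (S M)). destruct (archimed u) as [A1 A2].
  exists (Z.to_nat (up u)), (Z.to_nat (- up u)).
  assert (E : INR (Z.to_nat (up u)) - INR (Z.to_nat (- up u)) = IZR (up u)).
  { rewrite !INR_IZR_INZ, <- minus_IZR. f_equal. lia. }
  unfold rational. rewrite E.
  replace (t - IZR (up u) / INR (S M)) with ((u - IZR (up u)) * / INR (S M)) by (unfold u; field; lra).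
  rewrite Rabs_mult, (Rabs_pos_eq (/ _)) by (apply Rlt_le, Rinv_0_lt_compat; auto).
  rewrite <- (Rmult_1_l (/ INR (S M))) at 2. apply Rmult_le_compat_r.
  - apply Rlt_le, Rinv_0_lt_compat; auto.
  - apply Rabs_le. lra.
Qed.

Definition gauss_rational (M code : nat) : C :=
  (rational M (decode 0 code) (decode 1 code), rational M (decode 2 code) (decode 3 code)).

Lemma gauss_rational_approx M c : exists code, Cmod (c - gauss_rational M code) <= 2 / INR (S M).
Proof.
  destruct (rational_approx M (fst c)) as [x1 [y1 H1]].
  destruct (rational_approx M (snd c)) as [x2 [y2 H2]].
  destruct (decode_surjective 4 (fun k => match k with 0 => x1 | 1 => y1 | 2 => x2 | _ => y2 end)%nat)
    as [n Hn].
  exists n. unfold gauss_rational. rewrite !Hn by lia.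
  eapply Rle_trans; [apply Cmod_le_add|]. simpl fst; simpl snd. unfold Rminus in *.
  unfold Rdiv. lra.
Qed.

(** Of the sequence coded by [n], entry 0 is the number of coefficients, entry 1 fixes the common
    denominator, and the entries from 2 on code the coefficients. *)
Definition dense_poly (n : nat) : C -> C := fun z =>
  if Rlt_dec (Cmod z) 1
  then cpoly (fun k => gauss_rational (decode 1 n) (decode (S (S k)) n)) (decode 0 n) z
  else RtoC 0.

Lemma holomorphic_disc_restrict f : hol f ->
  holomorphic_disc (fun z => if Rlt_dec (Cmod z) 1 then f z else RtoC 0).
Proof.
  intros Hf. apply hol_holomorphic_disc.
  - intros z Hz. destruct (Hf z Hz) as [l Hl]. exists l.
    apply (cdiff_ext_loc f _ _ _ (1 - Cmod z)); [lra| |auto].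
    intros w Hw. apply ball_in_disc in Hw. destruct (Rlt_dec (Cmod w) 1); [auto|lra].
  - intros z Hz. destruct (Rlt_dec (Cmod z) 1); auto. lra.
Qed.

Lemma Hardy_dense_poly p n : exponent p -> carrier (Hardy p) (dense_poly n).
Proof.
  intros Hp. unfold dense_poly. set (c := fun k => gauss_rational (decode 1 n) (decode (S (S k)) n)). set (m := decode 0 n).
  assert (Hd := holomorphic_disc_restrict _ (hol_cpoly c m)).
  assert (Hb : exists B, 0 <= B /\ forall z, Cmod z <= 1 -> Cmod (cpoly c m z) <= B).
  { clearbody c m. clear Hd. induction m as [|k [B [HB IH]]]; simpl.
    - exists 0. split; [lra|]. intros z _. rewrite Cmod_0. lra.
    - exists (B + Cmod (c k)). split; [assert (h := Cmod_ge_0 (c k)); lra|]. intros z Hz.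
      eapply Rle_trans; [apply Cmod_triangle|]. rewrite Cmod_mult, Cmod_pow.
      assert (p1 : Cmod z ^ k <= 1).
      { rewrite <- (pow1 k). apply pow_incr. split; [apply Cmod_ge_0|auto]. }
      assert (h := Cmod_ge_0 (c k)). specialize (IH z Hz). nra. }
  destruct Hb as [B [HB Hb]].
  apply (hardy_le_Hardy p _ B); auto. apply hardy_le_bounded; auto.
  - now apply holomorphic_disc_hol.
  - intros z Hz. destruct (Rlt_dec (Cmod z) 1); [|lra]. apply Hb. lra.
Qed.

(** Take the Taylor polynomials of [f] on a circle of radius [r > s] and absorb the powers of [s]
    into the coefficients: they converge on the whole disc like [(s / r)^m]. Once the degree is
    fixed, the coefficients can be rounded. *)
Lemma dilation_dense_poly p f s e : exponent p -> carrier (Hardy p) f -> 0 < s < 1 -> 0 < e ->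
  exists n, forall z, Cmod z < 1 -> Cmod (dilation s f z - dense_poly n z) <= e.
Proof.
  intros Hp Cf Hs He. assert (Hf := Hardy_hol _ _ Cf).
  set (r := (1 + s) / 2). assert (Hr : 0 < r < 1) by (unfold r; lra).
  assert (Hsr : s < r) by (unfold r; lra).
  set (M := 4 / (1 - r) * nrm (Hardy p) f).
  assert (HN := Hardy_nrm_ge_0 p f Hp Cf).
  assert (HM : 0 <= M). { apply Rmult_le_pos; auto. apply Rdiv_le_0_compat; lra. }
  destruct (hol_taylor f r M Hf Hr) as [c Hc].
  { intros z Hz. unfold M. rewrite <- Hz. apply Hardy_growth; auto. lra. }
  set (B := M * (r / (r - s)) + 1).
  assert (HB0 : 0 <= M * (r / (r - s))).
  { apply Rmult_le_pos; auto. apply Rdiv_le_0_compat; lra. }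
  assert (Hq : 0 <= s / r < 1).
  { split; [apply Rdiv_le_0_compat; lra|]. apply Rlt_div_l; lra. }
  destruct (pow_lt_1_zero (s / r) ltac:(rewrite Rabs_pos_eq; lra) (e / (2 * B)))
    as [m Hm]. { apply Rdiv_lt_0_compat; unfold B; lra. }
  specialize (Hm m (Nat.le_refl m)). rewrite Rabs_pos_eq in Hm by (apply pow_le; lra).
  set (d := fun k => (c k * RtoC s ^ k)%C).
  assert (Ed : forall n z, cpoly c n (RtoC s * z)%C = cpoly d n z).
  { intros n z. induction n as [|n IH]; simpl; auto. rewrite IH, Cpow_mult_l. unfold d. ring. }
  assert (HmI : 0 < INR m + 1) by (assert (h := pos_INR m); lra).
  (* Each of the [m] coefficients is rounded with error at most [2 / INR (S M0)], so all together
     cost at most [e / 2]. *)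
  destruct (inv_INR_small (e / (4 * (INR m + 1)))) as [M0 HM0].
  { apply Rdiv_lt_0_compat; lra. }
  specialize (HM0 M0 (Nat.le_refl M0)).
  destruct (choice (fun k code => Cmod (d k - gauss_rational M0 code) <= 2 / INR (S M0)))
    as [code Hcode]. { intros k. apply gauss_rational_approx. }
  destruct (decode_surjective (S (S m))
    (fun k => match k with O => m | S O => M0 | S (S k) => code k end)) as [n Hn].
  exists n. intros z Hz. assert (hz := Cmod_ge_0 z).
  unfold dilation, dense_poly. destruct (Rlt_dec (Cmod z) 1); [|lra].
  rewrite (Hn O), (Hn 1%nat) by lia.
  eapply Rle_trans; [apply (Cmod_triangle_minus _ (cpoly d m z))|].
  assert (T1 : Cmod (f (RtoC s * z)%C - cpoly d m z) <= e / 2).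
  { rewrite <- Ed.
    assert (Hsz : Cmod (RtoC s * z) <= s) by (rewrite Cmod_dilate by lra; nra).
    eapply Rle_trans; [apply Hc; lra|].
    set (a := Cmod (RtoC s * z)) in *. assert (ha : 0 <= a) by apply Cmod_ge_0.
    apply Rle_trans with (M * ((s / r) ^ m * (r / (r - s)))).
    - apply Rmult_le_compat_l; auto.
      assert (Hir : 0 < / r) by (apply Rinv_0_lt_compat; lra).
      assert (Har : 0 <= a / r <= s / r).
      { unfold Rdiv. split; [apply Rmult_le_pos; lra|apply Rmult_le_compat_r; lra]. }
      apply Rmult_le_compat.
      + apply pow_le; lra.
      + apply Rdiv_le_0_compat; lra.
      + apply pow_incr; auto.
      + unfold Rdiv. apply Rmult_le_compat_l; [lra|]. apply Rinv_le_contravar; lra.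
    - apply Rle_trans with (B * (s / r) ^ m).
      + assert (0 <= (s / r) ^ m) by (apply pow_le; lra). unfold B. lra.
      + apply (Rmult_lt_compat_l B) in Hm; [|unfold B; lra].
        replace (B * (e / (2 * B))) with (e / 2) in Hm by (field; unfold B; lra). lra. }
  assert (T2 : Cmod (cpoly d m z - cpoly (fun k => gauss_rational M0 (decode (S (S k)) n)) m z)
     <= e / 2).
  { eapply Rle_trans.
    - apply (cpoly_diff_le _ _ m (2 / INR (S M0))).
      + apply Rdiv_le_0_compat; [lra|]. apply lt_0_INR; lia.
      + lra.
      + intros k Hk. rewrite Hn by lia. apply Hcode.
    - apply Rle_trans with ((INR m + 1) * (2 * (e / (4 * (INR m + 1))))).
      + apply Rmult_le_compat; try lra.
        * apply pos_INR.
        * apply Rdiv_le_0_compat; [lra|]. apply lt_0_INR; lia.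
      + right. field. lra. }
  lra.
Qed.

Lemma Hardy_separable q : 1 < q -> separable (Hardy (Finite q)).
Proof.
  intros Hq. assert (Hp := exponent_finite q ltac:(lra)).
  exists dense_poly. split; [intros n; now apply Hardy_dense_poly|].
  intros f Cf e He.
  destruct (dilation_dense q f (e / 3) Hq Cf ltac:(lra)) as [s [Hs Hd]].
  destruct (dilation_dense_poly _ f s (e / 3) Hp Cf Hs ltac:(lra)) as [n Hn].
  exists n.
  assert (Hf := Hardy_hol _ _ Cf).
  assert (Hg : hol (dilation s f)).
  { apply holomorphic_disc_hol, holomorphic_disc_dilation; auto. lra. }
  assert (Hu := Hardy_hol _ _ (Hardy_dense_poly _ n Hp)).
  apply Rle_lt_trans with (e / 3 + e / 3); [|lra].
  assert (He3 : 0 <= e / 3) by lra.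
  assert (B := hardy_le_plus _ _ _ _ _ Hp (hol_minus _ _ Hf Hg) (hol_minus _ _ Hg Hu)
    He3 He3 Hd (hardy_le_bounded _ _ _ Hp (hol_minus _ _ Hg Hu) He3 Hn)).
  apply Hardy_nrm_le; auto; [|lra|].
  - apply ns_minus; auto; [now apply Hardy_normed|now apply Hardy_dense_poly].
  - replace (minus f (dense_poly n)) with
      (fun z => (f z - dilation s f z) + (dilation s f z - dense_poly n z))%C; auto.
    apply functional_extensionality. intros z.
    change ((f z - dilation s f z + (dilation s f z - dense_poly n z))%C =
      (f z - dense_poly n z)%C). ring.
Qed.

(** * The operators V and T *)

Lemma RInt_Cint F a b : a <= b -> ccurve_on F a b ->
  RInt (V := C_R_CompleteNormedModule) F a b = Cint F a b.
Proof.
  intros Hab H. apply (is_RInt_unique (V := C_R_CompleteNormedModule)).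
  apply (is_RInt_fct_extend_pair (U := R_NormedModule) (V := R_NormedModule)).
  - apply (RInt_correct (V := R_CompleteNormedModule)). now apply (ccurve_on_ex_fst F).
  - apply (RInt_correct (V := R_CompleteNormedModule)). now apply (ccurve_on_ex_snd F).
Qed.

Definition ray (k : C -> C) (z : C) (t : R) : C := (k (RtoC t * z) * z)%C.

Lemma ccurve_ray k z t : hol k -> Rabs t * Cmod z < 1 -> ccurve (ray k z) t.
Proof.
  intros Hk Ht. apply (ccurve_mult (fun t => k (RtoC t * z)%C) (fun _ => z)).
  - apply (ccurve_comp k (fun t => RtoC t * z)%C).
    + apply (ccurve_mult RtoC (fun _ => z)); [|apply ccurve_const].
      apply (ccurve_RtoC (fun s => s)), rcont_id.
    + apply hol_ccont; auto. now rewrite Cmod_mult, Cmod_R.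
  - apply ccurve_const.
Qed.

Lemma ccurve_on_ray k z a b : hol k -> Cmod z < 1 -> 0 <= a -> b <= 1 -> ccurve_on (ray k z) a b.
Proof.
  intros Hk Hz Ha Hb t Ht. apply ccurve_ray; auto.
  rewrite Rabs_pos_eq by lra. assert (h := Cmod_ge_0 z). nra.
Qed.

Lemma segment_integral_Cint k z : hol k -> Cmod z < 1 ->
  segment_integral k z = Cint (ray k z) 0 1.
Proof.
  intros Hk Hz. apply (RInt_Cint (ray k z)); [lra|]. apply ccurve_on_ray; auto; lra.
Qed.

Lemma hol_mult f h : hol f -> hol h -> hol (fun z => f z * h z)%C.
Proof.
  intros Hf Hh z Hz. destruct (Hf z Hz) as [l Hl]. destruct (Hh z Hz) as [m Hm].
  eexists. apply cdiff_mult; eauto.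
Qed.

Definition weight (g f : C -> C) : C -> C := fun z => (f z * C_derive g z)%C.

Lemma hol_weight g f : hol g -> hol f -> hol (weight g f).
Proof. intros Hg Hf. apply hol_mult; auto. now apply hol_C_derive. Qed.

Lemma V_op_in g f z : hol g -> hol f -> Cmod z < 1 -> V_op g f z = Cint (ray (weight g f) z) 0 1.
Proof.
  intros Hg Hf Hz. unfold V_op. destruct (Rlt_dec (Cmod z) 1) as [_|n]; [|lra].
  apply segment_integral_Cint; auto. now apply hol_weight.
Qed.

Lemma V_op_out g f z : 1 <= Cmod z -> V_op g f z = RtoC 0.
Proof. intros Hz. unfold V_op. destruct (Rlt_dec (Cmod z) 1); auto. lra. Qed.

Lemma T_op_0 g f : T_op g f 0 = (f (RtoC 0) * C_derive g (RtoC 0))%C.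
Proof. unfold T_op. destruct (Req_EM_T (Cmod 0) 0) as [_|n]; auto. now rewrite Cmod_0 in n. Qed.

Lemma T_op_neq g f z : z <> RtoC 0 -> T_op g f z = (/ z * V_op g f z)%C.
Proof.
  intros Hz. unfold T_op. destruct (Req_EM_T (Cmod z) 0) as [e|n]; auto.
  now apply Cmod_eq_0 in e.
Qed.

Lemma T_op_out g f z : 1 <= Cmod z -> T_op g f z = RtoC 0.
Proof.
  intros Hz. rewrite T_op_neq by (apply Cmod_pos_neq; lra). rewrite V_op_out by auto. ring.
Qed.

Lemma V_op_T_op g f z : hol g -> hol f -> V_op g f z = (z * T_op g f z)%C.
Proof.
  intros Hg Hf. destruct (Ceq_dec z 0) as [->|n].
  - rewrite V_op_in by (auto; rewrite Cmod_0; lra).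
    rewrite (Cint_ext _ (fun _ => RtoC 0)), Cint_const; [ring|lra|].
    intros t _. unfold ray. ring.
  - rewrite T_op_neq by auto. field. auto.
Qed.

Lemma V_op_plus g f h z : hol g -> hol f -> hol h ->
  V_op g (fun z => f z + h z)%C z = (V_op g f z + V_op g h z)%C.
Proof.
  intros Hg Hf Hh. destruct (Rlt_dec (Cmod z) 1) as [Hz|Hz].
  - rewrite !V_op_in by (auto; now apply hol_plus).
    rewrite <- Cint_plus; [|lra| |].
    + apply Cint_ext; [lra|]. intros t _. unfold ray, weight. ring.
    + apply ccurve_on_ray; auto; try lra. now apply hol_weight.
    + apply ccurve_on_ray; auto; try lra. now apply hol_weight.
  - rewrite !V_op_out by lra. ring.
Qed.

Lemma V_op_scal g f c z : hol g -> hol f -> V_op g (fun z => c * f z)%C z = (c * V_op g f z)%C.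
Proof.
  intros Hg Hf. destruct (Rlt_dec (Cmod z) 1) as [Hz|Hz].
  - rewrite !V_op_in by (auto; now apply hol_scal).
    rewrite <- Cint_scal; [|lra|].
    + apply Cint_ext; [lra|]. intros t _. unfold ray, weight. ring.
    + apply ccurve_on_ray; auto; try lra. now apply hol_weight.
  - rewrite !V_op_out by lra. ring.
Qed.

Lemma T_op_plus g f h : hol g -> hol f -> hol h ->
  T_op g (fun z => f z + h z)%C = (fun z => T_op g f z + T_op g h z)%C.
Proof.
  intros Hg Hf Hh. apply functional_extensionality. intros z.
  destruct (Ceq_dec z 0) as [->|n].
  - rewrite !T_op_0. ring.
  - rewrite !T_op_neq, V_op_plus by auto. ring.
Qed.

Lemma T_op_scal g f c : hol g -> hol f ->
  T_op g (fun z => c * f z)%C = (fun z => c * T_op g f z)%C.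
Proof.
  intros Hg Hf. apply functional_extensionality. intros z.
  destruct (Ceq_dec z 0) as [->|n].
  - rewrite !T_op_0. ring.
  - rewrite !T_op_neq, V_op_scal by auto. ring.
Qed.

(** * Injectivity and surjectivity of [T_op] *)

Lemma RInt_scale (u : R -> R) s : ex_RInt u 0 s ->
  RInt (fun t => s * u (s * t + 0)) 0 1 = RInt u 0 s.
Proof.
  intros H. assert (E0 : s * 0 + 0 = 0) by ring. assert (E1 : s * 1 + 0 = s) by ring.
  assert (G := RInt_comp_lin (V := R_CompleteNormedModule) u s 0 0 1).
  rewrite E0, E1 in G. exact (G H).
Qed.

(** Moving the point along its ray is the same as moving the upper limit of integration, with
    respect to which one can differentiate. *)
Lemma Cint_ray_scale k z s : hol k -> Cmod z < 1 -> 0 <= s <= 1 ->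
  Cint (ray k (RtoC s * z)) 0 1 = Cint (ray k z) 0 s.
Proof.
  intros Hk Hz Hs.
  assert (E : forall t, ray k (RtoC s * z) t = (RtoC s * ray k z (s * t + 0))%C).
  { intros t. unfold ray. rewrite Rplus_0_r, RtoC_mult.
    replace (RtoC s * RtoC t * z)%C with (RtoC t * (RtoC s * z))%C by ring. ring. }
  assert (G := ccurve_on_ray k z 0 s Hk Hz (Rle_refl 0) (proj2 Hs)).
  unfold Cint. f_equal.
  - rewrite <- (RInt_scale (fun t => fst (ray k z t)) s)
      by (apply (ccurve_on_ex_fst (ray k z)); [lra|auto]).
    apply RInt_ext. intros t _. rewrite E. eq_in_R. simpl. ring.
  - rewrite <- (RInt_scale (fun t => snd (ray k z t)) s)
      by (apply (ccurve_on_ex_snd (ray k z)); [lra|auto]).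
    apply RInt_ext. intros t _. rewrite E. eq_in_R. simpl. ring.
Qed.

Lemma derive_RInt_eq (u v : R -> R) s : 0 < s < 1 ->
  (forall t, 0 <= t <= 1 -> rcont u t) -> (forall t, 0 <= t <= 1 -> rcont v t) ->
  (forall t, 0 < t < 1 -> RInt u 0 t = RInt v 0 t) -> u s = v s.
Proof.
  intros Hs Hu Hv H.
  assert (Loc : forall P : R -> Prop, (forall t, 0 < t < 1 -> P t) -> locally s P).
  { intros P HP. exists (mkposreal (Rmin s (1 - s)) ltac:(apply Rmin_pos; lra)).
    intros t Ht. apply HP.
    assert (Ht' : Rabs (t - s) < Rmin s (1 - s)) by exact Ht.
    assert (h1 := Rlt_le_trans _ _ _ Ht' (Rmin_l _ _)).
    assert (h2 := Rlt_le_trans _ _ _ Ht' (Rmin_r _ _)).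
    apply Rabs_lt_between in h1. apply Rabs_lt_between in h2. lra. }
  rewrite <- (Derive_RInt u 0 s).
  - rewrite <- (Derive_RInt v 0 s).
    + apply Derive_ext_loc. now apply Loc.
    + apply Loc. intros t Ht. apply ex_RInt_rcont; [lra|]. intros x Hx. apply Hv; lra.
    + apply Hv; lra.
  - apply Loc. intros t Ht. apply ex_RInt_rcont; [lra|]. intros x Hx. apply Hu; lra.
  - apply Hu; lra.
Qed.

(** Put [w = s z] with [z] farther out on the same ray. Then [s] is interior to the unit interval,
    and differentiating both integrals in the upper limit at [s] recovers the integrands. *)
Lemma segment_integral_inj k h : hol k -> hol h ->
  (forall z, Cmod z < 1 -> z <> RtoC 0 -> Cint (ray k z) 0 1 = Cint (ray h z) 0 1) ->
  forall w, Cmod w < 1 -> w <> RtoC 0 -> k w = h w.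
Proof.
  intros Hk Hh H w Hw Hw0. assert (m0 : 0 < Cmod w) by now apply Cmod_gt_0.
  set (s := (1 + Cmod w) / 2). assert (Hs : 0 < s < 1) by (unfold s; lra).
  assert (Hsn : RtoC s <> 0) by (apply RtoC_neq; lra).
  set (z := (w / RtoC s)%C).
  assert (Ew : (RtoC s * z)%C = w) by (unfold z; field; auto).
  assert (Hz0 : z <> 0). { intros e. apply Hw0. rewrite <- Ew, e. ring. }
  assert (Hz : Cmod z < 1).
  { unfold z. rewrite Cmod_div, Cmod_RtoC by (auto; lra).
    apply Rlt_div_l; [lra|].
    unfold s; lra. }
  assert (E : forall t, 0 < t < 1 -> Cint (ray k z) 0 t = Cint (ray h z) 0 t).
  { intros t Ht. rewrite <- (Cint_ray_scale k z t), <- (Cint_ray_scale h z t) by (auto; lra). apply H.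
    - rewrite Cmod_mult, Cmod_RtoC by lra. assert (q := Cmod_ge_0 z). nra.
    - apply Cmult_neq_0; auto. apply RtoC_neq; lra. }
  assert (Ck := ccurve_on_ray k z 0 1 Hk Hz (Rle_refl 0) (Rle_refl 1)).
  assert (Ch := ccurve_on_ray h z 0 1 Hh Hz (Rle_refl 0) (Rle_refl 1)).
  assert (R : ray k z s = ray h z s).
  { apply injective_projections.
    - apply (derive_RInt_eq (fun t => fst (ray k z t)) (fun t => fst (ray h z t))); auto.
      + intros t Ht. apply (Ck t Ht).
      + intros t Ht. apply (Ch t Ht).
      + intros t Ht. exact (f_equal fst (E t Ht)).
    - apply (derive_RInt_eq (fun t => snd (ray k z t)) (fun t => snd (ray h z t))); auto.
      + intros t Ht. apply (Ck t Ht).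
      + intros t Ht. apply (Ch t Ht).
      + intros t Ht. exact (f_equal snd (E t Ht)). }
  unfold ray in R. rewrite Ew in R.
  apply (f_equal (fun x => x / z)%C) in R.
  replace (k w * z / z)%C with (k w) in R by (field; auto).
  replace (h w * z / z)%C with (h w) in R by (field; auto). exact R.
Qed.

(** Away from 0 the primitives determine [f g']; at 0 the value of [T_op] is [f(0) g'(0)] itself.
    Then divide by [g']. *)
Lemma T_op_inj g f h : hol g -> (forall z, Cmod z < 1 -> C_derive g z <> RtoC 0) ->
  holomorphic_disc f -> holomorphic_disc h -> T_op g f = T_op g h -> f = h.
Proof.
  intros Hg Hg0 Hf Hh E.
  assert (Hf' := holomorphic_disc_hol f Hf). assert (Hh' := holomorphic_disc_hol h Hh).
  apply functional_extensionality. intros w.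
  destruct (Rlt_dec (Cmod w) 1) as [Hw|Hw].
  2: { rewrite (holomorphic_disc_out f), (holomorphic_disc_out h) by (auto; lra). reflexivity. }
  assert (W : weight g f w = weight g h w).
  { destruct (Ceq_dec w 0) as [->|n].
    - assert (E0 := f_equal (fun F => F (RtoC 0)) E). simpl in E0. now rewrite !T_op_0 in E0.
    - apply segment_integral_inj; auto using hol_weight. intros z Hz Hz0.
      rewrite <- !V_op_in by auto.
      rewrite !V_op_T_op by auto. now rewrite E. }
  unfold weight in W. apply (f_equal (fun x => x / C_derive g w)%C) in W.
  assert (N := Hg0 w Hw).
  replace (f w * C_derive g w / C_derive g w)%C with (f w) in W by (field; auto).
  replace (h w * C_derive g w / C_derive g w)%C with (h w) in W by (field; auto). exact W.
Qed.

Lemma is_derive_fst_ray w z t l : cdiff w (RtoC t * z) l ->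
  is_derive (fun s => fst (w (RtoC s * z)%C)) t (fst (l * z)%C).
Proof.
  intros H. apply is_derive_Reals. intros e He.
  destruct (H (e / (2 * (Cmod z + 1)))) as [d [Hd K]].
  { apply Rdiv_lt_0_compat; auto. assert (h := Cmod_ge_0 z). lra. }
  assert (hz := Cmod_ge_0 z).
  assert (Hd' : 0 < d / (Cmod z + 1)) by (apply Rdiv_lt_0_compat; lra).
  exists (mkposreal _ Hd'). intros h Hh0 Hh. simpl in Hh.
  assert (Ez : (RtoC (t + h) * z - RtoC t * z)%C = (RtoC h * z)%C) by (rewrite RtoC_plus; ring).
  specialize (K (RtoC (t + h) * z)%C). rewrite Ez, Cmod_mult, Cmod_R in K.
  assert (hp : 0 < Rabs h) by now apply Rabs_pos_lt.
  assert (Hlt : Rabs h * Cmod z < d).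
  { apply Rlt_div_r in Hh; nra. }
  specialize (K Hlt).
  set (D := (w (RtoC (t + h) * z) - w (RtoC t * z) - l * (RtoC h * z))%C) in *.
  assert (F := Cmod_fst_le D).
  replace ((fst (w (RtoC (t + h) * z)%C) - fst (w (RtoC t * z)%C)) / h - fst (l * z)%C) with
    (fst D / h) by (unfold D; simpl; field; auto).
  unfold Rdiv. rewrite Rabs_mult, Rabs_inv.
  apply Rmult_lt_reg_r with (Rabs h); auto. rewrite Rmult_assoc, Rinv_l by lra.
  apply Rle_lt_trans with (e / (2 * (Cmod z + 1)) * (Rabs h * Cmod z)); [lra|].
  apply Rle_lt_trans with (e / 2 * Rabs h); [|nra].
  replace (e / 2 * Rabs h) with (e / (2 * (Cmod z + 1)) * (Rabs h * (Cmod z + 1))) by (field; lra).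
  apply Rmult_le_compat_l; [apply Rdiv_le_0_compat; lra|nra].
Qed.

Lemma is_derive_snd_ray w z t l : cdiff w (RtoC t * z) l ->
  is_derive (fun s => snd (w (RtoC s * z)%C)) t (snd (l * z)%C).
Proof.
  intros H.
  assert (H' := is_derive_fst_ray _ z t _ (cdiff_scal (- Ci)%C w _ _ H)).
  replace (fst (- Ci * l * z)%C) with (snd (l * z)%C) in H' by (simpl; ring).
  revert H'. apply is_derive_ext. intros s. simpl. ring.
Qed.

Lemma Cint_ray_derive w z : hol w -> Cmod z < 1 ->
  Cint (ray (C_derive w) z) 0 1 = (w z - w (RtoC 0))%C.
Proof.
  intros Hw Hz. assert (h := Cmod_ge_0 z).
  assert (Hin : forall t, Rmin 0 1 <= t <= Rmax 0 1 -> Cmod (RtoC t * z) < 1).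
  { intros t Ht. rewrite Rmin_left, Rmax_right in Ht by lra.
    rewrite Cmod_mult, Cmod_RtoC by lra. nra. }
  assert (CC := ccurve_on_ray (C_derive w) z 0 1 (hol_C_derive w Hw) Hz (Rle_refl 0) (Rle_refl 1)).
  assert (E0 : (RtoC 0 * z)%C = 0) by ring. assert (E1 : (RtoC 1 * z)%C = z) by ring.
  apply injective_projections.
  - apply is_RInt_unique.
    assert (P := is_RInt_derive (V := R_CompleteNormedModule) (fun t => fst (w (RtoC t * z)%C))
      (fun t => fst (ray (C_derive w) z t)) 0 1). cbv beta in P. rewrite E0, E1 in P. apply P.
    + intros t Ht. apply (is_derive_fst_ray w z t (C_derive w (RtoC t * z)%C)).
      apply hol_cdiff; auto.
    + intros t Ht. rewrite Rmin_left, Rmax_right in Ht by lra. exact (proj1 (CC t Ht)).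
  - apply is_RInt_unique.
    assert (P := is_RInt_derive (V := R_CompleteNormedModule) (fun t => snd (w (RtoC t * z)%C))
      (fun t => snd (ray (C_derive w) z t)) 0 1). cbv beta in P. rewrite E0, E1 in P. apply P.
    + intros t Ht. apply (is_derive_snd_ray w z t (C_derive w (RtoC t * z)%C)).
      apply hol_cdiff; auto.
    + intros t Ht. rewrite Rmin_left, Rmax_right in Ht by lra. exact (proj2 (CC t Ht)).
Qed.

Lemma hol_div f h : hol f -> hol h -> (forall z, Cmod z < 1 -> h z <> RtoC 0) ->
  hol (fun z => f z / h z)%C.
Proof.
  intros Hf Hh Hn z Hz. destruct (Hf z Hz) as [l Hl]. destruct (Hh z Hz) as [m Hm].
  eexists. apply cdiff_div; eauto.
Qed.

(** Integrating [w' = (z h)'] along the segment returns [z h(z)], with no constant of integration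
    because [w] vanishes at 0. *)
Lemma T_op_onto g h : hol g -> (forall z, Cmod z < 1 -> C_derive g z <> RtoC 0) ->
  holomorphic_disc h -> exists f, holomorphic_disc f /\ T_op g f = h.
Proof.
  intros Hg Hg0 Hh. assert (Hh' := holomorphic_disc_hol h Hh).
  set (w := (fun z => z * h z)%C). assert (Hw : hol w) by now apply hol_mul_id.
  set (q := (fun z => C_derive w z / C_derive g z)%C).
  assert (Hq : hol q) by (apply hol_div; auto using hol_C_derive).
  set (f := fun z => if Rlt_dec (Cmod z) 1 then q z else RtoC 0).
  assert (Hf : holomorphic_disc f) by now apply holomorphic_disc_restrict.
  exists f. split; auto. assert (Hf' := holomorphic_disc_hol f Hf).
  assert (W : forall z, Cmod z < 1 -> weight g f z = C_derive w z).
  { intros z Hz. unfold weight, f, q. destruct (Rlt_dec (Cmod z) 1); [|lra].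
    field. now apply Hg0. }
  apply functional_extensionality. intros z.
  destruct (Rlt_dec (Cmod z) 1) as [Hz|Hz].
  2: { rewrite T_op_out by lra. symmetry. apply holomorphic_disc_out; auto. lra. }
  destruct (Ceq_dec z 0) as [->|n].
  (* The special value at the origin fits, since [(z h)'] equals [h 0] there. *)
  - rewrite T_op_0. change (weight g f 0 = h 0). rewrite W by auto.
    apply cdiff_C_derive. apply (cdiff_eq _ _ (1 * h 0 + 0 * C_derive h 0)%C); [|ring].
    apply (cdiff_mult (fun z => z)); [apply cdiff_id|]. now apply hol_cdiff.
  - rewrite T_op_neq, V_op_in by auto.
    rewrite (Cint_ext _ (ray (C_derive w) z)).
    + rewrite Cint_ray_derive by auto. unfold w. field. auto.
    + lra.
    + intros t Ht. unfold ray. rewrite W; auto.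
      rewrite Cmod_mult, Cmod_RtoC by lra. assert (h0 := Cmod_ge_0 z). nra.
Qed.

(** This identifies the separately defined value [T_op g f 0] with the value that removes the
    singularity of [V_op g f z / z]. *)
Lemma cdiff_V_op_0 g f : hol g -> hol f -> cdiff (V_op g f) 0 (weight g f 0).
Proof.
  intros Hg Hf e He. set (k := weight g f). assert (Hk : hol k) by now apply hol_weight.
  destruct (hol_ccont k 0 Hk ltac:(rewrite Cmod_0; lra) e He) as [d [Hd K]].
  exists (Rmin d 1). split; [apply Rmin_pos; lra|]. intros z Hz.
  destruct (Rlt_Rmin _ _ _ Hz) as [h1 h2].
  rewrite (V_op_T_op g f 0) by auto.
  replace (z - 0)%C with z in * by ring.
  rewrite V_op_in by auto. fold k.
  replace (Cint (ray k z) 0 1 - 0 * T_op g f 0 - k 0 * z)%C with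
    (Cint (ray k z) 0 1 - Cint (fun _ => k 0 * z)%C 0 1)%C.
  2: { rewrite Cint_const. replace (1 - 0) with 1 by ring. ring. }
  rewrite <- Cint_minus; [|lra|apply ccurve_on_ray; auto; lra|intros t _; apply ccurve_const].
  replace (e * Cmod z) with ((1 - 0) * (e * Cmod z)) by ring.
  apply Cint_bound; [lra| |].
  - apply ccurve_on_minus; [apply ccurve_on_ray; auto; lra|intros t _; apply ccurve_const].
  - intros t Ht. unfold ray.
    replace (k (RtoC t * z) * z - k 0 * z)%C with ((k (RtoC t * z) - k 0) * z)%C by ring.
    rewrite Cmod_mult. apply Rmult_le_compat_r; [apply Cmod_ge_0|].
    apply Rlt_le, K. replace (RtoC t * z - 0)%C with (RtoC t * z)%C by ring.
    rewrite Cmod_mult, Cmod_RtoC by lra. assert (q := Cmod_ge_0 z). nra.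
Qed.

Lemma V_op_T_op_fun g f : hol g -> hol f -> V_op g f = (fun z => z * T_op g f z)%C.
Proof. intros Hg Hf. apply functional_extensionality. intros z. now apply V_op_T_op. Qed.

(** Multiplying by [z] is harmless; conversely [V_op g f] vanishes at 0 and the quotient by [z] has
    a removable singularity. *)
Lemma holomorphic_disc_V_T g f : hol g -> hol f ->
  holomorphic_disc (V_op g f) <-> holomorphic_disc (T_op g f).
Proof.
  intros Hg Hf. split; intros H.
  - apply hol_holomorphic_disc; [|intros z Hz; now apply T_op_out].
    assert (HV := holomorphic_disc_hol _ H).
    assert (V0 : V_op g f 0 = 0) by (rewrite V_op_T_op by auto; ring).
    assert (R := hol_removable _ HV V0).
    replace (T_op g f) with (fun z => if Ceq_dec z 0 then C_derive (V_op g f) 0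
      else (V_op g f z / z)%C); auto.
    apply functional_extensionality. intros z. destruct (Ceq_dec z 0) as [->|n].
    + rewrite T_op_0. apply cdiff_C_derive. exact (cdiff_V_op_0 g f Hg Hf).
    + rewrite T_op_neq by auto. unfold Cdiv. ring.
  - rewrite V_op_T_op_fun by auto. apply hol_holomorphic_disc.
    + now apply hol_mul_id, holomorphic_disc_hol.
    + intros z Hz. rewrite T_op_out by auto. ring.
Qed.

Lemma Hardy_V_T p g f : exponent p -> hol g -> hol f ->
  (carrier (Hardy p) (V_op g f) <-> carrier (Hardy p) (T_op g f)) /\
  (carrier (Hardy p) (V_op g f) -> nrm (Hardy p) (V_op g f) = nrm (Hardy p) (T_op g f)).
Proof.
  intros Hp Hg Hf.
  assert (LE : hol (T_op g f) -> forall t, 0 <= t ->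
    hardy_le p (V_op g f) t <-> hardy_le p (T_op g f) t).
  { intros HT t Ht. rewrite V_op_T_op_fun by auto. now apply hardy_le_mul_id. }
  assert (EQ : carrier (Hardy p) (V_op g f) <-> carrier (Hardy p) (T_op g f)).
  { rewrite !Hardy_carrier by auto. rewrite holomorphic_disc_V_T by auto.
    split; intros [H [t [Ht B]]]; split; auto; exists t; split; auto;
    apply LE; auto; now apply holomorphic_disc_hol. }
  split; auto. intros CV. assert (CT := proj1 EQ CV).
  assert (HT := Hardy_hol _ _ CT).
  assert (n1 := Hardy_nrm_ge_0 _ _ Hp CV). assert (n2 := Hardy_nrm_ge_0 _ _ Hp CT).
  apply Rle_antisym; apply Hardy_nrm_le; auto; apply LE; auto; now apply Hardy_nrm_hardy_le.
Qed.

Theorem proposition3p15 (p : Rbar) (g : C -> C)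
    (hp : Rbar_le 1 p)
    (hg : holomorphic_disc g)
    (hg' : forall z : C, unit_disc z -> 0 < Cmod (C_derive g z))
    (hT : continuous_between (Hardy p) (Hardy p) (T_op g)) :
  (same_nspace (optimal_domain (V_op g) (Hardy p)) (optimal_domain (T_op g) (Hardy p)) /\
   is_banach (optimal_domain (T_op g) (Hardy p)) /\
   isometric (optimal_domain (T_op g) (Hardy p)) (Hardy p) /\
   (Rbar_lt 1 p -> Rbar_lt p p_infty ->
      separable (optimal_domain (T_op g) (Hardy p)) /\
      uniformly_convex (optimal_domain (T_op g) (Hardy p)) /\
      reflexive_space (optimal_domain (T_op g) (Hardy p)))) /\
  (~ maps_onto (Hardy p) (Hardy p) (T_op g) ->
   (forall f : C -> C,
      carrier (Hardy p) f -> carrier (optimal_domain (T_op g) (Hardy p)) f) /\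
   exists f : C -> C,
     carrier (optimal_domain (T_op g) (Hardy p)) f /\ ~ carrier (Hardy p) f).
Proof.
  assert (Hp := exponent_of_le p hp). assert (Hg := holomorphic_disc_hol g hg).
  assert (Hg0 : forall z, Cmod z < 1 -> C_derive g z <> RtoC 0).
  { intros z Hz. apply Cmod_gt_0. now apply hg'. }
  set (X := optimal_domain (T_op g) (Hardy p)). set (Y := Hardy p).
  assert (HY : is_banach Y) by now apply Hardy_banach.
  assert (HYn := proj1 HY).
  assert (Lin : linear_on X (F := fct_ModuleSpace C C_ModuleSpace) (T_op g)).
  { split.
    - intros f h [Hf _] [Hh _]. apply T_op_plus; auto; now apply holomorphic_disc_hol.
    - intros c f [Hf _]. apply T_op_scal; auto; now apply holomorphic_disc_hol. }
  assert (Xscal : forall (c : C) f, carrier X f -> carrier X (scal c f)).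
  { intros c f Cf. split; [now apply holomorphic_disc_scal, Cf|].
    rewrite (proj2 Lin c f Cf). apply (ns_scal Y HYn), Cf. }
  assert (Xplus : forall f h, carrier X f -> carrier X h -> carrier X (plus f h)).
  { intros f h Cf Ch. split; [apply holomorphic_disc_plus; [apply Cf|apply Ch]|].
    rewrite (proj1 Lin f h Cf Ch). apply (ns_plus Y HYn); [apply Cf|apply Ch]. }
  assert (Into : maps_into X Y (T_op g)) by (intros f Cf; apply Cf).
  assert (Onto : maps_onto X Y (T_op g)).
  { intros h Ch. destruct (T_op_onto g h Hg Hg0 (proj1 Ch)) as [f [Hf E]].
    exists f. split; auto. split; auto. rewrite E. exact Ch. }
  assert (Inj : forall f h, carrier X f -> carrier X h -> T_op g f = T_op g h -> f = h).
  { intros f h Cf Ch. apply T_op_inj; auto; [apply Cf|apply Ch]. }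
  assert (Iso : forall f, carrier X f -> nrm Y (T_op g f) = nrm X f) by reflexivity.
  (* Scaling a preimage of 0 by the scalar 0 spares a computation of [T_op g] at the zero
     function. *)
  assert (X0 : carrier X zero).
  { destruct (Onto zero (ns_zero Y HYn)) as [f [Cf _]].
    rewrite <- (scal_zero_l (K := C_Ring) f). now apply Xscal. }
  assert (HX : is_banach X).
  { split; [now apply (transfer_normed X Y (T_op g))|].
    apply (transfer_complete X Y (T_op g)); auto. apply HY. }
  split; [split; [|split; [exact HX|split]]|].
  - split.
    + intros f. split; intros [Hf CV]; (split; [exact Hf|]);
      apply (proj1 (Hardy_V_T p g f Hp Hg (holomorphic_disc_hol f Hf))); exact CV.
    + intros f [Hf CV].
      exact (proj2 (Hardy_V_T p g f Hp Hg (holomorphic_disc_hol f Hf)) CV).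
  - exists (T_op g). auto.
  - intros h1 h2. destruct p as [q| |]; try easy. simpl in h1.
    assert (UC : uniformly_convex_ball X).
    { apply (transfer_uniformly_convex_ball X Y (T_op g)); auto.
      now apply Hardy_uniformly_convex_ball. }
    split; [|split].
    + apply (transfer_separable X Y (T_op g)); auto. now apply Hardy_separable.
    + now apply uniformly_convex_of_ball.
    + now apply milman_pettis.
  - intros N. split.
    + intros f Cf. split; [apply Cf|]. now apply hT.
    (* [T_op g] already maps the optimal domain onto [H^p]. If no member of that domain lay outside
       [H^p], every preimage would lie in [H^p] and [T_op g] would be onto from [H^p] itself. *)
    + apply NNPP. intros M. apply N. intros h Ch.
      destruct (Onto h Ch) as [f [Cf E]]. exists f. split; auto.
      apply NNPP. intros Nf. apply M. now exists f.
Qed.
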